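(* Let $f$ be an inner function on the open unit disc $\mathbb D$ of $\mathbb C$, let $\mathbb T=\partial\mathbb D$ be endowed with the normalized Lebesgue measure $\lambda$, and let $T_f$ be the (bounded) composition operator $\varphi\mapsto\varphi\circ f$ on $L^2(\mathbb T)=L^2(\mathbb T,d\lambda)$, where $f$ also denotes its boundary map. The following conditions are equivalent: (i) $T_f$ is topologically transitive on $L^2(\mathbb T)$; (ii) $T_f$ is topologically mixing on $L^2(\mathbb T)$; (iii) $f$ is an automorphism of the disc $\mathbb D$ with no fixed point in $\mathbb D$.
   Context: A holomorphic function $f:\mathbb D\to\mathbb D$ is inner if its radial limits $f^*(\xi)=\lim_{r\to1^-}f(r\xi)$ (which exist for almost every $\xi\in\mathbb T$ by Fatou's theorem) have modulus $1$ for almost every $\xi\in\mathbb T$. The radial limits define a map $f^*:\mathbb T\to\mathbb T$ up to a set of zero Lebesgue measure, again denoted by $f$; the composition operator $T_f\varphi=\varphi\circ f^*$ is bounded on $L^2(\mathbb T,d\lambda)$. An automorphism of $\mathbb D$ is a bijective holomorphic map $\mathbb D\to\mathbb D$. A bounded linear operator $T$ on a Banach space $\mathcal X$ is topologically transitive if for any nonempty open sets $U,V\subset\mathcal X$ there exists an integer $k\ge0$ with $T^k(U)\cap V\ne\emptyset$; it is topologically mixing if for any such $U,V$ there exists $k_0\ge0$ with $T^k(U)\cap V\neq\emptyset$ for every $k\ge k_0$. *)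

(* Defs.v *)
From HB Require Import structures.
From mathcomp Require Import all_boot all_order all_algebra.
From mathcomp Require Import generic_quotient ring_quotient.
From mathcomp Require Import all_classical all_reals all_analysis.
From mathcomp Require Import measurable_realfun.
From mathcomp Require Import complex.

Set Implicit Arguments.
Unset Strict Implicit.
Unset Printing Implicit Defensive.

Import Order.TTheory GRing.Theory Num.Theory numFieldNormedType.Exports.
Import ComplexField.Normc.

Local Open Scope classical_set_scope.
Local Open Scope complex_scope.
Local Open Scope quotient_scope.
Local Open Scope ring_scope.

(* R[i] as a normed space over itself: with this structure, derivable f z 1
   is complex differentiability of f at z. *)
HB.instance Definition _ (R : realType) := NormedModule.copy R[i] R[i]^o.

(* The Borel sigma-algebra of R[i], transported from R * R. *)
Definition complex_pair (R : realType) (z : R[i]) : R * R := (complex.Re z, complex.Im z).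
HB.instance Definition _ (R : realType) := @isMeasurable.Build
  default_measure_display R[i] (g_sigma_algebra_preimage (@complex_pair R))
  (@measurable0 _ (g_sigma_algebra_preimageType (@complex_pair R)))
  (@measurableC _ (g_sigma_algebra_preimageType (@complex_pair R)))
  (@bigcupT_measurable _ (g_sigma_algebra_preimageType (@complex_pair R))).

Section complex_measurability.
Context d (T : measurableType d) (R : realType).
Implicit Types f g : T -> R[i].

Lemma measurable_complexP f : measurable_fun setT f <->
  measurable_fun setT (fun x => complex.Re (f x)) /\
  measurable_fun setT (fun x => complex.Im (f x)).
Proof.
rewrite -(measurable_fun_pairP (@complex_pair R \o f)); split=> mf.
- move=> _ B mB; rewrite setTI comp_preimage -[X in measurable X]setTI.
  by apply: mf => //; exists B => //; rewrite setTI.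
- move=> _ _ [B mB <-]; rewrite !setTI -comp_preimage -[X in measurable X]setTI.
  exact: mf.
Qed.

Lemma measurable_funDc f g : measurable_fun setT f -> measurable_fun setT g ->
  measurable_fun setT (f + g).
Proof.
move=> /measurable_complexP[f1 f2] /measurable_complexP[g1 g2].
apply/measurable_complexP; split.
- rewrite (_ : (fun _ => _) = (fun x => complex.Re (f x)) \+ (fun x => complex.Re (g x))).
    exact: measurable_funD.
  by apply/funext => x; rewrite /= !fctE; case: (f x) (g x) => [a b] [c e].
- rewrite (_ : (fun _ => _) = (fun x => complex.Im (f x)) \+ (fun x => complex.Im (g x))).
    exact: measurable_funD.
  by apply/funext => x; rewrite /= !fctE; case: (f x) (g x) => [a b] [c e].
Qed.

Lemma measurable_funZc (a : R[i]) f : measurable_fun setT f ->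
  measurable_fun setT (a *: f).
Proof.
move=> /measurable_complexP[f1 f2]; case: a => a b.
apply/measurable_complexP; split.
- rewrite (_ : (fun _ => _) =
      (cst a \* (fun x => complex.Re (f x))) \- (cst b \* (fun x => complex.Im (f x)))).
    by apply: measurable_funB; apply: measurable_funM.
  by apply/funext => x; rewrite /= !fctE; case: (f x).
- rewrite (_ : (fun _ => _) =
      (cst a \* (fun x => complex.Im (f x))) \+ (cst b \* (fun x => complex.Re (f x)))).
    by apply: measurable_funD; apply: measurable_funM.
  by apply/funext => x; rewrite /= !fctE; case: (f x).
Qed.

Lemma measurable_normc f : measurable_fun setT f ->
  measurable_fun setT (fun x => normc (f x)).
Proof.
move=> /measurable_complexP[f1 f2].
rewrite (_ : (fun _ => _) =
    @Num.sqrt R \o (fun x => complex.Re (f x) ^+ 2 + complex.Im (f x) ^+ 2)).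
  apply: measurableT_comp.
    by apply: continuous_measurable_fun; exact: sqrt_continuous.
  by apply: measurable_funD; apply: measurable_funX.
by apply/funext => x /=; case: (f x).
Qed.

End complex_measurability.

Section Lnorm2.
Context d (T : measurableType d) (R : realType).
Variable mu : {measure set T -> \bar R}.

Lemma le_Lnorm2 (u v : T -> R) :
  measurable_fun setT u -> measurable_fun setT v ->
  {ae mu, forall x, `|u x| <= `|v x|} ->
  ('N[mu]_2%:E[EFin \o u] <= 'N[mu]_2%:E[EFin \o v])%E.
Proof.
move=> mu_ mv uv; rewrite unlock /=.
have ge0 (h : T -> R) : (0 <= \int[mu]_x (`|h x| `^ 2)%:E)%E.
  by apply: integral_ge0 => x _; rewrite lee_fin powR_ge0.
have mn (h : T -> R) : measurable_fun setT h ->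
    measurable_fun setT (fun x => (`|h x| `^ 2)%:E).
  move=> mh; apply/measurable_EFinP.
  apply: (@measurableT_comp _ _ _ _ _ _ (@powR R ^~ 2)) => //.
  exact: measurableT_comp.
apply: gt0_ler_poweR; rewrite ?in_itv /= ?invr_ge0 ?ge0 ?leey//.
apply: ae_ge0_le_integral => //; [exact: mn|exact: mn|].
by apply: filterS uv => x uvx _; rewrite lee_fin ge0_ler_powR ?nnegrE.
Qed.

End Lnorm2.

(* The space of complex-valued square-integrable functions, then its quotient
   by equality almost everywhere. *)
Section L2.
Context d (T : measurableType d) (R : realType).
Variable mu : {measure set T -> \bar R}.
Implicit Types f g : T -> R[i].

Definition L2norm f := ('N[mu]_2%:E[EFin \o (fun x => normc (f x))])%E.

Definition sqint : {pred T -> R[i]} :=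
  mem [set f | measurable_fun setT f /\ (L2norm f < +oo)%E].

Let le12 : (1 <= 2%:E :> \bar R)%E. Proof. by rewrite lee_fin ler1n. Qed.

Lemma normc_norm (z : R[i]) : `|normc z| = normc z.
Proof. by rewrite ger0_norm//; case: z => a b; rewrite /= sqrtr_ge0. Qed.

Lemma L2norm_ae f g : measurable_fun setT f -> measurable_fun setT g ->
  {ae mu, forall x, f x = g x} -> L2norm f = L2norm g.
Proof.
move=> mf mg fg; apply/eqP; rewrite eq_le; apply/andP; split;
  (apply: le_Lnorm2; [exact: measurable_normc..|]);
  by apply: filterS fg => x ->.
Qed.

Lemma L2normD f g : measurable_fun setT f -> measurable_fun setT g ->
  (L2norm (f + g)%R <= L2norm f + L2norm g)%E.
Proof.
move=> mf mg.
have mnf := measurable_normc mf; have mng := measurable_normc mg.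
apply: le_trans (eminkowski mu mnf mng le12).
apply: le_Lnorm2.
- by apply: measurable_normc; exact: measurable_funDc.
- exact: measurable_funD.
- apply/nearW => x; rewrite !fctE normc_norm ger0_norm ?le_normcD//.
  by rewrite addr_ge0// -normc_norm.
Qed.

Lemma L2norm0 : L2norm 0 = 0%E.
Proof.
rewrite /L2norm (_ : _ \o _ = cst 0%E) ?Lnorm0//.
by apply/funext => x; congr EFin; exact: normc0.
Qed.

Lemma L2normZ (a : R[i]) f : f \in sqint ->
  (L2norm (a *: f)%R = (normc a)%:E * L2norm f)%E.
Proof.
rewrite inE => -[mf lf].
have fP : (fun x => normc (f x)) \in Lfun mu 2%:E.
  by rewrite inE; apply/andP; split; rewrite inE//=; exact: measurable_normc.
have := LnormZ (Lfun_Sub le12 fP) (normc a).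
rewrite normc_norm => <-.
by congr ('N[mu]_2%:E[EFin \o _])%E; apply/funext => x /=; rewrite normcM.
Qed.

Lemma sqint_submod_closed : submod_closed sqint.
Proof.
split; first by rewrite inE; split; [exact: measurable_cst|rewrite L2norm0].
move=> a f g fP gP.
have L2Z := L2normZ a fP.
move: fP gP; rewrite !inE => -[mf lf] [mg lg].
have maf := measurable_funZc a mf.
split; first exact: measurable_funDc.
rewrite (le_lt_trans (L2normD maf mg))// L2Z.
by rewrite lte_add_pinfty// lte_mul_pinfty// lee_fin -normc_norm.
Qed.

HB.instance Definition _ := GRing.isSubmodClosed.Build _ _ sqint
  sqint_submod_closed.

Record sqintfun := Sqintfun {
  sqintfun_val :> T -> R[i] ;
  _ : sqintfun_val \in sqint }.

HB.instance Definition _ := [isSub for sqintfun_val].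
HB.instance Definition _ := [Choice of sqintfun by <:].
HB.instance Definition _ := [SubChoice_isSubLmodule of sqintfun by <:].

Definition aezero : {pred sqintfun} :=
  mem [set f : sqintfun | {ae mu, forall x, f x = 0}].

Lemma aezero_zmod_closed : zmod_closed aezero.
Proof.
split; first by rewrite inE; apply/nearW.
move=> f g; rewrite !inE => f0 g0.
by apply: filterS2 f0 g0 => x /= fx gx; rewrite !fctE fx gx subr0.
Qed.

HB.instance Definition _ := GRing.isZmodClosed.Build _ aezero aezero_zmod_closed.

Definition L2 : Type := Quotient.quot aezero.
HB.instance Definition _ := GRing.Zmodule.on L2.
HB.instance Definition _ := EqQuotient.on L2.

Definition L2_to_fun (phi : L2) : T -> R[i] := repr phi.
Coercion L2_to_fun : L2 >-> Funclass.

Lemma L2_eqP (f g : sqintfun) :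
  {ae mu, forall x, f x = g x} <-> \pi_L2 f = \pi_L2 g.
Proof.
split=> [fg|/eqP].
  apply/eqP; rewrite -Quotient.idealrBE inE.
  by apply: filterS fg => x /= fgx; rewrite !fctE fgx subrr.
rewrite -Quotient.idealrBE inE; apply: filterS => x /eqP.
by rewrite /= !fctE subr_eq0 => /eqP.
Qed.

Lemma L2_reprE (f : sqintfun) : {ae mu, forall x, (\pi_L2 f : L2) x = f x}.
Proof. by apply/L2_eqP; rewrite reprK. Qed.

Lemma L2_measurable (phi : L2) : measurable_fun setT phi.
Proof. by have := valP (repr phi); rewrite inE => -[]. Qed.

Lemma L2_lty (phi : L2) : (L2norm phi < +oo)%E.
Proof. by have := valP (repr phi); rewrite inE => -[]. Qed.

Lemma L2_ext (phi psi : L2) : {ae mu, forall x, phi x = psi x} -> phi = psi.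
Proof. by move=> /L2_eqP; rewrite !reprK. Qed.

Lemma L2_addE (phi psi : L2) :
  {ae mu, forall x, (phi + psi : L2) x = phi x + psi x}.
Proof.
have -> : phi + psi = \pi_L2 (repr phi + repr psi).
  by rewrite raddfD /= !reprK.
exact: L2_reprE.
Qed.

Definition scaleL2 (a : R[i]) (phi : L2) : L2 := \pi_L2 (a *: repr phi).

Lemma scaleL2E a phi : {ae mu, forall x, scaleL2 a phi x = a * phi x}.
Proof. exact: L2_reprE. Qed.

Lemma scaleL2A a b phi : scaleL2 a (scaleL2 b phi) = scaleL2 (a * b) phi.
Proof.
apply: L2_ext; apply: filterS3 (scaleL2E a (scaleL2 b phi)) (scaleL2E b phi)
  (scaleL2E (a * b) phi) => x -> -> ->.
by rewrite mulrA.
Qed.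

Lemma scaleL2_1 : left_id 1 scaleL2.
Proof.
move=> phi; apply: L2_ext; apply: filterS (scaleL2E 1 phi) => x ->.
by rewrite mul1r.
Qed.

Lemma scaleL2Dr : right_distributive scaleL2 +%R.
Proof.
move=> a phi psi; apply: L2_ext.
apply: filterS3 (L2_addE (scaleL2 a phi) (scaleL2 a psi))
  (filterI (scaleL2E a phi) (scaleL2E a psi))
  (filterI (scaleL2E a (phi + psi)) (L2_addE phi psi)).
by move=> x -> [-> ->] [-> ->]; rewrite mulrDr.
Qed.

Lemma scaleL2Dl phi : {morph scaleL2^~ phi : a b / a + b}.
Proof.
move=> a b; apply: L2_ext.
apply: filterS2 (L2_addE (scaleL2 a phi) (scaleL2 b phi))
  (filterI (scaleL2E (a + b) phi) (filterI (scaleL2E a phi) (scaleL2E b phi))).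
by move=> x -> [-> [-> ->]]; rewrite mulrDl.
Qed.

HB.instance Definition _ := GRing.Zmodule_isLmodule.Build R[i] L2
  scaleL2A scaleL2_1 scaleL2Dr scaleL2Dl.

Definition normL2 (phi : L2) : R[i] := (fine (L2norm phi))%:C.

Lemma fine_normL2 (phi : L2) : (fine (L2norm phi))%:E = L2norm phi.
Proof. by rewrite fineK// ge0_fin_numE ?Lnorm_ge0// L2_lty. Qed.

Lemma ler_normL2D (phi psi : L2) : normL2 (phi + psi) <= normL2 phi + normL2 psi.
Proof.
have -> : normL2 phi + normL2 psi =
    (fine (L2norm phi) + fine (L2norm psi))%:C by rewrite rmorphD.
rewrite /normL2 lecR -lee_fin EFinD !fine_normL2.
rewrite (L2norm_ae (L2_measurable _) _ (L2_addE phi psi)).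
  exact: L2normD (L2_measurable _) (L2_measurable _).
exact: measurable_funDc (L2_measurable _) (L2_measurable _).
Qed.

Lemma normL2Z (a : R[i]) (phi : L2) : normL2 (a *: phi) = `|a| * normL2 phi.
Proof.
have -> : `|a| * normL2 phi = (normc a * fine (L2norm phi))%:C by rewrite rmorphM.
congr (_%:C); apply: EFin_inj; rewrite EFinM !fine_normL2.
rewrite (L2norm_ae (L2_measurable _) _ (scaleL2E a phi)).
  exact: (L2normZ a (valP (repr phi))).
exact: (measurable_funZc a (L2_measurable phi)).
Qed.

Lemma normL2_eq0 (phi : L2) : normL2 phi = 0 -> phi = 0.
Proof.
move=> phi0; have {}phi0 : L2norm phi = 0%E.
  by rewrite -fine_normL2; congr EFin; apply: complexI.
have /measurable_EFinP mphi := measurable_normc (L2_measurable phi).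
have n0 := Lnorm_eq0_eq0 mphi (lt_le_trans lte01 le12) phi0.
rewrite -(reprK phi) -(raddf0 \pi_L2); apply/L2_eqP.
by apply: filterS n0 => x /(_ I) [] /eq0_normc.
Qed.

HB.instance Definition _ := Lmodule_isNormed.Build R[i] L2
  ler_normL2D normL2Z normL2_eq0.

End L2.

Definition disc (R : realType) : set R[i] := [set z | `|z| < 1].

Definition circle (R : realType) : Type := {z : R[i] | `|z| == 1}.
HB.instance Definition _ (R : realType) := Choice.on (circle R).
HB.instance Definition _ (R : realType) := SubType.on (circle R).

Definition expi (R : realType) (t : R) : R[i] := cos t +i* sin t.

Lemma norm_expi (R : realType) (t : R) : `|expi t| == 1.
Proof. by rewrite normc_def /= cos2Dsin2 sqrtr1. Qed.

Definition circle_param (R : realType) (t : R) : circle R :=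
  exist _ (expi t) (norm_expi t).

HB.instance Definition _ (R : realType) :=
  isPointed.Build (circle R) (circle_param 0).
HB.instance Definition _ (R : realType) := @isMeasurable.Build
  default_measure_display (circle R)
  (g_sigma_algebra_preimage (val : circle R -> R[i]))
  (@measurable0 _ (g_sigma_algebra_preimageType (val : circle R -> R[i])))
  (@measurableC _ (g_sigma_algebra_preimageType (val : circle R -> R[i])))
  (@bigcupT_measurable _
    (g_sigma_algebra_preimageType (val : circle R -> R[i]))).

Section circle_measure.
Variable R : realType.

Lemma measurable_circle_param :
  measurable_fun setT (@circle_param R : measurableTypeR R -> circle R).
Proof.
have mexpi : measurable_fun setT (@expi R).
  apply/measurable_complexP; split.
    by apply: continuous_measurable_fun; exact: continuous_cos.
  by apply: continuous_measurable_fun; exact: continuous_sin.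
move=> _ _ [B mB <-]; rewrite !setTI -comp_preimage -[X in measurable X]setTI.
exact: mexpi.
Qed.

HB.instance Definition _ := isMeasurableFun.Build _ _ _ _
  (@circle_param R : measurableTypeR R -> circle R) measurable_circle_param.

Lemma twopi_gt0 : 0 < 2 * pi :> R.
Proof. by rewrite mulr_gt0// pi_gt0. Qed.

(* Normalized Lebesgue measure: the image of dt / (2 * pi) on [0, 2 * pi]
   by t |-> exp (i * t). *)
Definition circle_measure : probability (circle R) R :=
  distribution (uniform_prob twopi_gt0)
    (@circle_param R : {mfun measurableTypeR R >-> circle R}).

End circle_measure.

Section inner_functions.
Variable R : realType.
Implicit Types f : R[i] -> R[i].

(* A map of the disc is represented by a function on R[i] whose values outside
   of the open unit disc are irrelevant. *)
Definition holomorphic_self_map f :=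
  {homo f : z / disc z} /\ forall z, disc z -> derivable f z 1.

Definition radial f (xi : circle R) (r : R) : R[i] := f (r%:C * val xi).

Definition radial_limit f (xi : circle R) : R[i] :=
  lim (radial f xi r @[r --> 1^'-]).

Definition inner f := holomorphic_self_map f /\
  {ae @circle_measure R, forall xi,
    cvg (radial f xi r @[r --> 1^'-]) /\ `|radial_limit f xi| = 1}.

(* The junk value xi is only taken on a null set when f is inner. *)
Definition boundary_map f (xi : circle R) : circle R :=
  insubd xi (radial_limit f xi).

Definition automorphism f :=
  holomorphic_self_map f /\ set_bij (@disc R) (@disc R) f.

Local Notation L2_circle := (L2 (@circle_measure R)).

(* The class of phi \o boundary_map f. When f is inner, preimages of null sets
   by boundary_map f are null, so that this class exists, is unique and does not
   depend on the representative of phi; the default 0 is never taken. *)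
Definition comp_op f (phi : L2_circle) : L2_circle :=
  xget 0 [set psi : L2_circle |
    {ae @circle_measure R, forall xi, psi xi = phi (boundary_map f xi)}].

End inner_functions.

Definition topologically_transitive (X : topologicalType) (A : X -> X) :=
  forall U V : set X, open U -> open V -> U !=set0 -> V !=set0 ->
  exists k, (iter k A @` U) `&` V !=set0.

Definition topologically_mixing (X : topologicalType) (A : X -> X) :=
  forall U V : set X, open U -> open V -> U !=set0 -> V !=set0 ->
  exists k0, forall k, (k0 <= k)%N -> (iter k A @` U) `&` V !=set0.

(* Main.v *)
(** Under an inner function [f] with boundary map [g], a density [P_z] on the
circle ([P_z] the Poisson kernel) is transported to [P_(f z)]: both measures have
the same moments, since the powers of [f] are bounded and holomorphic.

If [T_f] is transitive, then [f] has no fixed point [z], as the functional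
[phi |-> int phi P_z] would be invariant, and the range of [T_f] is dense. Up to a
Moebius map [f 0 = 0]; the coordinate function is then a limit of functions of
[g], which forces [|f' 0| >= 1], and [f] is a rotation by the Schwarz lemma.

Conversely an automorphism [f] is a Moebius map given by a matrix of SU(1,1). If
it has no fixed point in the disc, its trace is at least 2 in absolute value, so
that the entries of its powers are unbounded and the points [f^n 0] and
[f^(-n) 0] tend to the boundary. As [|T_f^n phi|^2 = int |phi|^2 P_(f^n 0)],
every function can be slightly modified to become small under [T_f^n] or under
its inverse, and [phi + T_f^(-n) psi] witnesses mixing. *)

Require Import Defs.
From HB Require Import structures.
From mathcomp Require Import all_boot all_order all_algebra.
From mathcomp Require Import all_classical all_reals all_analysis.
From mathcomp Require Import measurable_realfun complex.
From mathcomp Require Import ring lra.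
Set Implicit Arguments.
Unset Strict Implicit.
Unset Printing Implicit Defensive.
Import Order.TTheory GRing.Theory Num.Theory numFieldNormedType.Exports.
Import ComplexField.Normc.
Local Open Scope classical_set_scope.
Local Open Scope complex_scope.
Local Open Scope ring_scope.

(** * Mean value property *)

(** All the complex analysis rests on one mean value property, for functions continuous on a disc
    slightly larger than the unit disc and differentiable there except perhaps at 0 and at one point
    [p]. The exceptional points absorb the removable singularities of difference quotients, so that
    the Poisson formula, the first Fourier coefficients, the Schwarz lemma and the maximum principle
    all follow without power series. As [f] need not extend beyond the disc, each formula is first
    proved for the dilates [f (r z)] and reaches the boundary by dominated convergence. Only moments
    of nonnegative order are computed: the kernels are real, so conjugation gives the others.
    Polynomials converging boundedly to indicators of quadrants then identify the measures. For
    [|f' 0| >= 1], the Poisson kernels are replaced by the densities [1 + Re (c conj xi)]. They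
    compute the projection of [Re xi] onto the functions of [g], whose mean square is
    [|f' 0|^2 / 2], against 1/2 for [Re xi] itself; density of the range leaves no gap between the
    two. *)

Section rectangle_bisection.
Variable R : realType.

Lemma nested_intervals (u v : nat -> R) :
  (forall n, u n <= u n.+1) -> (forall n, v n.+1 <= v n) ->
  (forall n, u n <= v n) -> exists x, forall n, u n <= x <= v n.
Proof.
move=> u1 v1 uv.
have um : {homo u : i j / (i <= j)%N >-> i <= j}.
  exact: (homo_leq (@lexx _ _) le_trans).
have vm : {homo v : i j / (j <= i)%N >-> i <= j}.
  move=> i j ji; rewrite -lerN2.
  move: ji; apply: (homo_leq (f := fun n => - v n) (@lexx _ _) le_trans).
  by move=> k; rewrite lerN2.
have uv' n k : u n <= v k.
  apply: (le_trans (um n (maxn n k) (leq_maxl _ _))).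
  by apply: (le_trans (uv _)); exact: vm (leq_maxr _ _).
exists (sup (range u)) => n; apply/andP; split.
  by apply: ub_le_sup; [exists (v 0) => _ [k _ <-]; exact: uv'|exists n].
by apply: ge_sup; [exists (u 0), 0|move=> _ [k _ <-]; exact: uv'].
Qed.

Let midpointP (x y : R) : x <= y -> [/\ x <= (x + y) / 2, (x + y) / 2 <= y,
  (x + y) / 2 - x = (y - x) / 2 & y - (x + y) / 2 = (y - x) / 2].
Proof. by move=> xy; split; lra. Qed.

Let quarter_le (p q r s t : R) :
  p <= q + r + s + t -> q < p / 4 -> r < p / 4 -> s < p / 4 -> p / 4 <= t.
Proof. lra. Qed.

(** Goursat's argument for an abstract function [m] of rectangles. If [|m|] is [k > 0] on the whole,
    some quarter keeps at least [k / 4], and so on; the nested rectangles shrink to a point, where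
    the second hypothesis makes [m] too small compared with the square of the size. *)
Lemma rectangle_bisection (m : R -> R -> R -> R -> R) (a b c d : R) :
  a <= b -> c <= d ->
  (forall x1 x2 y1 y2, a <= x1 -> x1 <= x2 -> x2 <= b ->
     c <= y1 -> y1 <= y2 -> y2 <= d ->
     `|m x1 x2 y1 y2| <=
     `|m x1 ((x1 + x2) / 2) y1 ((y1 + y2) / 2)| +
     `|m ((x1 + x2) / 2) x2 y1 ((y1 + y2) / 2)| +
     `|m x1 ((x1 + x2) / 2) ((y1 + y2) / 2) y2| +
     `|m ((x1 + x2) / 2) x2 ((y1 + y2) / 2) y2|) ->
  (forall x0 y0, a <= x0 <= b -> c <= y0 <= d -> forall e, 0 < e ->
     exists2 dl, 0 < dl & forall x1 x2 y1 y2, a <= x1 -> x2 <= b ->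
       c <= y1 -> y2 <= d -> x1 <= x0 <= x2 -> y1 <= y0 <= y2 ->
       x2 - x1 < dl -> y2 - y1 < dl ->
       `|m x1 x2 y1 y2| <= e * (x2 - x1 + (y2 - y1)) ^+ 2) ->
  m a b c d = 0.
Proof.
move=> ab cd split4 small; apply/eqP/negPn/negP => m0.
have k0 : 0 < `|m a b c d| by rewrite normr_gt0.
set k := `|m a b c d| in k0.
pose T := (R * R * R * R)%type.
pose M (r : T) := let: (x1, x2, y1, y2) := r in `|m x1 x2 y1 y2|.
pose next (r : T) : T := let: (x1, x2, y1, y2) := r in
  let u := (x1 + x2) / 2 in let v := (y1 + y2) / 2 in
  if M r / 4 <= M (x1, u, y1, v) then (x1, u, y1, v) else
  if M r / 4 <= M (u, x2, y1, v) then (u, x2, y1, v) else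
  if M r / 4 <= M (x1, u, v, y2) then (x1, u, v, y2) else (u, x2, v, y2).
pose X1 (r : T) := r.1.1.1. pose X2 (r : T) := r.1.1.2.
pose Y1 (r : T) := r.1.2. pose Y2 (r : T) := r.2.
pose wf (r : T) := [/\ a <= X1 r, X1 r <= X2 r & X2 r <= b] /\
  [/\ c <= Y1 r, Y1 r <= Y2 r & Y2 r <= d].
have nextP r : wf r -> [/\ wf (next r),
    (X1 r <= X1 (next r) /\ X2 (next r) <= X2 r),
    (Y1 r <= Y1 (next r) /\ Y2 (next r) <= Y2 r),
    (X2 (next r) - X1 (next r) = (X2 r - X1 r) / 2 /\
     Y2 (next r) - Y1 (next r) = (Y2 r - Y1 r) / 2) & M r / 4 <= M (next r)].
  move: r => [[[x1 x2] y1] y2]; rewrite /wf /X1 /X2 /Y1 /Y2/= => -[[h1 h2 h3] [h4 h5 h6]].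
  have s := split4 _ _ _ _ h1 h2 h3 h4 h5 h6.
  have [u1 u2 u3 u4] := midpointP h2; have [v1 v2 v3 v4] := midpointP h5.
  have [au ub cv vd] : [/\ a <= (x1 + x2) / 2, (x1 + x2) / 2 <= b,
      c <= (y1 + y2) / 2 & (y1 + y2) / 2 <= d].
    by split; [exact: le_trans h1 u1|exact: le_trans u2 h3|
               exact: le_trans h4 v1|exact: le_trans v2 h6].
  do 3 (case: ifPn => [/= hM|]; first by do ![split] => //=; rewrite ?lexx).
  rewrite -!ltNge/= => n3 n2 n1; do ![split] => //=; rewrite ?lexx//.
  exact: (quarter_le s).
pose r n := iter n next (a, b, c, d).
have wfr n : wf (r n).
  by elim: n => [|n IH]; [rewrite /wf /X1 /X2 /Y1 /Y2/=|have [] := nextP _ IH].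
have sz n : X2 (r n) - X1 (r n) = (b - a) / 2 ^+ n /\
            Y2 (r n) - Y1 (r n) = (d - c) / 2 ^+ n.
  elim: n => [|n [IH1 IH2]]; first by rewrite /X1 /X2 /Y1 /Y2/= expr0 !divr1.
  have [_ _ _ [-> ->] _] := nextP _ (wfr n).
  by rewrite IH1 IH2 exprSr invfM !mulrA.
have Mr n : k / 4 ^+ n <= M (r n).
  elim: n => [|n IH]; first by rewrite expr0 divr1.
  have [_ _ _ _ h] := nextP _ (wfr n); apply: le_trans h.
  by rewrite exprSr invfM mulrA ler_wpM2r// invr_ge0.
have [x0 x0P] : exists x, forall n, X1 (r n) <= x <= X2 (r n).
  apply: nested_intervals => n; last by have [[]] := wfr n.
  - by have [_ []] := nextP _ (wfr n).
  - by have [_ []] := nextP _ (wfr n).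
have [y0 y0P] : exists x, forall n, Y1 (r n) <= x <= Y2 (r n).
  apply: nested_intervals => n; last by have [_ []] := wfr n.
  - by have [_ _ []] := nextP _ (wfr n).
  - by have [_ _ []] := nextP _ (wfr n).
pose L := b - a + (d - c).
have L0 : 0 <= L by rewrite /L; lra.
(* At level [n] the two bounds read [k / 4^n <= e (L / 2^n)^2], that is [k <= e L^2]; this [e] makes
   [e L^2 < k]. The added 1 covers the case [L = 0]. *)
pose e := k / (2 * (L ^+ 2 + 1)).
have L21 : 0 < L ^+ 2 + 1 by rewrite ltr_wpDl// sqr_ge0.
have e0 : 0 < e by rewrite divr_gt0// mulr_gt0.
have [dl dl0 dlP] := small x0 y0 (x0P 0) (y0P 0) e e0.
have [n nP] : exists n, L / 2 ^+ n < dl.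
  have : (fun n => L * (1 / 2) ^+ n) @ \oo --> (L * 0).
    apply: cvgMr; apply: cvg_expr; rewrite ger0_norm; lra.
  rewrite mulr0 => /cvgr0_norm_lt /(_ _ dl0) [n _ /(_ n (leqnn n))] /=.
  rewrite expr_div_n expr1n mul1r ger0_norm ?mulr_ge0 ?invr_ge0 ?exprn_ge0//.
  by exists n.
have {x0P} x0n := x0P n; have {y0P} y0n := y0P n.
have [s1 s2] := sz n; have Mn := Mr n; have [[w1 w2 w3] [w4 w5 w6]] := wfr n.
have p2 : 0 < (2 : R) ^+ n by rewrite exprn_gt0.
have [bL dL] : b - a <= L /\ d - c <= L.
  by rewrite /L lerDl lerDr !subr_ge0.
have sx : X2 (r n) - X1 (r n) < dl.
  by rewrite s1; apply: le_lt_trans nP; rewrite ler_pM2r ?invr_gt0.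
have sy : Y2 (r n) - Y1 (r n) < dl.
  by rewrite s2; apply: le_lt_trans nP; rewrite ler_pM2r ?invr_gt0.
have := dlP _ _ _ _ w1 w3 w4 w6 x0n y0n sx sy.
rewrite s1 s2 -mulrDl -/L => h.
have {Mn h} : k / 4 ^+ n <= e * (L / 2 ^+ n) ^+ 2.
  apply: le_trans h; apply: le_trans Mn _.
  by rewrite /M /X1 /X2 /Y1 /Y2; case: (r n) => [[[]]].
rewrite exprMn exprVn -exprM muln2 -addnn exprD -expr2.
rewrite -(_ : 4 ^+ n = (2 ^+ n) ^+ 2 :> R); last first.
  by rewrite -exprM mulnC exprM expr2 -natrM.
rewrite mulrA ler_pM2r ?invr_gt0 ?exprn_gt0// /e.
rewrite mulrAC ler_pdivlMr ?mulr_gt0//.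
rewrite ler_pM2l//; nra.
Qed.

End rectangle_bisection.

(** * Integrals over segments and closed forms on rectangles *)

Section closed_forms.
Variable R : realType.
Notation mu := (@lebesgue_measure R).
Implicit Types (f : R -> R) (a b c d e x y u v : R).

Definition segint f a b : R := \int[mu]_(x in `[a, b]) f x.

Lemma segment_integrable f a b :
  {within `[a, b], continuous f} -> mu.-integrable `[a, b] (EFin \o f).
Proof.
by move=> cf; apply: continuous_compact_integrable => //; exact: segment_compact.
Qed.

Lemma withinS f a b u v : a <= u -> v <= b ->
  {within `[a, b], continuous f} -> {within `[u, v], continuous f}.
Proof.
move=> au vb; apply: continuous_subspaceW => x /=; rewrite !in_itv/=.
by move=> /andP[ux xv]; rewrite (le_trans au ux) (le_trans xv vb).
Qed.

Lemma segint_chasles f a u b : a <= u -> u <= b ->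
  {within `[a, b], continuous f} ->
  segint f a b = segint f a u + segint f u b.
Proof.
move=> au ub cf; apply/eqP; rewrite addrC -subr_eq; apply/eqP.
rewrite /segint Rintegral_itvB ?bnd_simp//; last exact: segment_integrable.
rewrite Rintegral_itv_obnd_cbnd//.
apply: integrableS (segment_integrable cf) => //.
by move=> x /=; rewrite !in_itv/= => /andP[/ltW ux ->]; rewrite (le_trans au ux).
Qed.

Lemma segint_cst r a b : a <= b -> segint (cst r) a b = r * (b - a).
Proof.
move=> ab; rewrite /segint (@Rintegral_cst _ _ _ mu)//= (lebesgue_measure_itv `[a, b]%R)/= lte_fin.
by case: ltgtP ab => //= -> _; rewrite subrr.
Qed.

Lemma segintB f g a b : {within `[a, b], continuous f} ->
  {within `[a, b], continuous g} ->
  segint (fun x => f x - g x) a b = segint f a b - segint g a b.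
Proof.
by move=> cf cg; rewrite /segint RintegralB//; exact: segment_integrable.
Qed.

Lemma segint_le f a b e : a <= b -> {within `[a, b], continuous f} ->
  (forall x, a <= x <= b -> `|f x| <= e) -> `|segint f a b| <= e * (b - a).
Proof.
move=> ab cf fe; rewrite /segint.
have intf := segment_integrable cf.
apply: le_trans (le_normr_Rintegral _ intf) _ => //.
rewrite -(segint_cst e ab) /segint; apply: le_Rintegral => //.
- by have := integrable_norm intf.
- by apply: segment_integrable => x; exact: cvg_cst.
Qed.

(* The form [P dx + Q dy] is only assumed to be differentiable, in the weak
   sense that at each point [P] varies with [y] as [Q] varies with [x]. *)
Lemma closed_form_rectangle (P Q : R -> R -> R) a b c d : a <= b -> c <= d ->
  (forall y, c <= y <= d -> {within `[a, b], continuous (P ^~ y)}) ->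
  (forall x, a <= x <= b -> {within `[c, d], continuous (Q x)}) ->
  (forall x0 y0, a <= x0 <= b -> c <= y0 <= d -> exists B, forall e, 0 < e ->
     exists2 dl, 0 < dl & forall x1 x2 y1 y2, a <= x1 -> x2 <= b ->
       c <= y1 -> y2 <= d -> x1 <= x0 <= x2 -> y1 <= y0 <= y2 ->
       x2 - x1 < dl -> y2 - y1 < dl ->
       (forall x, x1 <= x <= x2 -> `|P x y2 - P x y1 - B * (y2 - y1)| <=
          e * (x2 - x1 + (y2 - y1))) /\
       (forall y, y1 <= y <= y2 -> `|Q x2 y - Q x1 y - B * (x2 - x1)| <=
          e * (x2 - x1 + (y2 - y1)))) ->
  segint (P ^~ d) a b - segint (P ^~ c) a b = segint (Q b) c d - segint (Q a) c d.
Proof.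
move=> ab cd cP cQ loc.
(* Up to sign, the circulation of the form along the boundary of the rectangle. *)
pose m x1 x2 y1 y2 := segint (P ^~ y2) x1 x2 - segint (P ^~ y1) x1 x2
  - (segint (Q x2) y1 y2 - segint (Q x1) y1 y2).
suff : m a b c d = 0 by move/eqP; rewrite subr_eq0 => /eqP.
apply: rectangle_bisection => //.
- move=> x1 x2 y1 y2 ax1 x12 x2b cy1 y12 y2d.
  have [x1u ux2] := midf_le x12; have [y1v vy2] := midf_le y12.
  set u := (x1 + x2) / 2 in x1u ux2 *; set v := (y1 + y2) / 2 in y1v vy2 *.
  have cP' y : y1 <= y <= y2 -> {within `[x1, x2], continuous (P ^~ y)}.
    move=> /andP[h1 h2]; apply: withinS ax1 x2b (cP _ _).
    by rewrite (le_trans cy1 h1) (le_trans h2 y2d).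
  have cQ' x : x1 <= x <= x2 -> {within `[y1, y2], continuous (Q x)}.
    move=> /andP[h1 h2]; apply: withinS cy1 y2d (cQ _ _).
    by rewrite (le_trans ax1 h1) (le_trans h2 x2b).
  have -> : m x1 x2 y1 y2 = m x1 u y1 v + m u x2 y1 v + m x1 u v y2 + m u x2 v y2.
    rewrite /m (segint_chasles x1u ux2 (cP' y1 _)) ?lexx//.
    rewrite (segint_chasles x1u ux2 (cP' y2 _)) ?lexx ?y12//.
    rewrite (segint_chasles y1v vy2 (cQ' x1 _)) ?lexx ?x12//.
    rewrite (segint_chasles y1v vy2 (cQ' x2 _)) ?lexx ?x12//.
    ring.
  do 2 (apply: le_trans (ler_normD _ _) _; rewrite lerD2r).
  exact: ler_normD.
- move=> x0 y0 x0P y0P e e0; have [B BP] := loc _ _ x0P y0P.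
  have [dl dl0 {}BP] := BP _ e0.
  exists dl => // x1 x2 y1 y2 ax1 x2b cy1 y2d x0' y0' xdl ydl.
  have [BP1 BP2] := BP _ _ _ _ ax1 x2b cy1 y2d x0' y0' xdl ydl.
  have x12 : x1 <= x2 by case/andP: x0' => h1 h2; exact: le_trans h1 h2.
  have y12 : y1 <= y2 by case/andP: y0' => h1 h2; exact: le_trans h1 h2.
  have cP' y : y1 <= y <= y2 -> {within `[x1, x2], continuous (P ^~ y)}.
    move=> /andP[h1 h2]; apply: withinS ax1 x2b (cP _ _).
    by rewrite (le_trans cy1 h1) (le_trans h2 y2d).
  have cQ' x : x1 <= x <= x2 -> {within `[y1, y2], continuous (Q x)}.
    move=> /andP[h1 h2]; apply: withinS cy1 y2d (cQ _ _).
    by rewrite (le_trans ax1 h1) (le_trans h2 x2b).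
  have ccst z (A : set R) : {within A, continuous (cst z : R -> R)}.
    by move=> ?; exact: cvg_cst.
  have cP2 := cP' y2 (introT andP (conj y12 (lexx _))).
  have cP1 := cP' y1 (introT andP (conj (lexx _) y12)).
  have cQ2 := cQ' x2 (introT andP (conj x12 (lexx _))).
  have cQ1 := cQ' x1 (introT andP (conj (lexx _) x12)).
  have cB f g (A : set R) : {within A, continuous f} -> {within A, continuous g} ->
      {within A, continuous (fun x => f x - g x)}.
    by move=> cf cg z; apply: cvgB; [exact: cf|exact: cg].
  (* Subtracting the first-order terms removes from both integrals the same [B] times the area, so
     [m] is unchanged and only the remainders are left to estimate. *)
  have EP : segint (fun x => P x y2 - P x y1 - cst (B * (y2 - y1)) x) x1 x2 =
     segint (P ^~ y2) x1 x2 - segint (P ^~ y1) x1 x2 - B * (y2 - y1) * (x2 - x1).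
    by rewrite !segintB ?segint_cst//; exact: cB.
  have EQ : segint (fun y => Q x2 y - Q x1 y - cst (B * (x2 - x1)) y) y1 y2 =
     segint (Q x2) y1 y2 - segint (Q x1) y1 y2 - B * (x2 - x1) * (y2 - y1).
    by rewrite !segintB ?segint_cst//; exact: cB.
  have -> : m x1 x2 y1 y2 =
     segint (fun x => P x y2 - P x y1 - cst (B * (y2 - y1)) x) x1 x2 -
     segint (fun y => Q x2 y - Q x1 y - cst (B * (x2 - x1)) y) y1 y2.
    by rewrite EP EQ /m; ring.
  apply: le_trans (ler_normB _ _) _.
  rewrite expr2 mulrA [leRHS]mulrDr; apply: lerD.
    by apply: segint_le BP1 => //; exact: (cB _ _ _ (cB _ _ _ cP2 cP1) (ccst _ _)).
  by apply: segint_le BP2 => //; exact: (cB _ _ _ (cB _ _ _ cQ2 cQ1) (ccst _ _)).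
Qed.

End closed_forms.

(** * Real and imaginary parts, modulus and limits of complex functions *)

Section complex_basics.
Variable R : realType.
Local Notation C := R[i].
Local Notation Re := (@complex.Re R).
Local Notation Im := (@complex.Im R).
Implicit Types (z w : C).

Lemma normrcE z : `|z| = (normc z)%:C.
Proof. by rewrite normc_def; case: z. Qed.

Lemma normc_ge0 z : 0 <= normc z.
Proof. by case: z => a b; rewrite sqrtr_ge0. Qed.

Lemma normcB z w : normc (z - w) = normc (w - z).
Proof. by rewrite -normcN opprB. Qed.

Lemma normcE2 z : normc z ^+ 2 = Re z ^+ 2 + Im z ^+ 2.
Proof. by case: z => a b /=; rewrite sqr_sqrtr// addr_ge0 ?sqr_ge0. Qed.

Lemma normc_conj z : normc z^* = normc z.
Proof. by case: z => a b /=; rewrite sqrrN. Qed.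

Lemma normc_real (x : R) : normc x%:C = `|x|.
Proof. by rewrite /= expr0n/= addr0 sqrtr_sqr. Qed.

Lemma normcX z n : normc (z ^+ n) = normc z ^+ n.
Proof.
elim: n => [|n IH]; first by rewrite !expr0 normc1.
by rewrite !exprS normcM IH.
Qed.

Lemma normc_eq0 z : (normc z == 0) = (z == 0).
Proof.
by apply/eqP/eqP => [/eq0_normc//|->]; exact: normc0.
Qed.

Lemma normc_gt0 z : (0 < normc z) = (z != 0).
Proof. by rewrite lt_neqAle normc_ge0 andbT eq_sym normc_eq0. Qed.

Lemma mulcJ z : z * z^* = (normc z ^+ 2)%:C.
Proof. by rewrite -sqr_normc normrcE rmorphXn. Qed.

Lemma Re_le z : `|Re z| <= normc z.
Proof. by rewrite -sqrtr_sqr; case: z => a b /=; rewrite ler_wsqrtr// lerDl sqr_ge0. Qed.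

Lemma Im_le z : `|Im z| <= normc z.
Proof. by rewrite -sqrtr_sqr; case: z => a b /=; rewrite ler_wsqrtr// lerDr sqr_ge0. Qed.

Lemma normc_leD z : normc z <= `|Re z| + `|Im z|.
Proof.
rewrite -(@ler_pXn2r _ 2) ?nnegrE ?normc_ge0 ?addr_ge0//.
by rewrite normcE2 sqrrD !real_normK ?num_real// lerD2r lerDl mulrn_wge0 ?mulr_ge0.
Qed.

Lemma normc_subr z w : normc z - normc w <= normc (z - w).
Proof. by rewrite lerBlDr; apply: le_trans (le_normcD _ _); rewrite subrK. Qed.

Lemma cReD z w : Re (z + w) = Re z + Re w. Proof. by case: z w => [? ?] []. Qed.
Lemma cImD z w : Im (z + w) = Im z + Im w. Proof. by case: z w => [? ?] []. Qed.
Lemma cReN z : Re (- z) = - Re z. Proof. by case: z. Qed.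
Lemma cImN z : Im (- z) = - Im z. Proof. by case: z. Qed.
Lemma cReM z w : Re (z * w) = Re z * Re w - Im z * Im w.
Proof. by case: z w => [? ?] []. Qed.
Lemma cImM z w : Im (z * w) = Re z * Im w + Im z * Re w.
Proof. by case: z w => [? ?] []. Qed.
Lemma complex_ext z w : Re z = Re w -> Im z = Im w -> z = w.
Proof. by case: z w => [? ?] [? ?] /= -> ->. Qed.

Lemma normc_expi (t : R) : normc (expi t) = 1.
Proof. by rewrite /= cos2Dsin2 sqrtr1. Qed.

Lemma cvg_cplx (T : Type) (F : set_system T) {FF : Filter F} (f : T -> C) z :
  f x @[x --> F] --> z <->
  Re (f x) @[x --> F] --> Re z /\ Im (f x) @[x --> F] --> Im z.
Proof.
split=> [/cvgrPdist_lt fz|[/cvgrPdist_lt rz /cvgrPdist_lt iz]].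
  split; apply/cvgrPdist_lt => e e0;
    have := fz e%:C; rewrite ltcR => /(_ e0); apply: filterS => t;
    rewrite normrcE ltcR.
  - by apply: le_lt_trans; rewrite -cReN -cReD Re_le.
  - by apply: le_lt_trans; rewrite -cImN -cImD Im_le.
apply/cvgrPdist_lt => -[e e']; rewrite ltcE/= => /andP[/eqP -> e0].
have e20 : 0 < e / 2 by rewrite divr_gt0.
apply: filterS2 (rz _ e20) (iz _ e20) => t rt it.
rewrite normrcE (ltcR (normc _) e); apply: le_lt_trans (normc_leD _) _.
by rewrite cReD cImD cReN cImN (splitr e) ltrD.
Qed.

Lemma cvg_cplx_norm (T : Type) (F : set_system T) {FF : Filter F} (f : T -> C) z :
  f x @[x --> F] --> z <-> normc (f x - z) @[x --> F] --> 0.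
Proof.
split=> [/cvgrPdist_lt fz|/cvgr0_norm_lt fz].
  apply/cvgr0Pnorm_lt => e e0.
  have := fz e%:C; rewrite ltcR => /(_ e0); apply: filterS => t.
  by rewrite normrcE ltcR normcB ger0_norm ?normc_ge0.
apply/cvgrPdist_lt => -[e e']; rewrite ltcE/= => /andP[/eqP -> e0].
have := fz e e0; apply: filterS => t.
by rewrite normrcE ltcR normcB ger0_norm ?normc_ge0.
Qed.

Lemma nbhs_normc z (P : set C) : nbhs z P <->
  exists2 e : R, 0 < e & forall w, normc (w - z) < e -> P w.
Proof.
split=> [/nbhs_ballP[[e e'] /=]|[e e0 h]].
  rewrite ltcE/= => /andP[/eqP -> e0] h; exists e => // w wz.
  by apply: h; rewrite -ball_normE/= normrcE normcB ltcR.
apply/nbhs_ballP; exists e%:C => /=; first by rewrite ltcR.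
by move=> w; rewrite -ball_normE/= normrcE normcB ltcR; exact: h.
Qed.

Lemma normc_cont (z : C) : {for z, continuous (@normc R)}.
Proof.
apply/(@cvgrPdist_lt _ _ _ (nbhs z)) => e e0; apply/nbhs_normc; exists e => // w; apply: le_lt_trans.
rewrite ler_norml lerNl opprB (normcB w) normc_subr andbT normcB.
exact: normc_subr.
Qed.

Lemma Re_cont (z : C) : {for z, continuous (Re)}.
Proof. by have /cvg_cplx[] : (@idfun C) w @[w --> z] --> z by exact: cvg_id. Qed.

Lemma Im_cont (z : C) : {for z, continuous (Im)}.
Proof. by have /cvg_cplx[] : (@idfun C) w @[w --> z] --> z by exact: cvg_id. Qed.

Lemma real_complex_cont (x : R) : {for x, continuous (real_complex R)}.
Proof. by apply/cvg_cplx; split=> /=; [exact: cvg_id|exact: cvg_cst]. Qed.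

Lemma expi_cont (t : R) : {for t, continuous (@expi R)}.
Proof.
by apply/cvg_cplx; split=> /=; [exact: continuous_cos|exact: continuous_sin].
Qed.

End complex_basics.

(** * Complex differentiability through continuous slopes *)

Section complex_differentiability.
Variable R : realType.
Local Notation C := R[i].
Implicit Types (f g : C -> C) (z w l p : C).

(* Caratheodory's form of differentiability: every rule of calculus becomes an
   algebraic identity between the continuous slopes [phi]. *)
Definition cdiff f z l := exists phi : C -> C,
  [/\ {for z, continuous phi}, phi z = l &
      forall w, f w = f z + phi w * (w - z)].

Section continuity_at.
Variables (T : topologicalType) (x : T).
Implicit Types u v : T -> C.

Lemma cont_cst (c : C) : {for x, continuous (fun _ : T => c)}.
Proof. exact: (@cvg_cst _ _ _ (nbhs x)). Qed.

Lemma contD u v : {for x, continuous u} -> {for x, continuous v} ->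
  {for x, continuous (fun y => u y + v y)}.
Proof. exact: (@cvgD _ _ _ (nbhs x)). Qed.

Lemma contB u v : {for x, continuous u} -> {for x, continuous v} ->
  {for x, continuous (fun y => u y - v y)}.
Proof. exact: (@cvgB _ _ _ (nbhs x)). Qed.

Lemma contN u : {for x, continuous u} -> {for x, continuous (fun y => - u y)}.
Proof. exact: (@cvgN _ _ _ (nbhs x)). Qed.

Lemma contM u v : {for x, continuous u} -> {for x, continuous v} ->
  {for x, continuous (fun y => u y * v y)}.
Proof. exact: (@cvgM _ _ (nbhs x)). Qed.

Lemma contV u : u x != 0 -> {for x, continuous u} ->
  {for x, continuous (fun y => (u y)^-1)}.
Proof. exact: (@cvgV _ _ (nbhs x)). Qed.

End continuity_at.

Lemma cont_id z : {for z, continuous (fun w : C => w)}.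
Proof. exact: cvg_id. Qed.

Lemma cdiff_cont f z l : cdiff f z l -> {for z, continuous f}.
Proof.
move=> [phi [cphi _ fE]].
rewrite (_ : f = fun w => f z + phi w * (w - z)); last exact/funext.
apply: contD; first exact: cont_cst.
by apply: (contM cphi); apply: contB; [exact: cont_id|exact: cont_cst].
Qed.

Definition diffquot p l f w := if w == p then l else (f w - f p) / (w - p).

Lemma diffquotE p l f w : f w = f p + diffquot p l f w * (w - p).
Proof.
rewrite /diffquot; case: eqP => [->|/eqP wp]; first by rewrite subrr mulr0 addr0.
by rewrite mulfVK ?subr_eq0// addrC subrK.
Qed.

(** The slope in [cdiff] is forced by its equation off [z] and by its value at [z], so it can only
    be [diffquot]. In this form, filling a difference quotient with the derivative gives a function
    continuous at the singular point. *)
Lemma cdiff_diffquot f z l :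
  cdiff f z l <-> {for z, continuous (diffquot z l f)}.
Proof.
split=> [[phi [cphi <- fE]]|ch].
  rewrite (_ : diffquot _ _ _ = phi)//; apply/funext => w; rewrite /diffquot.
  case: eqP => [->//|/eqP wz].
  by rewrite {1}fE addrAC subrr add0r mulfK// subr_eq0.
exists (diffquot z l f); split=> //; first by rewrite /diffquot eqxx.
exact: diffquotE.
Qed.

Lemma near_cont f g z : (\forall w \near z, f w = g w) ->
  {for z, continuous f} -> {for z, continuous g}.
Proof.
move=> fg cf; rewrite /prop_for /continuous_at -(nbhs_singleton fg).
move=> P /cf; rewrite /nbhs/= => fP.
by apply: filterS2 fg fP => w; rewrite /preimage/= => ->.
Qed.

Lemma near_cdiff f g z l : (\forall w \near z, f w = g w) ->
  cdiff f z l -> cdiff g z l.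
Proof.
move=> fg /cdiff_diffquot cf; apply/cdiff_diffquot; apply: near_cont cf.
have fgz := nbhs_singleton fg.
by apply: filterS fg => w; rewrite /diffquot fgz => ->.
Qed.

Lemma cdiff_cst c z : cdiff (cst c) z 0.
Proof.
by exists (cst 0); split=> [||w]; [exact: cont_cst|by []|rewrite mul0r addr0].
Qed.

Lemma cdiff_id z : cdiff id z 1.
Proof.
by exists (cst 1); split=> [||w]; [exact: cont_cst|by []|rewrite mul1r addrC subrK].
Qed.

Lemma cdiffD f g z l m : cdiff f z l -> cdiff g z m ->
  cdiff (fun w => f w + g w) z (l + m).
Proof.
move=> [phi [cphi <- fE]] [psi [cpsi <- gE]].
exists (fun w => phi w + psi w); split=> [||w]; [exact: (contD cphi cpsi)|by []|].
by rewrite fE gE; ring.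
Qed.

Lemma cdiffN f z l : cdiff f z l -> cdiff (fun w => - f w) z (- l).
Proof.
move=> [phi [cphi <- fE]].
exists (fun w => - phi w); split=> [||w]; [exact: (contN cphi)|by []|].
by rewrite fE; ring.
Qed.

Lemma cdiffM f g z l m : cdiff f z l -> cdiff g z m ->
  cdiff (fun w => f w * g w) z (l * g z + f z * m).
Proof.
move=> df dg; have cg := cdiff_cont dg.
case: df dg => [phi [cphi <- fE]] [psi [cpsi <- gE]].
exists (fun w => phi w * g w + f z * psi w); split=> [||w]; [|by []|].
  apply: contD; first exact: (contM cphi cg).
  by apply: contM; [exact: cont_cst|exact: cpsi].
by rewrite {1}fE mulrDl {1}(gE w); ring.
Qed.

(** The algebraic slope of the inverse is right only where [f] does not vanish, hence near [z]. This
    is why the proof goes through the difference quotient and [near_cont]. *)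
Lemma cdiffV f z l : f z != 0 -> cdiff f z l ->
  cdiff (fun w => (f w)^-1) z (- l / f z ^+ 2).
Proof.
move=> fz0 df; have cf := cdiff_cont df.
case: df => phi [cphi <- fE].
have nz : \forall w \near z, (f w != 0).
  have : (fun w => normc (f w)) @ z --> normc (f z).
    by apply: (continuous_comp cf); exact: normc_cont.
  move=> /cvgr_gt /(_ 0); rewrite normc_gt0 => /(_ fz0).
  by apply: filterS => w; rewrite normc_gt0.
have cv : {for z, continuous (fun w => (f w)^-1)} by exact: (contV fz0 cf).
apply/cdiff_diffquot.
apply: (@near_cont (fun w => - phi w * (f z)^-1 * (f w)^-1)); last first.
  by apply: contM cv; apply: contM; [exact: (contN cphi)|exact: cont_cst].
apply: filterS nz => w fw0; rewrite /diffquot; case: eqP => [->|/eqP wz].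
  by rewrite expr2 invfM mulrA.
apply: (mulIf (x := w - z)); first by rewrite subr_eq0.
rewrite mulfVK ?subr_eq0//.
have e : phi w * (w - z) = f w - f z by rewrite (fE w); ring.
rewrite (_ : _ * (w - z) = - (phi w * (w - z)) * (f z)^-1 * (f w)^-1); last by ring.
by rewrite e; field; rewrite fz0.
Qed.

Lemma cdiff_comp f g z l m : cdiff f z l -> cdiff g (f z) m ->
  cdiff (fun w => g (f w)) z (m * l).
Proof.
move=> df dg; have cf := cdiff_cont df.
case: df dg => [phi [cphi <- fE]] [psi [cpsi <- gE]].
exists (fun w => psi (f w) * phi w); split=> [||w]; [|by []|].
  by apply: contM cphi; exact: (continuous_comp cf cpsi).
by rewrite gE {2}(fE w); ring.
Qed.

Lemma cdiffX f z l n : cdiff f z l ->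
  cdiff (fun w => f w ^+ n) z (l * f z ^+ n.-1 *+ n).
Proof.
move=> df; elim: n => [|n IH].
  by rewrite mulr0n; under eq_fun do rewrite expr0; exact: cdiff_cst.
under eq_fun do rewrite exprSr.
suff -> : l * f z ^+ n.+1.-1 *+ n.+1 =
    l * f z ^+ n.-1 *+ n * f z + f z ^+ n * l by exact: cdiffM.
rewrite /= mulrSr mulrnAl; congr (_ + _); last by rewrite mulrC.
by case: n {IH} => [|n]; rewrite ?mulr0n// -mulrA -exprSr.
Qed.

Lemma derivable_cdiff f z : derivable f z 1 -> exists l, cdiff f z l.
Proof.
move=> /cvg_ex[l] /cvgrPdist_lt dl; exists l; apply/cdiff_diffquot.
apply/(@cvgrPdist_lt _ _ _ (nbhs z)) => e e0.
have := dl e e0; rewrite near_withinE => /nbhs_normc[d d0 h].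
apply/nbhs_normc; exists d => // w wz.
rewrite /diffquot eqxx; case: eqP => [_|/eqP nwz]; first by rewrite subrr normr0.
have := h (w - z); rewrite subr0 => /(_ wz); rewrite subr_eq0 => /(_ nwz)/=.
rewrite (_ : (w - z)%:A = w - z); last exact: mulr1.
rewrite subrK (_ : _ *: _ = (f w - f z) / (w - z))//; exact: mulrC.
Qed.

Lemma diffquot_cdiff f p z l l' : z != p -> cdiff f z l ->
  exists m, cdiff (diffquot p l' f) z m.
Proof.
move=> zp df.
have dq : exists m, cdiff (fun w => (f w - f p) * (w - p)^-1) z m.
  eexists; apply: cdiffM.
    by apply: cdiffD; [exact: df|exact: cdiff_cst].
  apply: cdiffV; first by rewrite subr_eq0.
  by apply: cdiffD; [exact: cdiff_id|exact: cdiff_cst].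
case: dq => m dm; exists m; apply: near_cdiff dm.
have zp0 : 0 < normc (z - p) by rewrite normc_gt0 subr_eq0.
apply/nbhs_normc; exists (normc (z - p)) => // w wz.
by rewrite /diffquot; case: eqP wz => // ->; rewrite normcB ltxx.
Qed.

End complex_differentiability.

(** * Mean value property on circles, in polar coordinates *)

Section mean_value.
Variable R : realType.
Local Notation C := R[i].
Local Notation Re := (@complex.Re R).
Local Notation Im := (@complex.Im R).

Let slope (t0 d : R) (f : R -> R) t := if t == t0 then d else (f t - f t0) / (t - t0).

Let slopeE t0 d f t : f t = f t0 + slope t0 d f t * (t - t0).
Proof.
rewrite /slope; case: eqP => [->|/eqP tt0]; first by rewrite subrr mulr0 addr0.
by rewrite mulfVK ?subr_eq0// addrC subrK.
Qed.

Let slope_cont (t0 d : R) (f : R -> R) : is_derive t0 (1:R) f d ->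
  {for t0, continuous (slope t0 d f)}.
Proof.
move=> df; apply/(@cvgrPdist_lt _ _ _ (nbhs t0)) => e e0.
have [+ fd] := df; rewrite /derivable => fd'.
have : h^-1 *: ((f \o shift t0) (h *: 1) - f t0) @[h --> 0^'] --> d.
  by rewrite -fd; exact: fd'.
move=> /cvgrPdist_lt /(_ e e0); rewrite near_withinE => /nbhs_ballP[r /= r0 h].
apply/nbhs_ballP; exists r => //= t tr; rewrite /slope eqxx.
case: eqP => [_|/eqP tt0]; first by rewrite subrr normr0.
have := h (t - t0); rewrite /ball/= sub0r normrN distrC => /(_ tr).
by rewrite subr_eq0 => /(_ tt0); rewrite [_%:A]mulr1 subrK [_ *: _]mulrC.
Qed.

Lemma expi_slope (t0 : R) : exists psi : R -> C,
  [/\ {for t0, continuous psi}, psi t0 = 'i * expi t0 &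
      forall t, expi t = expi t0 + psi t * (t - t0)%:C].
Proof.
exists (fun t => slope t0 (- sin t0) (@cos R) t +i* slope t0 (cos t0) (@sin R) t).
split.
- by apply/(@cvg_cplx _ _ (nbhs t0)); split; apply: slope_cont.
- by rewrite /slope eqxx; apply: complex_ext; rewrite ?cReM ?cImM/=; ring.
- move=> t; apply: complex_ext; rewrite ?cReD ?cImD ?cReM ?cImM/=.
    by rewrite mulr0 subr0; exact: slopeE.
  by rewrite mulr0 add0r; exact: slopeE.
Qed.

Lemma polar_cont (x y : R) :
  {for (x, y), continuous (fun p : R * R => p.1%:C * expi p.2)}.
Proof.
apply: contM; apply: continuous_comp.
- exact: cvg_fst.
- exact: real_complex_cont.
- exact: cvg_snd.
- exact: expi_cont.
Qed.

Lemma normc_polar (x t : R) : normc (x%:C * expi t) = `|x|.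
Proof. by rewrite normcM normc_expi mulr1 normc_real. Qed.

Lemma expi_2pi : expi (2 * pi) = expi 0 :> C.
Proof. by rewrite /expi mulr_natl cos2pi sin2pi cos0 sin0. Qed.

Variables (H : C -> C) (rho : R).
Hypothesis cH : forall z, normc z < rho -> {for z, continuous H}.

Let h (x t : R) := H (x%:C * expi t).

Let h_cont x t : `|x| < rho -> {for (x, t), continuous (fun p => h p.1 p.2)}.
Proof.
move=> xr; apply: (@continuous_comp _ _ _ (fun p : R * R => p.1%:C * expi p.2) H).
  exact: polar_cont.
by apply: cH; rewrite normc_polar.
Qed.

Let hx_cont x t : `|x| < rho -> {for x, continuous (h ^~ t)}.
Proof.
move=> xr; apply: (@continuous_comp _ _ _ (fun x : R => (x, t)) (fun p => h p.1 p.2)).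
  apply: (@cvg_pair _ _ _ (nbhs x) (nbhs x) (nbhs t)); first exact: cvg_id.
  exact: cvg_cst.
exact: h_cont.
Qed.

Let ht_cont x t : `|x| < rho -> {for t, continuous (h x)}.
Proof.
move=> xr; apply: (@continuous_comp _ _ _ (fun t : R => (x, t)) (fun p => h p.1 p.2)).
  apply: (@cvg_pair _ _ _ (nbhs t) (nbhs x) (nbhs t)); last exact: cvg_id.
  exact: cvg_cst.
exact: h_cont.
Qed.

(** The real part is enough: the imaginary part of [H] is the real part of [- 'i * H]. *)
Definition circle_int (x : R) := segint (fun t => Re (h x t)) 0 (2 * pi).

Let mul_bound (a s eta S : R) : `|a| <= eta -> `|s| <= S -> `|a * s| <= eta * S.
Proof. by move=> aeta sS; rewrite normrM ler_pM. Qed.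

Let Re_mulr (u : C) (s : R) : Re (u * s%:C) = Re u * s.
Proof. by rewrite cReM/= mulr0 subr0. Qed.

Let Im_mulr (u : C) (s : R) : Im (u * s%:C) = Im u * s.
Proof. by rewrite cImM/= mulr0 add0r. Qed.

Let four_terms (a1 a2 b1 b2 s1 s2 s3 eta S T : R) :
  `|a1| <= eta -> `|a2| <= eta -> `|b1| <= eta -> `|b2| <= eta ->
  `|s1| + `|s2| <= S -> `|s3| <= T ->
  `|a2 * s2 - a1 * s1 + (b2 - b1) * s3| <= eta * (S + 2 * T).
Proof.
move=> a1e a2e b1e b2e sS s3T.
have e0 : 0 <= eta by apply: le_trans a1e.
have h1 := mul_bound a1e (lexx `|s1|); have h2 := mul_bound a2e (lexx `|s2|).
have h3 := mul_bound b1e s3T; have h4 := mul_bound b2e s3T.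
have h5 := ler_wpM2l e0 sS.
rewrite mulrBl; move: h1 h2 h3 h4; rewrite !ler_norml.
move=> /andP[? ?] /andP[? ?] /andP[? ?] /andP[? ?]; apply/andP; split; lra.
Qed.

Let rectangle_size (x y q : R) : 0 <= x -> 0 <= y -> 0 <= q ->
  y + 2 * (x * q) <= (2 + 2 * q) * (x + y) /\ x + 2 * y <= (2 + 2 * q) * (x + y).
Proof.
by move=> x0 y0 q0; have := mulr_ge0 x0 q0; have := mulr_ge0 y0 q0; split; lra.
Qed.

Let dist_interval (a b x x0 : R) : a <= x <= b -> a <= x0 -> x0 <= b -> `|x - x0| <= b - a.
Proof. by move=> /andP[? ?] ? ?; rewrite ler_norml; apply/andP; split; lra. Qed.

Let dist_ends (a b x0 : R) : a <= x0 -> x0 <= b -> `|a - x0| + `|b - x0| <= b - a.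
Proof. by move=> ? ?; rewrite ler0_norm ?subr_le0// ger0_norm ?subr_ge0//; lra. Qed.

(** [x e^(it) - r0 e^(it0)] splits as [e^(it0) (x - r0) + x psi(t) (t - t0)], [psi] being the slope
    of [expi]. At the base point [A] is the radial derivative of [h] and [G] its angular derivative
    divided by the radius; their values differ by the factor ['i], which is the Cauchy-Riemann
    equation. *)
Let polar_expansion (r0 t0 : R) l : 0 < r0 ->
  cdiff H (r0%:C * expi t0) l ->
  exists A G : R * R -> C, [/\
    {for (r0, t0), continuous A} /\ A (r0, t0) = l * expi t0,
    {for (r0, t0), continuous G} /\ G (r0, t0) = l * ('i * expi t0) &
    forall x t, h x t = H (r0%:C * expi t0) + A (x, t) * (x - r0)%:C +
      x%:C * G (x, t) * (t - t0)%:C].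
Proof.
move=> r00 [phi [cphi <- HE]]; have [psi [cpsi psi0 expE]] := expi_slope t0.
have cz : {for (r0, t0), continuous (fun p : R * R => phi (p.1%:C * expi p.2))}.
  exact: (@continuous_comp _ _ _ (fun p : R * R => p.1%:C * expi p.2) phi _
    (@polar_cont _ _) cphi).
exists (fun p => phi (p.1%:C * expi p.2) * expi t0),
  (fun p => phi (p.1%:C * expi p.2) * psi p.2); split.
- split; last reflexivity.
  by apply: (contM cz); exact: (@cont_cst _ _ _ (expi t0)).
- split; last by rewrite /= psi0.
  apply: (contM cz); apply: (@continuous_comp _ _ _ snd psi); last exact: cpsi.
  exact: cvg_snd.
- move=> x t.
  have zE : x%:C * expi t - r0%:C * expi t0 =
      expi t0 * (x - r0)%:C + x%:C * psi t * (t - t0)%:C.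
    by rewrite (expE t) !rmorphB/=; ring.
  by rewrite /h (HE (x%:C * expi t)) zE/=; ring.
Qed.

(* In polar coordinates, [h] is a closed form on the rectangle
   [r1 <= r <= r2], [0 <= t <= 2 pi]. *)
Lemma circle_int_annulus (r1 r2 : R) : 0 < r1 -> r1 <= r2 -> r2 < rho ->
  (forall z, r1 <= normc z <= r2 -> exists l, cdiff H z l) ->
  circle_int r1 = circle_int r2.
Proof.
move=> r10 r12 r2rho dH.
have pi0 : 0 <= 2 * pi :> R by rewrite mulr_ge0// pi_ge0.
have x0P x : r1 <= x <= r2 -> `|x| < rho.
  move=> /andP[h1 h2]; rewrite ger0_norm; first exact: le_lt_trans h2 r2rho.
  exact: le_trans (ltW r10) h1.
(* The form is the imaginary part of [H(z) dz / z = H (dr / r + i dt)]. The sides [t = 0] and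
   [t = 2 pi] carry the same function and cancel, so only the two circles remain. *)
have := @closed_form_rectangle R (fun x t => Im (h x t) / x)
  (fun x t => Re (h x t)) r1 r2 0 (2 * pi) r12 pi0.
have -> : (fun x => Im (h x (2 * pi)) / x) = (fun x => Im (h x 0) / x).
  by apply/funext => x; rewrite /h expi_2pi.
rewrite subrr => cf; apply/eqP; rewrite -subr_eq0 -oppr_eq0 opprB.
apply/eqP/esym; apply: cf.
- move=> y _; apply: continuous_in_subspaceT => x; rewrite inE/= in_itv/= => xr.
  apply: (@cvgM _ _ (nbhs x)).
    by apply: (@continuous_comp _ _ _ (h ^~ y) Im);
      [apply: hx_cont; exact: x0P|exact: Im_cont].
  apply: (@cvgV _ _ (nbhs x)); last exact: cvg_id.
  by rewrite gt_eqF// (lt_le_trans r10)//; case/andP: xr.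
- move=> x xr; apply: continuous_subspaceT => t.
  by apply: (@continuous_comp _ _ _ (h x) Re);
      [apply: ht_cont; exact: x0P|exact: Re_cont].
move=> r0 t0 r0P t0P.
have r00 : 0 < r0 by apply: lt_le_trans r10 _; case/andP: r0P.
have [l dl] : exists l, cdiff H (r0%:C * expi t0) l.
  by apply: dH; rewrite normc_polar ger0_norm// ltW.
have [A [G [[cA A0] [cG G0] hE]]] := polar_expansion r00 dl.
exists (Re (l * expi t0)) => e e0.
(* The denominator is the factor of [rectangle_size] with [q = 1 / r1]; [1 / r1] bounds the [1 / x]
   of the radial component of the form. *)
pose eta := e / (2 + 2 / r1).
have d0 : 0 < 2 + 2 / r1 by rewrite addr_gt0// divr_gt0.
have eta0 : 0 < eta by rewrite divr_gt0.
have ceta : e = eta * (2 + 2 / r1) by rewrite /eta mulfVK// gt_eqF.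
have cX : {for (r0, t0), continuous (fun p : R * R => p.1%:C * G p)}.
  apply: (contM _ cG); apply: (@continuous_comp _ _ _ fst (real_complex R)).
    exact: cvg_fst.
  exact: real_complex_cont.
have unif (F : R * R -> C) : {for (r0, t0), continuous F} ->
    \forall p \near (r0, t0), normc (F p - F (r0, t0)) <= eta.
  move=> /cvgrPdist_le /(_ eta%:C); rewrite ltcR => /(_ eta0).
  by apply: filterS => p; rewrite normrcE lecR normcB.
have /nbhs_ballP[dl' /= dl'0 near3] : \forall p \near (r0, t0),
    [/\ normc (A p - l * expi t0) <= eta,
     normc (G p - l * ('i * expi t0)) <= eta &
     normc (p.1%:C * G p - r0%:C * (l * ('i * expi t0))) <= eta].
  have := unif _ cX => /=; rewrite G0 => nX.
  by apply: filterS3 (unif _ cA) (unif _ cG) nX; rewrite A0 G0; split.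
exists dl' => // x1 x2 y1 y2 rx1 x2r cy1 y2d /andP[x10 x20] /andP[y10 y20] xdl ydl.
have nP x y : x1 <= x <= x2 -> y1 <= y <= y2 ->
    [/\ normc (A (x, y) - l * expi t0) <= eta,
     normc (G (x, y) - l * ('i * expi t0)) <= eta &
     normc (x%:C * G (x, y) - r0%:C * (l * ('i * expi t0))) <= eta].
  move=> /andP[xx1 xx2] /andP[yy1 yy2]; apply: (near3 (x, y)); split.
    by rewrite /ball/= distrC; apply: le_lt_trans xdl; apply: dist_interval => //; rewrite xx1.
  by rewrite /ball/= distrC; apply: le_lt_trans ydl; apply: dist_interval => //; rewrite yy1.
have x12 := le_trans x10 x20; have y12 := le_trans y10 y20.
(* Cauchy-Riemann: the same constant is the derivative of [Re h] in [r] and of [Im h / r] in [t]. *)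
have ReImG : Re (l * expi t0) = Im (l * ('i * expi t0)).
  by rewrite !cReM !cImM/=; ring.
have ReB (u v : C) : normc (u - v) <= eta -> `|Re u - Re v| <= eta.
  by rewrite -cReN -cReD; exact: (le_trans (Re_le _)).
have ImB (u v : C) : normc (u - v) <= eta -> `|Im u - Im v| <= eta.
  by rewrite -cImN -cImD; exact: (le_trans (Im_le _)).
split=> [x xP|y yP].
- have xgt0 : 0 < x by apply: (lt_le_trans r10); case/andP: xP => + _; exact: le_trans.
  have [a1 g1 _] := nP x y1 xP (introT andP (conj (lexx y1) y12)).
  have [a2 g2 _] := nP x y2 xP (introT andP (conj y12 (lexx y2))).
  have xx : `|(x - r0) / x| <= (x2 - x1) / r1.
    have q1 : `|x - r0| <= x2 - x1 by exact: dist_interval.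
    have q2 : x^-1 <= r1^-1.
      by rewrite lef_pV2 ?posrE//; case/andP: xP => + _; exact: le_trans.
    by rewrite normrM normfV (gtr0_norm xgt0) ler_pM// invr_ge0 ltW.
  have yy : `|y1 - t0| + `|y2 - t0| <= y2 - y1 by exact: dist_ends.
  have -> : Im (h x y2) / x - Im (h x y1) / x - Re (l * expi t0) * (y2 - y1) =
      (Im (G (x, y2)) - Im (l * ('i * expi t0))) * (y2 - t0) -
      (Im (G (x, y1)) - Im (l * ('i * expi t0))) * (y1 - t0) +
      ((Im (A (x, y2)) - Im (l * expi t0)) - (Im (A (x, y1)) - Im (l * expi t0))) *
        ((x - r0) / x).
    rewrite ReImG !hE !cImD !Im_mulr [_%:C * G _]mulrC [_%:C * G (x, y1)]mulrC !Im_mulr.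
    field; exact: lt0r_neq0.
  apply: le_trans (four_terms (ImB _ _ g1) (ImB _ _ g2) (ImB _ _ a1) (ImB _ _ a2) yy xx) _.
  rewrite ceta -mulrA ler_pM2l//.
  by apply: (rectangle_size _ _ _).1; rewrite ?subr_ge0 ?invr_ge0// ltW.
- have [a1 _ g1] := nP x1 y (introT andP (conj (lexx x1) x12)) yP.
  have [a2 _ g2] := nP x2 y (introT andP (conj x12 (lexx x2))) yP.
  have yy : `|y - t0| <= y2 - y1 by exact: dist_interval.
  have xx : `|x1 - r0| + `|x2 - r0| <= x2 - x1 by exact: dist_ends.
  have -> : Re (h x2 y) - Re (h x1 y) - Re (l * expi t0) * (x2 - x1) =
      (Re (A (x2, y)) - Re (l * expi t0)) * (x2 - r0) -
      (Re (A (x1, y)) - Re (l * expi t0)) * (x1 - r0) +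
      ((Re (x2%:C * G (x2, y)) - Re (r0%:C * (l * ('i * expi t0)))) -
       (Re (x1%:C * G (x1, y)) - Re (r0%:C * (l * ('i * expi t0))))) * (y - t0).
    by rewrite !hE !cReD !Re_mulr; ring.
  apply: le_trans (four_terms (ReB _ _ a1) (ReB _ _ a2) (ReB _ _ g1) (ReB _ _ g2) xx yy) _.
  rewrite ceta -mulrA ler_pM2l//.
  by apply: (rectangle_size _ _ _).2; rewrite ?subr_ge0 ?invr_ge0// ltW.
Qed.

(** Compactness of the range of angles makes the continuity of [h] in the radius uniform in the
    angle. This serves to cross the radii 0 and [normc p], where [circle_int_annulus] says
    nothing. *)
Lemma circle_int_cont (r0 : R) : `|r0| < rho -> {for r0, continuous circle_int}.
Proof.
move=> r0rho; apply/(@cvgrPdist_le _ _ _ (nbhs r0)) => e e0.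
have pi20 : 0 < 2 * pi :> R by rewrite mulr_gt0// pi_gt0.
pose eps := e / (2 * pi).
have eps0 : 0 < eps by rewrite divr_gt0.
have eps20 : 0 < eps / 2 by rewrite divr_gt0.
have /compact_near_coveringP/(_ R (nbhs r0) (fun r t => `|Re (h r0 t) - Re (h r t)| <= eps) _) cpt :
  compact `[0, 2 * pi : R]%classic by exact: segment_compact.
have rr : \forall r \near r0, `|r| < rho.
  have : `|r| @[r --> r0] --> `|r0| by exact: norm_continuous.
  by move=> /cvgr_lt; exact.
have : \forall r \near r0, `[0, 2 * pi]%classic `<=`
    (fun t => `|Re (h r0 t) - Re (h r t)| <= eps).
  apply: cpt => t0 _.
  have cj : {for (r0, t0), continuous (fun p : R * R => Re (h p.1 p.2))}.
    apply: (@continuous_comp _ _ _ (fun p : R * R => h p.1 p.2) Re).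
      exact: h_cont.
    exact: Re_cont.
  have /cvgrPdist_le /(_ _ eps20) /nbhs_ballP[d /= d0 hd] := cj.
  exists (ball t0 d, ball r0 d); first by split; exact: nbhsx_ballx.
  move=> [t r] /= [ht hr].
  have h1 := hd (r, t) (conj hr ht).
  have h2 := hd (r0, t) (conj (ballxx r0 d0) ht).
  rewrite [leRHS]splitr; rewrite /= in h1 h2.
  rewrite (_ : _ - _ = (Re (h r0 t0) - Re (h r t)) - (Re (h r0 t0) - Re (h r0 t))); last by ring.
  by apply: le_trans (ler_normB _ _) _; exact: lerD.
move=> near1; apply: filterS2 near1 rr => r hr rr'.
have chr x : `|x| < rho -> {within `[0, 2 * pi], continuous (fun t => Re (h x t))}.
  move=> xr; apply: continuous_subspaceT => t.
  by apply: (@continuous_comp _ _ _ (h x) Re); [exact: ht_cont|exact: Re_cont].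
rewrite -segintB//; try exact: chr.
rewrite (_ : e = eps * (2 * pi - 0)); last by rewrite subr0 /eps mulfVK// gt_eqF.
apply: segint_le; first exact: ltW.
  by move=> z; apply: (@cvgB _ _ _ (nbhs z)); [exact: chr|exact: chr].
by move=> t ht; apply: hr; rewrite /= in_itv.
Qed.

Let right_limit (J : R -> R) (a b c : R) : a < b -> {for a, continuous J} ->
  (forall x, a < x < b -> J x = c) -> J a = c.
Proof.
move=> ab /cvgrPdist_lt cJ Jc; apply/eqP; rewrite -subr_eq0 -normr_eq0.
apply/negPn/negP => n0; have n0' : 0 < `|J a - c| by rewrite lt_neqAle eq_sym n0/=.
have /nbhs_ballP[d /= d0 hd] := cJ _ n0'.
have m0 : 0 < Num.min d (b - a) by rewrite lt_min d0 subr_gt0.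
have m1 : Num.min d (b - a) <= d by rewrite ge_min lexx.
have m2 : Num.min d (b - a) <= b - a by rewrite ge_min lexx orbT.
have mb : ball a d (a + Num.min d (b - a) / 2).
  by rewrite /ball/= opprD addrA subrr sub0r normrN gtr0_norm; lra.
have Jm : J (a + Num.min d (b - a) / 2) = c by apply: Jc; apply/andP; split; lra.
by have := hd _ mb; rewrite /= Jm ltxx.
Qed.

Let left_limit (J : R -> R) (a b c : R) : b < a -> {for a, continuous J} ->
  (forall x, b < x < a -> J x = c) -> J a = c.
Proof.
move=> ba cJ Jc; rewrite -(opprK a).
apply: (@right_limit (J \o -%R) (- a) (- b)); first by rewrite ltrN2.
  by apply: (@continuous_comp _ _ _ -%R J); [exact: oppr_continuous|rewrite opprK].
by move=> x xab; apply: Jc; rewrite /= ltrNl ltrNr andbC.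
Qed.

(** The integral is constant on annuli that avoid the circle through [p]; continuity glues these
    across that circle and down to radius 0, where the integral is [2 pi Re (H 0)]. *)
Lemma circle_int_const p r : 0 < r < rho ->
  (forall z, normc z < rho -> z != 0 -> z != p -> exists l, cdiff H z l) ->
  circle_int r = 2 * pi * Re (H 0).
Proof.
move=> /andP[r0 rrho] dH.
have ann r1 r2 : 0 < r1 -> r1 <= r2 -> r2 < rho -> (normc p < r1) || (r2 < normc p) ->
    circle_int r1 = circle_int r2.
  move=> r10 r12 r2rho pr; apply: circle_int_annulus => // z /andP[r1z zr2].
  apply: dH; first exact: le_lt_trans r2rho.
    by rewrite -normc_gt0; exact: lt_le_trans r1z.
  by apply: contraTneq pr => zp; rewrite -zp negb_or -!leNgt r1z zr2.
have cJ x : 0 <= x -> x < rho -> {for x, continuous circle_int}.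
  by move=> x0 xr; apply: circle_int_cont; rewrite ger0_norm.
have J0 : circle_int 0 = 2 * pi * Re (H 0).
  rewrite /circle_int /h; under [in LHS]eq_fun do rewrite mul0r.
  by rewrite segint_cst ?mulr_ge0 ?pi_ge0// subr0 mulrC.
rewrite -J0.
have before r' : 0 < r' -> r' < rho -> r' < normc p -> circle_int r' = circle_int 0.
  move=> r'0 r'rho r'p; apply/esym.
  apply: (@right_limit _ _ r') => //; first exact: cJ (lexx 0) (lt_trans r'0 r'rho).
  by move=> x /andP[x0 xr']; apply: ann => //; [exact: ltW|rewrite r'p orbT].
have [rp|pr|rp] := ltgtP r (normc p); first exact: before.
  have [p0|p0] := eqVneq (normc p) 0.
    apply/esym; apply: (@right_limit _ _ r) => //; first exact: cJ (lexx 0) (lt_trans r0 rrho).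
    by move=> x /andP[x0 xr']; apply: ann => //; [exact: ltW|rewrite p0 x0].
  have {}p0 : 0 < normc p by rewrite lt_neqAle eq_sym p0 normc_ge0.
  have prho := lt_trans pr rrho.
  transitivity (circle_int (normc p)).
    apply/esym; apply: (@right_limit _ _ r) => //; first exact: cJ (ltW p0) prho.
    by move=> x /andP[px xr]; apply: ann; rewrite ?px ?(lt_trans p0 px)// ltW.
  apply: (@left_limit _ _ 0) => //; first exact: cJ (ltW p0) prho.
  by move=> x /andP[x0 xp]; apply: before => //; exact: lt_trans xp prho.
apply: (@left_limit _ _ 0) => //; first exact: cJ (ltW r0) rrho.
by move=> x /andP[x0 xr]; apply: before => //; rewrite -?rp//; exact: lt_trans xr rrho.
Qed.

End mean_value.

(** * Integrals of bounded measurable functions against a probability *)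

Section bounded_integrals.
Context d (T : measurableType d) (R : realType).
Variable P : probability T R.
Local Notation C := R[i].
Local Notation Re := (@complex.Re R).
Local Notation Im := (@complex.Im R).
Implicit Types (u v : T -> R) (f g : T -> C).

(** Boundedness is preferred to integrability because it is stable under products, while it implies
    integrability for a probability. *)
Definition bmr u := measurable_fun setT u /\ exists M, forall x, `|u x| <= M.
Definition bmc f := measurable_fun setT f /\ exists M, forall x, normc (f x) <= M.
Definition cint f : C := (\int[P]_x Re (f x)) +i* (\int[P]_x Im (f x)).

Lemma measurable_funMc f g : measurable_fun setT f -> measurable_fun setT g ->
  measurable_fun setT (fun x => f x * g x).
Proof.
move=> /measurable_complexP[f1 f2] /measurable_complexP[g1 g2].
apply/measurable_complexP; split.
  by under eq_fun do rewrite cReM; apply: measurable_funB; exact: measurable_funM.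
by under eq_fun do rewrite cImM; apply: measurable_funD; exact: measurable_funM.
Qed.

Lemma measurable_fun_ifc (b : T -> bool) f g : measurable_fun setT b ->
  measurable_fun setT f -> measurable_fun setT g ->
  measurable_fun setT (fun x => if b x then f x else g x).
Proof.
move=> mb /measurable_complexP[f1 f2] /measurable_complexP[g1 g2].
apply/measurable_complexP; split.
  rewrite (_ : (fun _ => _) = fun x => if b x then Re (f x) else Re (g x)).
    exact: measurable_fun_ifT.
  by apply/funext => x; case: (b x).
rewrite (_ : (fun _ => _) = fun x => if b x then Im (f x) else Im (g x)).
  exact: measurable_fun_ifT.
by apply/funext => x; case: (b x).
Qed.

Lemma measurable_fun_cvgc (h : nat -> T -> C) f :
  (forall n, measurable_fun setT (h n)) -> (forall x, h n x @[n --> \oo] --> f x) ->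
  measurable_fun setT f.
Proof.
move=> mh hf; apply/measurable_complexP; split.
  apply: (measurable_fun_cvg (h := fun n x => Re (h n x))) => [n|x _].
    by have /measurable_complexP[] := mh n.
  by have /cvg_cplx[] := hf x.
apply: (measurable_fun_cvg (h := fun n x => Im (h n x))) => [n|x _].
  by have /measurable_complexP[] := mh n.
by have /cvg_cplx[] := hf x.
Qed.

Lemma bmr_integrable u : bmr u -> P.-integrable setT (EFin \o u).
Proof.
move=> [mu [M uM]].
apply: (@le_integrable _ _ _ P _ measurableT _ (cst M%:E)).
- exact/measurable_EFinP.
- by move=> x _ /=; rewrite lee_fin (le_trans (uM x))// ler_norm.
- exact: finite_measure_integrable_cst.
Qed.

Lemma bmr_cst r : bmr (cst r).
Proof. by split; [exact: measurable_cst|exists `|r|]. Qed.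

Lemma bmrD u v : bmr u -> bmr v -> bmr (fun x => u x + v x).
Proof.
move=> [mu [M uM]] [mv [N vN]]; split; first exact: measurable_funD.
by exists (M + N) => x; apply: le_trans (ler_normD _ _) _; exact: lerD.
Qed.

Lemma bmrN u : bmr u -> bmr (fun x => - u x).
Proof.
move=> [mu [M uM]]; split; first exact: measurableT_comp.
by exists M => x; rewrite normrN.
Qed.

Lemma bmrB u v : bmr u -> bmr v -> bmr (fun x => u x - v x).
Proof. by move=> bu /bmrN; exact: bmrD. Qed.

Lemma bmrM u v : bmr u -> bmr v -> bmr (fun x => u x * v x).
Proof.
move=> [mu [M uM]] [mv [N vN]]; split; first exact: measurable_funM.
by exists (M * N) => x; rewrite normrM ler_pM.
Qed.

Lemma bmrX u n : bmr u -> bmr (fun x => u x ^+ n).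
Proof.
move=> bu; elim: n => [|n IH].
  by under eq_fun do rewrite expr0; exact: bmr_cst.
by under eq_fun do rewrite exprS; exact: bmrM.
Qed.

Lemma bmcP f : bmc f <-> bmr (fun x => Re (f x)) /\ bmr (fun x => Im (f x)).
Proof.
split=> [[/measurable_complexP[mr mi] [M fM]]|[[mr [M rM]] [mi [N iN]]]].
  split; split=> //; exists M => x; apply: le_trans (fM x); [exact: Re_le|exact: Im_le].
split; first exact/measurable_complexP.
by exists (M + N) => x; apply: le_trans (normc_leD _) _; exact: lerD.
Qed.

Lemma bmc_Re f : bmc f -> bmr (fun x => Re (f x)).
Proof. by case/bmcP. Qed.

Lemma bmc_normc f : bmc f -> bmr (fun x => normc (f x)).
Proof.
move=> [mf [M fM]]; split; first exact: measurable_normc.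
by exists M => x; rewrite ger0_norm ?normc_ge0.
Qed.

Lemma bmc_cst c : bmc (cst c).
Proof. by split; [exact: measurable_cst|exists (normc c)]. Qed.

Lemma bmcD f g : bmc f -> bmc g -> bmc (fun x => f x + g x).
Proof.
move=> /bmcP[fr fi] /bmcP[gr gi]; apply/bmcP; split.
  by under eq_fun do rewrite cReD; exact: bmrD.
by under eq_fun do rewrite cImD; exact: bmrD.
Qed.

Lemma bmcM f g : bmc f -> bmc g -> bmc (fun x => f x * g x).
Proof.
move=> /bmcP[fr fi] /bmcP[gr gi]; apply/bmcP; split.
  by under eq_fun do rewrite cReM; apply: bmrB; exact: bmrM.
by under eq_fun do rewrite cImM; apply: bmrD; exact: bmrM.
Qed.

Lemma bmcZ c f : bmc f -> bmc (fun x => c * f x).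
Proof. by move=> bf; apply: bmcM => //; exact: bmc_cst. Qed.

Lemma bmc_conj f : bmc f -> bmc (fun x => (f x)^*).
Proof.
move=> /bmcP[fr fi]; apply/bmcP; split.
  by rewrite (_ : (fun _ => _) = fun x => Re (f x))//; apply/funext => x; case: (f x).
rewrite (_ : (fun _ => _) = fun x => - Im (f x)); first exact: bmrN.
by apply/funext => x; case: (f x).
Qed.

Lemma bmcX f n : bmc f -> bmc (fun x => f x ^+ n).
Proof.
move=> bf; elim: n => [|n IH].
  by under eq_fun do rewrite expr0; exact: bmc_cst.
by under eq_fun do rewrite exprS; exact: bmcM.
Qed.

Lemma bmc_real u : bmr u -> bmc (fun x => (u x)%:C).
Proof. by move=> bu; apply/bmcP; split=> //=; exact: bmr_cst. Qed.

Lemma RintD u v : bmr u -> bmr v ->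
  \int[P]_x (u x + v x) = \int[P]_x u x + \int[P]_x v x.
Proof. by move=> bu bv; rewrite RintegralD//; exact: bmr_integrable. Qed.

Lemma RintB u v : bmr u -> bmr v ->
  \int[P]_x (u x - v x) = \int[P]_x u x - \int[P]_x v x.
Proof. by move=> bu bv; rewrite RintegralB//; exact: bmr_integrable. Qed.

Lemma RintZ r u : bmr u -> \int[P]_x (r * u x) = r * \int[P]_x u x.
Proof. by move=> bu; rewrite RintegralZl//; exact: bmr_integrable. Qed.

Lemma Rint_cst r : \int[P]_x r = r.
Proof.
transitivity (r * fine (P setT)); first exact: Rintegral_cst.
by rewrite probability_setT mulr1.
Qed.

Lemma Rint_le u v : bmr u -> bmr v -> (forall x, u x <= v x) ->
  \int[P]_x u x <= \int[P]_x v x.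
Proof. by move=> bu bv uv; apply: le_Rintegral => //; exact: bmr_integrable. Qed.

Lemma cintD f g : bmc f -> bmc g -> cint (fun x => f x + g x) = cint f + cint g.
Proof.
move=> /bmcP[fr fi] /bmcP[gr gi].
by apply: complex_ext => /=; under eq_Rintegral do rewrite ?cReD ?cImD; rewrite RintD.
Qed.

Lemma cintZ c f : bmc f -> cint (fun x => c * f x) = c * cint f.
Proof.
move=> /bmcP[fr fi]; apply: complex_ext; rewrite ?cReM ?cImM /=;
  under eq_Rintegral do rewrite ?cReM ?cImM.
  rewrite RintB ?RintZ//; by apply: bmrM => //; exact: bmr_cst.
rewrite RintD ?RintZ//; by apply: bmrM => //; exact: bmr_cst.
Qed.

Lemma cintB f g : bmc f -> bmc g -> cint (fun x => f x - g x) = cint f - cint g.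
Proof.
move=> bf bg; under eq_fun do rewrite -mulN1r.
rewrite cintD//; last exact: bmcZ.
by rewrite cintZ// mulN1r.
Qed.

Lemma cint_conj f : bmc f -> cint (fun x => (f x)^*) = (cint f)^*.
Proof.
move=> /bmcP[fr fi]; apply: complex_ext => /=.
  by apply: eq_Rintegral => x _; case: (f x).
rewrite -mulN1r -RintZ//; apply: eq_Rintegral => x _.
by rewrite mulN1r; case: (f x).
Qed.

Lemma cint_real u : cint (fun x => (u x)%:C) = (\int[P]_x u x)%:C.
Proof. by apply: complex_ext => //=; rewrite Rint_cst. Qed.

(** With [w] the integral, [|w|^2] is the integral of the real part of [conj w * f], which is at
    most [|w| |f|] pointwise. *)
Lemma normc_cint f : bmc f -> normc (cint f) <= \int[P]_x normc (f x).
Proof.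
move=> bf; set w := cint f.
have [w0|w0] := eqVneq w 0.
  by rewrite w0 normc0; apply: Rintegral_ge0 => x _; exact: normc_ge0.
rewrite -(@ler_pM2l _ (normc w)) ?normc_gt0// -expr2.
have -> : normc w ^+ 2 = Re (cint (fun x => w^* * f x)).
  by rewrite cintZ// mulrC mulcJ.
rewrite /= -RintZ; last exact: bmc_normc.
have bwf : bmc (fun x => w^* * f x) by exact: bmcZ.
apply: Rint_le; first by case/bmcP: bwf.
  by apply: bmrM; [exact: bmr_cst|exact: bmc_normc].
move=> x; apply: le_trans (ler_norm _) _; apply: le_trans (Re_le _) _.
by rewrite normcM normc_conj.
Qed.

Lemma normc_cint_le f M : bmc f -> (forall x, normc (f x) <= M) ->
  normc (cint f) <= M.
Proof.
move=> bf fM; apply: le_trans (normc_cint bf) _; rewrite -[leRHS](Rint_cst M).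
by apply: Rint_le => //; [exact: bmc_normc|exact: bmr_cst].
Qed.

Lemma Rint_cvg (u_ : nat -> T -> R) u M : (forall n, measurable_fun setT (u_ n)) ->
  measurable_fun setT u -> (forall n x, `|u_ n x| <= M) ->
  {ae P, forall x, u_ n x @[n --> \oo] --> u x} ->
  \int[P]_x u_ n x @[n --> \oo] --> \int[P]_x u x.
Proof.
move=> mu_ mu uM uu.
have bu n : bmr (u_ n) by split=> //; exists M.
have [|||||iu _ lim] := @dominated_convergence _ _ _ P setT measurableT
  (fun n x => (u_ n x)%:E) (fun x => (u x)%:E) (cst M%:E).
- by move=> n; exact/measurable_EFinP.
- exact/measurable_EFinP.
- by apply: filterS uu => x ux _; exact: cvg_EFin (nearW _ _) ux.
- exact: finite_measure_integrable_cst.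
- by apply/nearW => x n _; rewrite lee_fin.
apply: fine_cvg; rewrite fineK//.
exact: integrable_fin_num.
Qed.

Lemma cint_cvg (f_ : nat -> T -> C) f M : (forall n, measurable_fun setT (f_ n)) ->
  measurable_fun setT f -> (forall n x, normc (f_ n x) <= M) ->
  {ae P, forall x, f_ n x @[n --> \oo] --> f x} ->
  cint (f_ n) @[n --> \oo] --> cint f.
Proof.
move=> mf_ /measurable_complexP[mr mi] fM ff; apply/cvg_cplx; split=> /=.
- apply: (@Rint_cvg _ _ M) => //.
  + by move=> n; have /measurable_complexP[] := mf_ n.
  + by move=> n x; apply: le_trans (fM n x); exact: Re_le.
  + by apply: filterS ff => x /cvg_cplx[].
- apply: (@Rint_cvg _ _ M) => //.
  + by move=> n; have /measurable_complexP[] := mf_ n.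
  + by move=> n x; apply: le_trans (fM n x); exact: Im_le.
  + by apply: filterS ff => x /cvg_cplx[].
Qed.

End bounded_integrals.

(** * The circle, its measure, and the mean value property on it *)

Section circle_integrals.
Variable R : realType.
Local Notation C := R[i].
Local Notation Re := (@complex.Re R).
Local Notation Im := (@complex.Im R).
Local Notation lam := (@circle_measure R).
Local Notation T := (circle R).

(* A bare [val] would carry the predicate of [circle] in unfolded form, which
   makes comparing terms slow. *)
Definition cval (xi : T) : C := val xi.

Lemma cval_inj : injective cval. Proof. exact: val_inj. Qed.

Lemma normc_circle (xi : T) : normc (cval xi) = 1.
Proof.
by have /eqP := valP xi; rewrite -/(cval xi) normrcE => /complexI.
Qed.

Lemma measurable_cval : measurable_fun setT (cval : T -> C).
Proof. by move=> _ B mB; rewrite setTI; exists B => //; rewrite setTI. Qed.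

Lemma measurable_to_circle d (U : measurableType d) (g : U -> T) :
  measurable_fun setT (fun x => cval (g x)) -> measurable_fun setT g.
Proof.
move=> mg _ _ [B mB <-]; rewrite !setTI -[X in measurable X]setTI.
exact: (mg measurableT B mB).
Qed.

(** The inverse cosine with its endpoint values set apart: measurability comes from continuity on
    the open interval and from a two-valued function outside of it. *)
Let arccos (x : R) := if (-1 < x) && (x < 1) then acos x else if 1 <= x then 0 else pi.

Let measurable_arccos : measurable_fun setT arccos.
Proof.
apply: measurable_fun_if => //.
- by apply: measurable_and; [exact: measurable_fun_ltr|exact: measurable_fun_ltr].
- rewrite setTI (_ : _ @^-1` _ = `](-1), 1[%classic); last first.
    by apply/seteqP; split=> x /=; rewrite in_itv.
  apply: open_continuous_measurable_fun; first exact: interval_open.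
  by move=> x; rewrite inE/= in_itv/=; exact: continuous_acos.
- apply: measurable_funTS; apply: measurable_fun_ifT => //.
  exact: measurable_fun_ler.
Qed.

Definition angle (xi : T) : R :=
  if 0 <= Im (cval xi) then arccos (Re (cval xi)) else - arccos (Re (cval xi)).

Lemma measurable_angle : measurable_fun setT angle.
Proof.
have /measurable_complexP[mr mi] := measurable_cval.
have ma : measurable_fun setT (fun xi : T => arccos (Re (cval xi))).
  exact: measurableT_comp measurable_arccos mr.
apply: measurable_fun_ifT => //; first exact: measurable_fun_ler.
exact: measurableT_comp.
Qed.

Lemma angleP (xi : T) : -pi <= angle xi <= pi /\ expi (angle xi) = cval xi.
Proof.
have n1 := normcE2 (cval xi); rewrite normc_circle expr1n in n1.
set x := Re (cval xi) in n1 *; set y := Im (cval xi) in n1 *.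
have x1 : -1 <= x <= 1.
  by have := Re_le (cval xi); rewrite normc_circle ler_norml.
have [c0 cpi] : 0 <= acos x <= pi /\ arccos x = acos x.
  split; first by rewrite acos_ge0// acos_lepi.
  rewrite /arccos; case: ifPn => // h; case: ifPn => [x1'|].
    have -> : x = 1 by apply/eqP; rewrite eq_le x1' andbT; case/andP: x1.
    by rewrite acos1.
  rewrite -ltNge => x1'; have -> : x = -1; last by rewrite acosN1.
  apply/eqP; rewrite eq_le; case/andP: x1 => -> _; rewrite andbT.
  by move: h; rewrite x1' andbT -leNgt.
have cx : cos (acos x) = x by apply: acosK; rewrite in_itv.
have sx : sin (acos x) = `|y|.
  by rewrite sin_acos// n1 addrC addKr sqrtr_sqr.
have [p1 p2] := andP c0.
rewrite /angle -/x -/y cpi; case: ifPn => [y0|]; last rewrite -ltNge => y0.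
  split; first by rewrite (le_trans _ p1)// oppr_le0 pi_ge0.
  by apply: complex_ext => /=; rewrite ?cx// sx ger0_norm.
split; first by rewrite lerN2 p2 (le_trans _ (pi_ge0 _))// oppr_le0.
by apply: complex_ext => /=; rewrite ?cosN ?sinN ?cx// sx ltr0_norm// opprK.
Qed.

(** [G] is continuous only at the points of the circle, so it is factored as [G \o expi] after the
    measurable section [angle]. The first factor is continuous on the line, hence measurable, and
    bounded on [[-pi, pi]] by the extreme value theorem. *)
Lemma bmc_circle (G : C -> C) : (forall z, normc z = 1 -> {for z, continuous G}) ->
  bmc (fun xi : T => G (cval xi)).
Proof.
move=> cG.
have cGe : continuous (fun t : R => G (expi t)).
  move=> t; apply: (@continuous_comp _ _ _ (@expi R) G); first exact: expi_cont.
  by apply: cG; rewrite normc_expi.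
have key (p : C -> R) : (forall z, {for z, continuous p}) ->
    bmr (fun xi : T => p (G (cval xi))).
  move=> cp; have cpe : continuous (fun t : R => p (G (expi t))).
    by move=> t; apply: (@continuous_comp _ _ _ (fun t : R => G (expi t)) p);
      [exact: cGe|exact: cp].
  have -> : (fun xi : T => p (G (cval xi))) = (fun t => p (G (expi t))) \o angle.
    by apply/funext => xi /=; have [_ ->] := angleP xi.
  split.
    by apply: measurableT_comp measurable_angle; exact: continuous_measurable_fun.
  have npi : -pi <= pi :> R by rewrite (le_trans _ (pi_ge0 _))// oppr_le0 pi_ge0.
  have [|c cp1 cm] := @EVT_max R (fun t => `|p (G (expi t))|) (-pi) pi npi.
    apply: continuous_subspaceT => t.
    by apply: (@continuous_comp _ _ _ (fun t : R => p (G (expi t))) Num.norm);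
      [exact: cpe|exact: norm_continuous].
  exists `|p (G (expi c))| => xi /=; apply: cm; rewrite in_itv/=.
  by have [] := angleP xi.
apply/bmcP; split; apply: key => z; [exact: Re_cont|exact: Im_cont].
Qed.

Let lebesgue_2pi : lebesgue_measure `[0, 2 * pi : R]%classic = (2 * pi)%:E.
Proof.
by rewrite (lebesgue_measure_itv `[0, 2 * pi]%R)/= lte_fin twopi_gt0 -EFinD subr0.
Qed.

Lemma Rint_circle (u : T -> R) : bmr u ->
  \int[lam]_x u x = (2 * pi)^-1 * segint (fun t => u (circle_param t)) 0 (2 * pi).
Proof.
have pos (v : T -> R) : bmr v -> (forall x, 0 <= v x) ->
    \int[lam]_x v x = (2 * pi)^-1 * segint (fun t => v (circle_param t)) 0 (2 * pi).
  move=> [mv [M vM]] v0.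
  have mc : measurable_fun setT (fun t : R => (v (circle_param t))%:E).
    apply/measurable_EFinP; apply: (@measurableT_comp _ _ _ _ _ _ v) => //.
    exact: measurable_circle_param.
  rewrite /Rintegral /circle_measure ge0_integral_distribution//; last first.
    exact/measurable_EFinP.
  rewrite integral_uniform//=; last by move=> t; rewrite lee_fin.
  rewrite subr0 fineM// ge0_fin_numE; last first.
    by apply: integral_ge0 => t _; rewrite lee_fin.
  apply: (@le_lt_trans _ _ (\int[@lebesgue_measure R]_(t in `[0%R, (2 * pi)%R]) (cst M%:E t))%E).
    apply: ge0_le_integral => //.
    - by move=> t _; rewrite lee_fin.
    - exact: measurable_funTS.
    - by move=> t _; rewrite lee_fin (le_trans _ (vM (circle_param t)))// ler_norm.
  rewrite integral_cst// [X in (_ * X)%E](_ : _ = (2 * pi)%:E).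
    by rewrite -EFinM ltry.
  exact: lebesgue_2pi.
move=> bu; have [mu [M uM]] := bu.
(* Shifting by the bound [M] reduces to the nonnegative case; the constant is then subtracted from
   both sides. *)
have buM : bmr (fun x => u x + M) by apply: bmrD bu (bmr_cst _ M).
have := pos _ buM; rewrite RintD//; last exact: bmr_cst.
rewrite Rint_cst; have : forall x, 0 <= u x + M.
  by move=> x; have := uM x; rewrite ler_norml => /andP[]; rewrite -subr_ge0 opprK.
move=> /[swap] /[apply] E; apply/eqP; rewrite -(inj_eq (addIr M)) E.
have iu : (@lebesgue_measure R).-integrable `[0, 2 * pi] (EFin \o (fun t => u (circle_param t))).
  apply: measurable_bounded_integrable => //.
  - by rewrite [X in (X < _)%E](_ : _ = (2 * pi)%:E) ?ltry//; exact: lebesgue_2pi.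
  - have mc : measurable_fun setT (fun t : R => u (circle_param t)).
      apply: (@measurableT_comp _ _ _ _ _ _ u) => //.
      exact: measurable_circle_param.
    exact: measurable_funTS mc.
  - by exists M; split=> [|K MK x _]; [exact: num_real|rewrite /= (le_trans (uM _))// ltW].
have p0 : 0 <= 2 * pi :> R by exact/ltW/twopi_gt0.
rewrite /segint RintegralD//; last first.
  by apply: segment_integrable => x; exact: cvg_cst.
rewrite -/(segint (cst M) 0 (2 * pi)) segint_cst// subr0 mulrDr addrC.
by rewrite [_ * (M * _)]mulrCA mulVf ?mulr1 1?addrC// gt_eqF// twopi_gt0.
Qed.

Lemma mean_value_circle (H : C -> C) (rho : R) p : 1 < rho ->
  (forall z, normc z < rho -> {for z, continuous H}) ->
  (forall z, normc z < rho -> z != 0 -> z != p -> exists l, cdiff H z l) ->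
  cint lam (fun xi => H (cval xi)) = H 0.
Proof.
move=> rho1 cH dH.
have bH : bmc (fun xi : T => H (cval xi)).
  by apply: bmc_circle => z z1; apply: cH; rewrite z1.
have key (G : C -> C) : (forall z, normc z < rho -> {for z, continuous G}) ->
    (forall z, normc z < rho -> z != 0 -> z != p -> exists l, cdiff G z l) ->
    \int[lam]_xi Re (G (cval xi)) = Re (G 0).
  move=> cG dG.
  have bG : bmc (fun xi : T => G (cval xi)).
    by apply: bmc_circle => z z1; apply: cG; rewrite z1.
  rewrite Rint_circle; last by case/bmcP: bG.
  have := @circle_int_const R G rho cG p 1; rewrite ltr01 rho1 => /(_ isT dG).
  rewrite /circle_int; under [X in segint X]eq_fun do rewrite mul1r.
  by move=> ->; rewrite mulrA mulVf ?mul1r// mulf_neq0// gt_eqF// pi_gt0.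
apply: complex_ext => /=; first exact: key.
have ImRe z : Im z = Re (- 'i * z) by rewrite cReM/=; ring.
under eq_Rintegral do rewrite ImRe.
rewrite ImRe; apply: (key (fun z => - 'i * H z)) => z zr.
  by apply: (contM _ (cH z zr)); exact: cont_cst.
move=> z0 zp; have [l dl] := dH z zr z0 zp.
by eexists; apply: cdiffM dl; exact: cdiff_cst.
Qed.

End circle_integrals.

(** * Poisson kernel and boundary values *)

Section poisson.
Variable R : realType.
Local Notation C := R[i].
Local Notation Re := (@complex.Re R).
Local Notation Im := (@complex.Im R).
Local Notation lam := (@circle_measure R).
Local Notation T := (circle R).
Implicit Types (z w : C) (xi : T).

(* The Poisson kernel [P_z]. *)
Definition pk z xi : R := (1 - normc z ^+ 2) / normc (cval xi - z) ^+ 2.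

Lemma conj_circle xi : (cval xi)^* = (cval xi)^-1.
Proof.
apply: (mulfI (x := cval xi)); first by rewrite -normc_gt0 normc_circle.
by rewrite mulcJ normc_circle expr1n mulfV// -normc_gt0 normc_circle.
Qed.

Lemma circle_neq0 xi : cval xi != 0.
Proof. by rewrite -normc_gt0 normc_circle. Qed.

Lemma circle_sub_gt0 z xi : normc z < 1 -> 0 < normc (cval xi - z).
Proof.
move=> z1; apply: lt_le_trans (normc_subr _ _).
by rewrite normc_circle subr_gt0.
Qed.

Lemma pk_ge0 z xi : normc z < 1 -> 0 <= pk z xi.
Proof.
move=> z1; rewrite divr_ge0 ?sqr_ge0// subr_ge0.
by rewrite expr_le1 ?normc_ge0 ?ltW.
Qed.

Lemma one_sub_neq0 z w : normc z * normc w < 1 -> 1 - z^* * w != 0.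
Proof.
move=> zw; rewrite subr_eq0; apply: contraTneq zw => /(congr1 (@normc R)).
by rewrite normcM normc_conj normc1 => <-; rewrite ltxx.
Qed.

(** On the circle [conj xi = 1 / xi], so the kernel becomes a rational function of [xi] whose only
    pole in the closed disc is [z]. *)
Lemma pkE z xi : normc z < 1 -> (pk z xi)%:C =
  (1 - z * z^*) * cval xi * (1 - z^* * cval xi)^-1 * (cval xi - z)^-1.
Proof.
move=> z1; have xz := circle_sub_gt0 xi z1.
have nz : cval xi - z != 0 by rewrite -normc_gt0.
have nz' : 1 - z^* * cval xi != 0 by apply: one_sub_neq0; rewrite normc_circle mulr1.
have -> : (pk z xi)%:C = (1 - (normc z ^+ 2)%:C) / (normc (cval xi - z) ^+ 2)%:C.
  by rewrite /pk rmorphM fmorphV rmorphB rmorph1.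
rewrite -!mulcJ rmorphB/= conj_circle.
rewrite (_ : (cval xi)^-1 - z^* = (1 - z^* * cval xi) * (cval xi)^-1); last first.
  by rewrite mulrBl mul1r mulfK// circle_neq0.
have := circle_neq0 xi; move: (cval xi) nz nz' => w nz nz' w0.
by field; rewrite nz nz' w0.
Qed.

(* [rho] bounds a disc on which both [1 - conj z w] and a function holomorphic
   on the disc of radius [rho] behave. *)
Let radius z rho : 1 < rho -> normc z < 1 -> exists r,
  [/\ 1 < r, r <= rho & forall w, normc w < r -> normc z * normc w < 1].
Proof.
move=> rho1 z1; have z0 := normc_ge0 z.
exists (Num.min rho (2 / (1 + normc z))); split.
- have n1 : 0 < 1 + normc z by rewrite ltr_wpDr.
  by rewrite lt_min rho1 ltr_pdivlMr//; lra.
- by rewrite ge_min lexx.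
- have n1 : 0 < 1 + normc z by rewrite ltr_wpDr.
  move=> w; rewrite lt_min => /andP[_]; rewrite ltr_pdivlMr//.
  have : 0 <= (1 - normc z) * normc w by rewrite mulr_ge0 ?normc_ge0// subr_ge0 ltW.
  lra.
Qed.

Let cdiff_one_sub z w : cdiff (fun w => 1 - z^* * w) w (0 - (0 * w + z^* * 1)).
Proof.
apply: cdiffD; first exact: cdiff_cst.
by apply: cdiffN; apply: cdiffM; [exact: cdiff_cst|exact: cdiff_id].
Qed.

Let cdiff_one_add z w : cdiff (fun w => 1 + z^* * w) w (0 + (0 * w + z^* * 1)).
Proof.
apply: cdiffD; first exact: cdiff_cst.
by apply: cdiffM; [exact: cdiff_cst|exact: cdiff_id].
Qed.

Lemma bmr_pk z : normc z < 1 -> bmr (pk z).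
Proof.
move=> z1.
have : bmc (fun xi : T => (pk z xi)%:C).
  under eq_fun do rewrite pkE//.
  apply: (@bmc_circle _ (fun w => (1 - z * z^*) * w * (1 - z^* * w)^-1 * (w - z)^-1)) => w w1.
  apply: contM; first apply: contM; first apply: contM.
  - exact: cont_cst.
  - exact: cont_id.
  - apply: contV; last exact: cdiff_cont (cdiff_one_sub z w).
    by apply: one_sub_neq0; rewrite w1 mulr1.
  - apply: contV; last by apply: contB; [exact: cont_id|exact: cont_cst].
    rewrite -normc_gt0; apply: lt_le_trans (normc_subr _ _).
    by rewrite w1 subr_gt0.
by move=> /bmcP[].
Qed.

(** On the circle the kernel is the real part of [(1 + conj z w) / (1 - conj z w)], which is
    holomorphic beyond the closed disc and equals 1 at 0. The total mass of the kernel is thus given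
    by the mean value property. *)
Let herglotz z w : normc z < 1 -> normc w = 1 ->
  (1 - z * z^*) * w * (1 - z^* * w)^-1 * (w - z)^-1 =
  2^-1 * ((1 + z^* * w) * (1 - z^* * w)^-1 + ((1 + z^* * w) * (1 - z^* * w)^-1)^*).
Proof.
move=> z1 w1; have w0 : w != 0 by rewrite -normc_gt0 w1.
have nz' : 1 - z^* * w != 0 by apply: one_sub_neq0; rewrite w1 mulr1.
have nz : w - z != 0.
  by rewrite subr_eq0; apply: contraTneq z1 => <-; rewrite w1 ltxx.
have -> : ((1 + z^* * w) * (1 - z^* * w)^-1)^* = (1 + z * w^*) * (1 - z * w^*)^-1.
  by rewrite rmorphM fmorphV rmorphB rmorphD rmorphM rmorph1/= conjCK.
have -> : w^* = w^-1 by apply: (mulfI w0); rewrite mulcJ w1 expr1n mulfV.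
rewrite (_ : 1 - z / w = (w - z) / w); last by rewrite mulrBl mulfV.
by field; rewrite nz nz' w0.
Qed.

Lemma Rint_pk z : normc z < 1 -> \int[lam]_xi pk z xi = 1.
Proof.
move=> z1; have [r [r1 _ zr]] := radius (ltr1n R 2) z1.
pose H w := (1 + z^* * w) * (1 - z^* * w)^-1.
have dH w : normc w < r -> exists l, cdiff H w l.
  move=> wr; eexists; apply: cdiffM; first exact: cdiff_one_add.
  by apply: cdiffV; [exact/one_sub_neq0/zr|exact: cdiff_one_sub].
have cH w : normc w < r -> {for w, continuous H}.
  by move=> /dH[l]; exact: cdiff_cont.
have bH : bmc (fun xi : T => H (cval xi)).
  by apply: bmc_circle => w w1; apply: cH; rewrite w1.
have mH : cint lam (fun xi => H (cval xi)) = 1.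
  rewrite (mean_value_circle r1 cH (p := 0))//.
    by rewrite /H mulr0 addr0 subr0 invr1 mulr1.
  by move=> w wr _ _; exact: dH.
apply: complexI; rewrite -cint_real.
have -> : (fun xi => (pk z xi)%:C) =
    (fun xi => 2^-1 * (H (cval xi) + (H (cval xi))^*)).
  by apply/funext => xi; rewrite pkE// herglotz// normc_circle.
have bHc := bmc_conj bH.
rewrite (cintZ _ _ (bmcD bH bHc)) (cintD _ bH bHc) (cint_conj _ bH) mH.
by rewrite rmorph1 -mulr2n mulVf// pnatr_eq0.
Qed.

(** In [(G xi - G z) P_z(xi)] the pole at [z] cancels, leaving [K], where the difference quotient
    makes [z] the exceptional point of the mean value property. The factor [w] gives [K 0 = 0], so
    the integral of [G P_z] is [G z] times the mass of [P_z]. *)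
Lemma poisson_formula (G : C -> C) rho z : 1 < rho -> normc z < 1 ->
  (forall w, normc w < rho -> exists l, cdiff G w l) ->
  cint lam (fun xi => G (cval xi) * (pk z xi)%:C) = G z.
Proof.
move=> rho1 z1 dG; have [r [r1 rrho zr]] := radius rho1 z1.
have {}dG w : normc w < r -> exists l, cdiff G w l.
  by move=> wr; apply: dG; exact: lt_le_trans rrho.
have [l dGz] := dG z (lt_trans z1 r1).
pose K w := (1 - z * z^*) * w * (1 - z^* * w)^-1 * diffquot z l G w.
have dK0 w : normc w < r -> exists m, cdiff (fun w => (1 - z * z^*) * w * (1 - z^* * w)^-1) w m.
  move=> wr; eexists; apply: cdiffM.
    by apply: cdiffM; [exact: cdiff_cst|exact: cdiff_id].
  by apply: cdiffV; [exact/one_sub_neq0/zr|exact: cdiff_one_sub].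
have dq w : normc w < r -> w != z -> exists m, cdiff (diffquot z l G) w m.
  move=> wr wz; have [m dw] := dG w wr; exact: diffquot_cdiff wz dw.
have cK w : normc w < r -> {for w, continuous K}.
  move=> wr; have [m dm] := dK0 w wr; apply: (contM (cdiff_cont dm)).
  have [->|wz] := eqVneq w z; first exact/cdiff_diffquot.
  by have [m' dm'] := dq w wr wz; exact: cdiff_cont dm'.
have bG : bmc (fun xi : T => G (cval xi)).
  apply: bmc_circle => w w1; have [|m dm] := dG w; first by rewrite w1.
  exact: cdiff_cont dm.
have bp : bmc (fun xi => (pk z xi)%:C) by exact/bmc_real/bmr_pk.
have mK : cint lam (fun xi => K (cval xi)) = 0.
  rewrite (mean_value_circle r1 cK (p := z)).
    by rewrite /K mulr0 !mul0r.
  move=> w wr _ wz; have [m dm] := dK0 w wr; have [m' dm'] := dq w wr wz.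
  by eexists; exact: cdiffM dm dm'.
have KE : (fun xi => K (cval xi)) =
    (fun xi => G (cval xi) * (pk z xi)%:C - G z * (pk z xi)%:C).
  apply/funext => xi; rewrite -mulrBl pkE// /K /diffquot.
  have nz : cval xi - z != 0 by rewrite -normc_gt0 circle_sub_gt0.
  by rewrite -subr_eq0 (negbTE nz); ring.
move: mK; rewrite KE cintB//; [|exact: bmcM|exact: bmcZ].
rewrite cintZ// cint_real Rint_pk// mulr1 => /eqP.
by rewrite subr_eq0 => /eqP.
Qed.

(** As [conj xi = 1 / xi] and [G 0 = 0], the integrand is the difference quotient of [G] at 0, whose
    value at 0 is [a]. *)
Lemma first_coefficient (G : C -> C) rho a : 1 < rho ->
  (forall w, normc w < rho -> exists l, cdiff G w l) ->
  G 0 = 0 -> cdiff G 0 a ->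
  cint lam (fun xi => G (cval xi) * (cval xi)^*) = a.
Proof.
move=> rho1 dG G0 dG0.
have -> : (fun xi : T => G (cval xi) * (cval xi)^*) =
    (fun xi => diffquot 0 a G (cval xi)).
  apply/funext => xi; rewrite conj_circle /diffquot (negbTE (circle_neq0 xi)).
  by rewrite G0 !subr0.
have dq w : normc w < rho -> w != 0 -> exists m, cdiff (diffquot 0 a G) w m.
  move=> wr wz; have [m dw] := dG w wr; exact: diffquot_cdiff wz dw.
rewrite (mean_value_circle rho1 (p := 0)).
- by rewrite /diffquot eqxx.
- move=> w wr; have [->|wz] := eqVneq w 0; first exact/cdiff_diffquot.
  by have [m dm] := dq w wr wz; exact: cdiff_cont dm.
- by move=> w wr w0 _; exact: dq.
Qed.

Lemma negative_coefficient (G : C -> C) rho : 1 < rho ->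
  (forall w, normc w < rho -> exists l, cdiff G w l) ->
  cint lam (fun xi => G (cval xi) * cval xi) = 0.
Proof.
move=> rho1 dG.
have dq w : normc w < rho -> exists m, cdiff (fun w => G w * w) w m.
  by move=> /dG[m dm]; eexists; apply: (cdiffM dm); exact: cdiff_id.
rewrite (@mean_value_circle _ (fun w => G w * w) rho 0)//.
- by rewrite mulr0.
- by move=> w /dq[m]; exact: cdiff_cont.
- by move=> w wr _ _; exact: dq.
Qed.

End poisson.

(** * Dilates of holomorphic functions and the Schwarz lemma *)

Section schwarz.
Variable R : realType.
Local Notation C := R[i].
Local Notation Re := (@complex.Re R).
Local Notation Im := (@complex.Im R).
Local Notation lam := (@circle_measure R).
Local Notation T := (circle R).
Implicit Types (z w : C) (xi : T) (F G : C -> C).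

Definition holo_disc F := forall z, normc z < 1 -> exists l, cdiff F z l.

Lemma cdiff_scale F (r : R) z l : cdiff F (r%:C * z) l ->
  cdiff (fun w => F (r%:C * w)) z (l * r%:C).
Proof.
have dr : cdiff (fun w => r%:C * w) z (0 * z + r%:C * 1).
  by apply: cdiffM; [exact: cdiff_cst|exact: cdiff_id].
by rewrite mul0r add0r mulr1 in dr; exact: (cdiff_comp dr).
Qed.

Lemma holo_scale F (r : R) w : holo_disc F -> 0 < r < 1 -> normc w < r^-1 ->
  exists l, cdiff (fun w => F (r%:C * w)) w l.
Proof.
move=> dF /andP[r0 r1] wr.
have [|l dl] := dF (r%:C * w).
  by rewrite normcM normc_real gtr0_norm// mulrC -ltr_pdivlMr// mul1r.
by exists (l * r%:C); exact: cdiff_scale.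
Qed.

Lemma bmc_scale F (r : R) : holo_disc F -> 0 < r < 1 ->
  bmc (fun xi : T => F (r%:C * cval xi)).
Proof.
move=> dF r01; apply: (@bmc_circle _ (fun w => F (r%:C * w))) => w w1.
have [|l dl] := holo_scale (w := w) dF r01; last exact: cdiff_cont dl.
by case/andP: r01 => r0 r1; rewrite w1 invf_gt1.
Qed.

(** The variance of [u] is nonnegative. *)
Lemma Rint_sqr (u : T -> R) : bmr u ->
  (\int[lam]_x u x) ^+ 2 <= \int[lam]_x (u x ^+ 2).
Proof.
move=> bu; set m := \int[lam]_x u x.
have : 0 <= \int[lam]_x ((u x - m) ^+ 2) by apply: Rintegral_ge0 => x _; exact: sqr_ge0.
have -> : \int[lam]_x ((u x - m) ^+ 2) =
    \int[lam]_x (u x ^+ 2 + ((- 2 * m) * u x + cst (m ^+ 2) x)).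
  by apply: eq_Rintegral => x _; rewrite /cst/=; ring.
have bm : bmr (cst m : T -> R) by exact: bmr_cst.
have b2 : bmr (fun x => (- 2 * m) * u x) by apply: bmrM bu; exact: bmr_cst.
rewrite RintD; [|exact: bmrX|by apply: bmrD => //; exact: bmr_cst].
rewrite RintD//; last exact: bmr_cst.
by rewrite RintZ// Rint_cst -/m; nra.
Qed.

Let sqr_sub_expand (p : R) (u a : C) : normc u <= 1 ->
  normc (u - a * p%:C) ^+ 2 <=
  1 + normc a ^+ 2 * p ^+ 2 + Re ((- 2 * p)%:C * a^* * u).
Proof.
move=> u1; have : normc u ^+ 2 <= 1 by rewrite expr_le1 ?normc_ge0.
by rewrite !normcE2; case: u a {u1} => [u1 u2] [a1 a2] /=; nra.
Qed.

Let mean_bound (p q : R) : 1 <= q -> 0 <= p ->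
  1 + q * p - 2 * p * q <= 1 - p.
Proof. nra. Qed.

(* The first coefficient of [F (r xi)] is [r a], hence the mean square of
   [F (r xi) - a r xi] is at most [1 - r^2]; the Poisson formula turns this into
   a pointwise bound, and [r] tends to 1. *)
Lemma schwarz F a : holo_disc F -> (forall z, normc z < 1 -> normc (F z) <= 1) ->
  F 0 = 0 -> cdiff F 0 a -> 1 <= normc a ->
  forall z, normc z < 1 -> F z = a * z.
Proof.
move=> dF F1 F0 dF0 a1 z z1.
have [_ [K zK]] := bmr_pk z1.
have K0 : 0 <= K by apply: le_trans (zK (circle_param 0)).
have key r : 0 < r < 1 -> normc (F (r%:C * z) - a * (r%:C * z)) ^+ 2 <= K ^+ 2 * (1 - r ^+ 2).
  move=> r01; have [r0 r1] := andP r01.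
  have ri1 : 1 < r^-1 by rewrite invf_gt1.
  pose D w := F (r%:C * w) - a * (r%:C * w).
  have dD w : normc w < r^-1 -> exists l, cdiff D w l.
    move=> wr; have [l dl] := holo_scale dF r01 wr.
    eexists; apply: (cdiffD dl); apply: cdiffN; apply: cdiffM; first exact: cdiff_cst.
    by apply: cdiffM; [exact: cdiff_cst|exact: cdiff_id].
  have bF := bmc_scale dF r01.
  have bD : bmc (fun xi : T => D (cval xi)).
    by apply: bmc_circle => w w1; have [|l dl] := dD w; [rewrite w1|exact: cdiff_cont dl].
  have bFc : bmc (fun xi : T => F (r%:C * cval xi) * (cval xi)^*).
    apply: (bmcM bF); apply: bmc_conj; apply: (@bmc_circle _ id) => w _; exact: cont_id.
  rewrite -/(D z) -(poisson_formula ri1 z1 dD).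
  have bp : bmc (fun xi => (pk z xi)%:C) by exact/bmc_real/bmr_pk.
  have bDp := bmcM bD bp.
  apply: (@le_trans _ _ ((\int[lam]_xi normc (D (cval xi) * (pk z xi)%:C)) ^+ 2)).
    by rewrite lerXn2r ?nnegrE ?normc_ge0 ?Rintegral_ge0 ?normc_cint// => xi _; exact: normc_ge0.
  apply: le_trans (Rint_sqr (bmc_normc bDp)) _.
  have bF2 : bmr (fun xi : T => Re ((- 2 * r)%:C * a^* * (F (r%:C * cval xi) * (cval xi)^*))).
    exact: bmc_Re (bmcZ _ bFc).
  have mF : cint lam (fun xi => F (r%:C * cval xi) * (cval xi)^*) = a * r%:C.
    apply: (first_coefficient (G := fun w => F (r%:C * w)) ri1).
    - by move=> w; exact: holo_scale.
    - by rewrite mulr0.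
    - by apply: cdiff_scale; rewrite mulr0.
  have bD2 : bmr (fun xi : T => normc (D (cval xi)) ^+ 2) by exact/bmrX/bmc_normc.
  have bR : bmr (fun xi : T => 1 + normc a ^+ 2 * r ^+ 2 +
     Re ((- 2 * r)%:C * a^* * (F (r%:C * cval xi) * (cval xi)^*))).
    by apply: bmrD bF2; exact: bmr_cst.
  apply: (@le_trans _ _ (K ^+ 2 * \int[lam]_xi (normc (D (cval xi)) ^+ 2))).
    rewrite -RintZ//; apply: Rint_le.
    - exact/bmrX/bmc_normc.
    - by apply: bmrM bD2; exact: bmr_cst.
    - move=> xi; rewrite normcM normc_real exprMn mulrC ler_wpM2r ?sqr_ge0//.
      by rewrite lerXn2r ?nnegrE// normr_ge0.
  rewrite ler_wpM2l ?sqr_ge0//.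
  apply: (@le_trans _ _ (\int[lam]_xi (1 + normc a ^+ 2 * r ^+ 2 +
     Re ((- 2 * r)%:C * a^* * (F (r%:C * cval xi) * (cval xi)^*))))).
    apply: Rint_le => // xi.
    have x1 := normc_circle xi.
    have Fx : normc (F (r%:C * cval xi) * (cval xi)^*) <= 1.
      rewrite normcM normc_conj x1 mulr1; apply: F1.
      by rewrite normcM normc_real x1 mulr1 gtr0_norm.
    (* Multiplying by [conj xi], of modulus 1, turns the linear term into a constant; the cross term
       of the expanded square then integrates to the first coefficient [mF]. *)
    have -> : normc (D (cval xi)) = normc (F (r%:C * cval xi) * (cval xi)^* - a * r%:C).
      rewrite (_ : _ - a * r%:C = D (cval xi) * (cval xi)^*); last first.
        by rewrite /D mulrBl -!mulrA mulcJ x1 expr1n mulr1.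
      by rewrite normcM normc_conj x1 mulr1.
    exact: (sqr_sub_expand _ _ Fx).
  rewrite RintD; [|exact: bmr_cst|exact: bF2].
  rewrite Rint_cst.
  have -> : \int[lam]_xi Re ((- 2 * r)%:C * a^* * (F (r%:C * cval xi) * (cval xi)^*)) =
    Re ((- 2 * r)%:C * a^* * (a * r%:C)).
    by rewrite -mF -cintZ.
  have -> : (- 2 * r)%:C * a^* * (a * r%:C) = (- 2 * r ^+ 2 * normc a ^+ 2)%:C.
    rewrite [RHS]rmorphM/= -mulcJ !rmorphM/=; ring.
  have : 1 <= normc a ^+ 2 by rewrite exprn_ege1.
  by move=> /mean_bound/(_ (sqr_ge0 r)); rewrite !mulNr.
suff : normc (F z - a * z) ^+ 2 <= 0.
  rewrite le_eqVlt ltNge sqr_ge0 orbF sqrf_eq0 normc_eq0 subr_eq0.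
  by move/eqP.
have ccz : {for (1 : R), continuous (fun r : R => r%:C * z)}.
  by apply: contM; [exact: real_complex_cont|exact: cont_cst].
have cL : {for (1 : R), continuous (fun r : R => F (r%:C * z) - a * (r%:C * z))}.
  apply: contB; last by apply: (contM _ ccz); exact: cont_cst.
  have [l dl] := dF z z1.
  apply: (@continuous_comp _ _ _ (fun r : R => r%:C * z) F); first exact: ccz.
  by rewrite mul1r; exact: cdiff_cont dl.
have lim1 : (fun r : R => normc (F (r%:C * z) - a * (r%:C * z)) ^+ 2) @ (1 : R)^'- -->
    normc (F z - a * z) ^+ 2.
  apply: cvg_at_left_filter.
  have : {for (1 : R), continuous (fun r : R => normc (F (r%:C * z) - a * (r%:C * z)))}.
    apply: (@continuous_comp _ _ _ (fun r : R => F (r%:C * z) - a * (r%:C * z)) (@normc R)).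
      exact: cL.
    exact: normc_cont.
  rewrite /prop_for /continuous_at mul1r => cn.
  by rewrite expr2; under eq_fun do rewrite expr2; exact: cvgM.
have lim2 : (fun r : R => K ^+ 2 * (1 - r ^+ 2)) @ (1 : R)^'- --> K ^+ 2 * (1 - 1 ^+ 2).
  apply: cvg_at_left_filter; apply: cvgM; first exact: cvg_cst.
  apply: cvgB; first exact: cvg_cst.
  exact: exprn_continuous.
rewrite expr1n subrr mulr0 in lim2.
apply: (ler_cvg_to lim1 lim2); near=> r; apply: key; apply/andP; split; near: r; last exact: nbhs_left_lt.
by apply: nbhs_left_gt; exact: ltr01.
Unshelve. all: by end_near. Qed.

End schwarz.

(** * Boundary values of bounded holomorphic functions *)

Section boundary_values.
Variable R : realType.
Local Notation C := R[i].
Local Notation Re := (@complex.Re R).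
Local Notation Im := (@complex.Im R).
Local Notation lam := (@circle_measure R).
Local Notation T := (circle R).
Implicit Types (z w : C) (xi : T) (F f : C -> C).

(** A sequence of radii, as dominated convergence and measurability of limits are used along
    sequences. The shift by 2 keeps every radius strictly between 0 and 1. *)
Definition rn (n : nat) : R := 1 - n.+2%:R^-1.

Lemma rn01 n : 0 < rn n < 1.
Proof.
by rewrite /rn subr_gt0 invf_lt1// ltr1n/= ltrBlDr ltrDl invr_gt0.
Qed.

Lemma rn_cvg : rn @ \oo --> (1 : R).
Proof.
have : (fun n => 1 - (n.+2%:R^-1 : R)) @ \oo --> (1 - 0 : R).
  apply: cvgB; first exact: cvg_cst.
  have := @cvg_harmonic R; rewrite -cvg_shiftS.
  by rewrite /harmonic.
by rewrite subr0.
Qed.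

Lemma rn_at_left : rn @ \oo --> (1 : R)^'-.
Proof.
move=> P; rewrite /at_left /within/= => nP.
have := rn_cvg nP; rewrite /nbhs/=; apply: filterS => n /=; apply.
by have /andP[] := rn01 n.
Qed.

Lemma scale_cvg F z : {for z, continuous F} -> F ((rn n)%:C * z) @[n --> \oo] --> F z.
Proof.
move=> cF; have rz : (rn n)%:C * z @[n --> \oo] --> z.
  have : {for (1 : R), continuous (fun r : R => r%:C * z)}.
    by apply: contM; [exact: real_complex_cont|exact: cont_cst].
  rewrite /prop_for /continuous_at mul1r => cz.
  exact: (cvg_comp _ _ rn_cvg cz).
exact: (cvg_comp _ _ rz cF).
Qed.

Definition rn_limit f xi (l : C) := f ((rn n)%:C * cval xi) @[n --> \oo] --> l.

Section one_function.
Variables (F : C -> C) (Fs : T -> C) (M : R).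
Hypotheses (dF : holo_disc F) (FM : forall z, normc z < 1 -> normc (F z) <= M).
Hypotheses (mFs : measurable_fun setT Fs).
Hypothesis FFs : {ae lam, forall xi, rn_limit F xi (Fs xi)}.

Let dFn n w : normc w < (rn n)^-1 -> exists l, cdiff (fun w => F ((rn n)%:C * w)) w l.
Proof. exact: holo_scale (rn01 n). Qed.

Let rni n : 1 < (rn n)^-1.
Proof. by have /andP[r0 r1] := rn01 n; rewrite invf_gt1. Qed.

Let cint_lim (k : T -> C) : bmc k ->
  cint lam (fun xi => F ((rn n)%:C * cval xi) * k xi) @[n --> \oo] -->
  cint lam (fun xi => Fs xi * k xi).
Proof.
move=> bk; have [mk [K kK]] := bk.
have bF n : bmc (fun xi : T => F ((rn n)%:C * cval xi)) by exact: bmc_scale (rn01 n).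
apply: (@cint_cvg _ _ _ _ _ _ (M * K)).
- by move=> n; exact: measurable_funMc (bF n).1 mk.
- exact: measurable_funMc mFs mk.
- move=> n xi; rewrite normcM ler_pM ?normc_ge0// FM//.
  have /andP[r0 r1] := rn01 n.
  by rewrite normcM normc_real normc_circle mulr1 gtr0_norm.
- apply: filterS FFs => xi h.
  by apply: (cvgM h); exact: cvg_cst.
Qed.

(** The dilates of [F] are holomorphic beyond the closed disc, where [poisson_formula] applies. One
    side converges by domination, the other by continuity of [F] at [z]. *)
Lemma boundary_poisson z : normc z < 1 ->
  cint lam (fun xi => Fs xi * (pk z xi)%:C) = F z.
Proof.
move=> z1; have bp : bmc (fun xi => (pk z xi)%:C) by exact/bmc_real/bmr_pk.
have h1 := cint_lim bp.
have [l dl] := dF z1; have h2 := scale_cvg (cdiff_cont dl).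
have E : (fun n => cint lam (fun xi => F ((rn n)%:C * cval xi) * (pk z xi)%:C)) =
    (fun n => F ((rn n)%:C * z)).
  by apply/funext => n; exact: (poisson_formula (rni n) z1 (@dFn n)).
rewrite E in h1; exact: cvg_unique h1 h2.
Qed.

Lemma boundary_first_coefficient a : F 0 = 0 -> cdiff F 0 a ->
  cint lam (fun xi => Fs xi * (cval xi)^*) = a.
Proof.
move=> F0 dF0; have bv : bmc (fun xi : T => (cval xi)^*).
  by apply: bmc_conj; apply: (@bmc_circle _ id) => w _; exact: cont_id.
have h1 := cint_lim bv.
have E : (fun n => cint lam (fun xi => F ((rn n)%:C * cval xi) * (cval xi)^*)) =
    (fun n => (fun w => a * w) ((rn n)%:C * 1)).
  apply/funext => n; rewrite mulr1.
  apply: (first_coefficient (G := fun w => F ((rn n)%:C * w)) (rni n) (@dFn n)).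
    by rewrite mulr0.
  by apply: cdiff_scale; rewrite mulr0.
rewrite E in h1.
have h2 : (fun w => a * w) ((rn n)%:C * 1) @[n --> \oo] --> a * 1.
  by apply: (@scale_cvg (fun w => a * w)); apply: contM; [exact: cont_cst|exact: cont_id].
by rewrite mulr1 in h2; exact: cvg_unique h1 h2.
Qed.

Lemma boundary_negative_coefficient :
  cint lam (fun xi => Fs xi * cval xi) = 0.
Proof.
have bv : bmc (fun xi : T => cval xi).
  by apply: (@bmc_circle _ id) => w _; exact: cont_id.
have h1 := cint_lim bv.
have E : (fun n => cint lam (fun xi => F ((rn n)%:C * cval xi) * cval xi)) = cst 0.
  by apply/funext => n; exact: (negative_coefficient (rni n) (@dFn n)).
rewrite E in h1.
have h2 : (cst 0 : nat -> C) @ \oo --> (0 : C) by exact: cvg_cst.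
exact: cvg_unique h1 h2.
Qed.

End one_function.

(* [g] is a measurable version of the boundary map of the inner function [f]. *)
Definition bvals f (g : T -> T) := [/\ holo_disc f,
  forall z, normc z < 1 -> normc (f z) < 1, measurable_fun setT g &
  {ae lam, forall xi, rn_limit f xi (cval (g xi))}].

(** [boundary_map f] is not known to be measurable. Made constant on a measurable null set [N] off
    which the radial limits exist with modulus 1, it becomes an everywhere limit of measurable
    functions. *)
Lemma inner_bvals f : inner f -> exists2 g, bvals f g &
  {ae lam, forall xi, boundary_map f xi = g xi}.
Proof.
move=> [[f1 df] [N [mN N0 subN]]].
pose pt : T := circle_param 0.
pose g xi := if xi \in N then pt else boundary_map f xi.
have f1' z : normc z < 1 -> normc (f z) < 1.
  have := f1 z; rewrite /disc/= !normrcE !(ltcR _ 1); exact.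
have df' : holo_disc f.
  move=> z z1; apply: derivable_cdiff; apply: df.
  by rewrite /disc/= normrcE (ltcR _ 1).
have good xi : xi \notin N -> rn_limit f xi (cval (boundary_map f xi)).
  move=> xiN; have [cv n1] : cvg (radial f xi r @[r --> 1^'-]) /\ `|radial_limit f xi| = 1.
    by apply: contrapT => h; move: xiN; rewrite notin_setE; apply; exact: subN.
  rewrite /cval /boundary_map val_insubd n1 eqxx.
  exact: (cvg_comp _ _ rn_at_left cv).
have lim xi : (if xi \in N then cval pt else f ((rn n)%:C * cval xi)) @[n --> \oo] --> cval (g xi).
  by rewrite /g; case: ifPn => [_|/good//]; exact: cvg_cst.
have mh n : measurable_fun setT (fun xi : T => if xi \in N then cval pt else f ((rn n)%:C * cval xi)).
  apply: measurable_fun_ifc; last exact: (bmc_scale df' (rn01 n)).1.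
    apply: (measurable_fun_bool true).
    rewrite setTI (_ : _ @^-1` _ = N)//.
    by apply/seteqP; split=> xi /=; [exact: set_mem|exact: mem_set].
  exact: measurable_cst.
exists g.
  split=> //.
    exact: measurable_to_circle (measurable_fun_cvgc mh lim).
  exists N; split=> // xi /= h; apply: contrapT => xiN; apply: h.
  have {}xiN : xi \notin N by rewrite notin_setE.
  by rewrite /g ifN//; exact: good.
exists N; split=> // xi /= h; apply: contrapT => xiN; apply: h.
by rewrite /g ifN// notin_setE.
Qed.

Lemma bvals_pow f g n : bvals f g -> [/\ holo_disc (fun z => f z ^+ n),
  forall z, normc z < 1 -> normc (f z ^+ n) <= 1,
  measurable_fun setT (fun xi => cval (g xi) ^+ n) &
  {ae lam, forall xi, rn_limit (fun z => f z ^+ n) xi (cval (g xi) ^+ n)}].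
Proof.
move=> [df f1 mg fg]; split.
- by move=> w /df[l dl]; eexists; exact: cdiffX dl.
- by move=> w w1; rewrite normcX exprn_ile1 ?normc_ge0// ltW// f1.
- have bv : bmc (fun xi : T => cval xi ^+ n).
    by apply: bmcX; apply: (@bmc_circle _ id) => w _; exact: cont_id.
  by apply: (@measurableT_comp _ _ _ _ _ _ (fun xi : T => cval xi ^+ n)) mg; case: bv.
- apply: filterS fg => xi; rewrite /rn_limit; elim: n => [|n IH] h.
    by under eq_fun do rewrite expr0; exact: cvg_cst.
  by rewrite exprS; under eq_fun do rewrite exprS; exact: (cvgM h (IH h)).
Qed.

Lemma bvals_moment f g z n : bvals f g -> normc z < 1 ->
  cint lam (fun xi => cval (g xi) ^+ n * (pk z xi)%:C) = f z ^+ n.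
Proof. by move=> /(bvals_pow n)[dfn fn1 mgn fgn]; exact: boundary_poisson dfn fn1 mgn fgn _. Qed.

End boundary_values.

(** * Measures on the circle and their moments *)

Section density.
Local Open Scope ereal_scope.
Context d (T : measurableType d) (R : realType).
Variables (mu : {measure set T -> \bar R}) (k : T -> R).
Hypotheses (mk : measurable_fun setT k) (k0 : forall x, (0 <= k x)%R).

(** The two proofs are arguments so that the measure structure can be attached to the term
    [density mk k0]. *)
Definition density of measurable_fun setT k & (forall x, (0 <= k x)%R) : set T -> \bar R :=
  fun A => \int[mu]_(x in A) (k x)%:E.

Local Notation nu := (density mk k0).

Let density0 : nu set0 = 0. Proof. by rewrite /density integral_set0. Qed.

Let density_ge0 A : 0 <= nu A.
Proof. by apply: integral_ge0 => x _; rewrite lee_fin. Qed.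

Let density_sigma_additive : semi_sigma_additive nu.
Proof.
move=> /= F mF tF mUF; rewrite /density; apply: cvg_toP.
  apply: ereal_nondecreasing_is_cvgn => m n mn.
  apply: lee_sum_nneg_natr => // i _ _.
  by apply: integral_ge0 => /= x _; rewrite lee_fin.
rewrite ge0_integral_bigcup//=.
- by apply: measurable_funTS; exact/measurable_EFinP.
- by move=> x _; rewrite lee_fin.
Qed.

HB.instance Definition _ := isMeasure.Build _ _ _ nu
  density0 density_ge0 density_sigma_additive.

Let mkE : measurable_fun setT (EFin \o k).
Proof. exact/measurable_EFinP. Qed.

Let integral_density_indic E : measurable E ->
  \int[nu]_x (\1_E x)%:E = \int[mu]_x ((\1_E x)%:E * (k x)%:E).
Proof.
move=> mE; rewrite integral_indic// setIT /= /density integral_mkcond/=.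
apply: eq_integral => x _; rewrite patchE indicE.
by case: ifPn => xE; rewrite ?mul1e ?mul0e.
Qed.

Import HBNNSimple.

Let integral_density_nnsfun (f : {nnsfun T >-> R}) :
  \int[nu]_x (f x)%:E = \int[mu]_x ((f x)%:E * (k x)%:E).
Proof.
under [LHS]eq_integral do rewrite fimfunE -fsumEFin//.
rewrite [LHS]ge0_integral_fsum//; last 2 first.
  - by move=> r; exact/measurable_EFinP/measurableT_comp.
  - by move=> n x _; rewrite EFinM nnfun_muleindic_ge0.
under [RHS]eq_integral.
  move=> x xD; rewrite fimfunE -fsumEFin// muleC ge0_mule_fsumr; last first.
    by move=> r; rewrite EFinM nnfun_muleindic_ge0.
  over.
rewrite [RHS]ge0_integral_fsum//; last 2 first.
  - move=> r; apply: emeasurable_funM => //.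
    by apply/measurable_EFinP; apply/measurableT_comp.
  - move=> n x _; rewrite mule_ge0//; last by rewrite EFinM nnfun_muleindic_ge0.
    by rewrite lee_fin.
apply: eq_fsbigr => r _.
under [RHS]eq_integral do rewrite EFinM muleCA [(k _)%:E * _]muleC.
have [r0|r0] := leP 0%R r; last first.
  rewrite preimage_nnfun0// !integral0_eq// => x _; rewrite indic0 ?EFinM ?mule0//.
  by rewrite mul0e mule0.
rewrite [RHS]ge0_integralZl//; last 2 first.
  - by apply: emeasurable_funM => //; apply/measurable_EFinP.
  - by move=> x _; rewrite mule_ge0 ?lee_fin.
rewrite -integral_density_indic//.
under eq_integral do rewrite EFinM.
rewrite ge0_integralZl//.
by apply/measurable_EFinP.
Qed.

Lemma ge0_integral_density (f : T -> \bar R) :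
  measurable_fun setT f -> (forall x, 0 <= f x) ->
  \int[nu]_x f x = \int[mu]_x (f x * (k x)%:E).
Proof.
move=> mf f0; pose f_ := nnsfun_approx measurableT mf.
transitivity (lim (\int[nu]_x (f_ n x)%:E @[n --> \oo])).
  rewrite -monotone_convergence//=.
  - apply: eq_integral => ? /[!inE] xD; apply/esym/cvg_lim => //=.
    exact: cvg_nnsfun_approx.
  - by move=> n; exact/measurable_EFinP/measurable_funTS.
  - by move=> n ? _; rewrite lee_fin.
  - by move=> ? _ ? ? mn; rewrite lee_fin; exact/lefP/nd_nnsfun_approx.
transitivity (lim (\int[mu]_x ((f_ n x)%:E * (k x)%:E) @[n --> \oo])).
  by apply: congr_lim; apply/funext => n; exact: integral_density_nnsfun.
rewrite -monotone_convergence//=.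
- apply: eq_integral => x _; apply/cvg_lim => //=.
  by apply: cvgeZr => //; apply: cvg_nnsfun_approx.
- by move=> n; apply: emeasurable_funM => //; exact/measurable_EFinP/measurable_funTS.
- by move=> n ? _; rewrite mule_ge0 ?lee_fin.
- move=> x _ m n mn; apply: lee_wpmul2r; first by rewrite lee_fin.
  by rewrite lee_fin; exact/lefP/nd_nnsfun_approx.
Qed.

End density.

(** * Polynomial approximation of step functions *)

Section step_polynomials.
Variable R : realType.
Implicit Types (q t s y a x : R).

Let geometric_tail s n : 0 <= s <= 1 -> n%:R * s ^+ n * (1 - s) <= 1 - s ^+ n.
Proof.
move=> /andP[s0 s1]; elim: n => [|n IH]; first by rewrite !mul0r expr0 subrr.
have sn : 0 <= s ^+ n.+1 <= 1 by rewrite exprn_ge0//= exprn_ile1.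
have := ler_wpM2l s0 IH; rewrite -natr1 exprS in sn *; nra.
Qed.

(** With [t = s^2], [geometric_tail] bounds [n s^n] by [1 / (1 - s)], and a factor [s^n] remains. *)
Let cvg_nat_exp t : 0 <= t < 1 -> n%:R * t ^+ n @[n --> \oo] --> 0.
Proof.
move=> /andP[t0 t1]; pose s := Num.sqrt t.
have s0 : 0 <= s by exact: sqrtr_ge0.
have ts : t = s * s by rewrite -expr2 sqr_sqrtr.
have s1 : s < 1 by rewrite -sqrtr1 ltr_sqrt.
have d0 : 0 < 1 - s by rewrite subr_gt0.
have lim : s ^+ n * (1 - s)^-1 @[n --> \oo] --> 0 * (1 - s)^-1.
  by apply: cvgMl; apply: cvg_expr; rewrite ger0_norm.
rewrite mul0r in lim.
apply: (squeeze_cvgr _ (cvg_cst 0) lim); apply: nearW => n.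
rewrite mulr_ge0 ?exprn_ge0//= ler_pdivlMr// ts exprMn.
have sn : 0 <= s ^+ n by rewrite exprn_ge0.
have := geometric_tail n (introT andP (conj s0 (ltW s1))).
move=> /(ler_wpM2l sn); nra.
Qed.

Let bernoulli y m : 0 <= y <= 1 -> 1 - m%:R * y <= (1 - y) ^+ m.
Proof.
move=> /andP[y0 y1]; elim: m => [|m IH]; first by rewrite mul0r subr0 expr0.
have y1' : 0 <= 1 - y by rewrite subr_ge0.
have := ler_wpM2l y1' IH; rewrite exprS -natr1.
have : 0 <= (m%:R : R) by []; nra.
Qed.

Let bernoulli' y m : 0 <= y <= 1 -> (1 - y) ^+ m * (1 + m%:R * y) <= 1.
Proof.
move=> /andP[y0 y1]; elim: m => [|m IH]; first by rewrite mul0r addr0 expr0 mulr1.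
have y1' : 0 <= 1 - y by rewrite subr_ge0.
apply: le_trans IH; rewrite exprSr -mulrA ler_wpM2l ?exprn_ge0// -natr1.
have : 0 <= (m%:R : R) * y * y by rewrite !mulr_ge0.
have : 0 <= y * y by rewrite mulr_ge0.
nra.
Qed.

(** With [y = q^n] and [m = n 2^n], the product [m y] is [n (2q)^n]. If [q < 1/2] it tends to 0 and
    Bernoulli's inequality bounds the power below by [1 - m y]; otherwise it is at least [n], and
    the power is at most [1 / (1 + m y)]. The factor [n] in the exponent settles the case
    [q = 1/2]. *)
Lemma bump_cvg q : 0 <= q <= 1 ->
  (1 - q ^+ n) ^+ (n * 2 ^ n) @[n --> \oo] --> ((q < 1 / 2)%R%:R : R).
Proof.
move=> /andP[q0 q1].
have qn n : 0 <= q ^+ n <= 1 by rewrite exprn_ge0//= exprn_ile1.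
have [q2|q2] := ltP q (1 / 2).
  have lim : 1 - n%:R * (2 * q) ^+ n @[n --> \oo] --> (1 - 0 : R).
    apply: cvgB; first exact: cvg_cst.
    by apply: cvg_nat_exp; apply/andP; split; lra.
  rewrite subr0 in lim; rewrite (_ : true%:R = 1 :> R)//.
  have lim1 : (cst 1 : nat -> R) @ \oo --> (1 : R) by exact: cvg_cst.
  apply: (squeeze_cvgr _ lim lim1); apply: nearW => n.
  rewrite exprMn mulrA -natrX -natrM bernoulli//=.
  by rewrite exprn_ile1// ?subr_ge0 ?gerBl; case/andP: (qn n).
have lim : @harmonic R @ \oo --> (0 : R) by exact: cvg_harmonic.
rewrite (_ : false%:R = 0 :> R)//.
apply: (squeeze_cvgr _ (cvg_cst 0) lim); apply: nearW => n.
have p0 : 0 <= (1 - q ^+ n) ^+ (n * 2 ^ n).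
  by rewrite exprn_ge0// subr_ge0; case/andP: (qn n).
rewrite p0/= /harmonic/= -[leRHS]mul1r ler_pdivlMr//.
apply: le_trans (bernoulli' (n * 2 ^ n) (qn n)); rewrite ler_wpM2l//.
rewrite -natr1 addrC lerD2l natrM -mulrA ler_peMr// natrX -exprMn.
by rewrite exprn_ege1//; lra.
Qed.

(* Polynomials in [x] which converge to the indicator of [x < a] on [-1, 1]. *)
Definition step a n x : R := (1 - (1 / 2 + (x - a) / (2 * (1 + `|a|))) ^+ n) ^+ (n * 2 ^ n).

(** Since [|x - a| <= 1 + |a|], the affine change of variable maps [[-1, 1]] into [[0, 1]] while
    sending [a] to the threshold 1/2 of [bump_cvg]. *)
Let step_arg a x : `|x| <= 1 -> 0 <= 1 / 2 + (x - a) / (2 * (1 + `|a|)) <= 1.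
Proof.
move=> x1; have d0 : 0 < 2 * (1 + `|a|) by rewrite mulr_gt0// ltr_wpDr.
suff : `|(x - a) / (2 * (1 + `|a|))| <= 1 / 2.
  by rewrite ler_norml => /andP[h1 h2]; apply/andP; split; lra.
rewrite normrM normfV (gtr0_norm d0) ler_pdivrMr//.
by apply: le_trans (ler_normB _ _) _; lra.
Qed.

Lemma step_norm a n x : `|x| <= 1 -> `|step a n x| <= 1.
Proof.
move=> /(step_arg a)/andP[q0 q1]; rewrite /step.
set q := (X in X ^+ n) in q0 q1 *.
have qn : 0 <= q ^+ n <= 1 by rewrite exprn_ge0//= exprn_ile1.
by rewrite ger0_norm ?exprn_ge0 ?exprn_ile1 ?subr_ge0 ?gerBl//; case/andP: qn.
Qed.

Lemma step_cvg a x : `|x| <= 1 -> step a n x @[n --> \oo] --> ((x < a)%R%:R : R).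
Proof.
move=> x1; have d0 : 0 < 2 * (1 + `|a|) by rewrite mulr_gt0// ltr_wpDr.
rewrite -(_ : (1 / 2 + (x - a) / (2 * (1 + `|a|)) < 1 / 2) = (x < a)).
  by apply: bump_cvg; exact: step_arg.
by rewrite gtrDl pmulr_llt0 ?invr_gt0// subr_lt0.
Qed.

End step_polynomials.

(** * Kernels with equal moments agree on quadrants *)

Section moments.
Variable R : realType.
Local Notation C := R[i].
Local Notation Re := (@complex.Re R).
Local Notation Im := (@complex.Im R).
Local Notation lam := (@circle_measure R).
Local Notation T := (circle R).
Implicit Types (q r : T -> C) (xi : T).

(** Traces on the circle of open quadrants. They are stable under intersection and include the whole
    circle (take both bounds equal to 2), as uniqueness of measures requires. *)
Definition halfplanes : set (set T) :=
  [set A | exists a b, A = [set xi | Re (cval xi) < a /\ Im (cval xi) < b]].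

Lemma circle_measurableE : @measurable _ T = <<s halfplanes >>.
Proof.
have /measurable_complexP[mRe mIm] := @measurable_cval R.
apply/seteqP; split=> [A mA|]; last first.
  apply: smallest_sub; first exact: sigma_algebra_measurable.
  move=> _ [a [b ->]].
  rewrite (_ : [set _ | _] = (fun xi : T => Re (cval xi)) @^-1` `]-oo, a[ `&`
                             (fun xi : T => Im (cval xi)) @^-1` `]-oo, b[).
    apply: measurableI; rewrite -[X in measurable X]setTI; [exact: mRe|exact: mIm].
  by apply/seteqP; split=> xi /=; rewrite !in_itv.
pose T' := g_sigma_algebraType halfplanes.
have n1 (xi : T) : Re (cval xi) < 2 /\ Im (cval xi) < 2.
  have hr := Re_le (cval xi); have hi := Im_le (cval xi).
  rewrite normc_circle in hr hi.
  by split; (apply: le_lt_trans (ler_norm _) _); [apply: le_lt_trans hr _|apply: le_lt_trans hi _]; rewrite ltr1n.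
have mR' : measurable_fun setT ((fun xi : T => Re (cval xi)) : T' -> R).
  apply: (measurability _ (RGenInftyO.measurableE R)) => _ [_ [a ->] <-].
  (* The bound 2 on the other coordinate is no restriction on the circle. *)
  rewrite setTI; apply: sub_sigma_algebra; exists a, 2.
  apply/seteqP; split=> xi /=; rewrite in_itv/=; last by case.
  by split=> //; have [] := n1 xi.
have mI' : measurable_fun setT ((fun xi : T => Im (cval xi)) : T' -> R).
  apply: (measurability _ (RGenInftyO.measurableE R)) => _ [_ [a ->] <-].
  rewrite setTI; apply: sub_sigma_algebra; exists 2, a.
  apply/seteqP; split=> xi /=; rewrite in_itv/=; last by case.
  by split=> //; have [] := n1 xi.
have mv : measurable_fun setT ((fun xi : T => cval xi) : T' -> C).
  exact/measurable_complexP.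
case: mA => B mB <-; rewrite setTI.
by have := mv measurableT B mB; rewrite setTI.
Qed.

Variables (g : T -> T) (k1 k2 : T -> R).
Hypotheses (mg : measurable_fun setT g) (bk1 : bmr k1) (bk2 : bmr k2).
Hypothesis moments : forall n,
  cint lam (fun xi => cval (g xi) ^+ n * (k1 xi)%:C) =
  cint lam (fun xi => cval xi ^+ n * (k2 xi)%:C).

Let bmc_g q : bmc q -> bmc (fun xi => q (g xi)).
Proof.
move=> [mq [M qM]]; split; first exact: (measurableT_comp mq mg).
by exists M => xi.
Qed.

Let bmr_g (u : T -> R) : bmr u -> bmr (fun xi => u (g xi)).
Proof.
move=> [mq [M qM]]; split; first exact: (measurableT_comp mq mg).
by exists M => xi.
Qed.

Let bk1c : bmc (fun xi => (k1 xi)%:C). Proof. exact: bmc_real. Qed.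
Let bk2c : bmc (fun xi => (k2 xi)%:C). Proof. exact: bmc_real. Qed.

Let same q := cint lam (fun xi => q (g xi) * (k1 xi)%:C) =
  cint lam (fun xi => q xi * (k2 xi)%:C).

Let sameD q r : bmc q -> bmc r -> same q -> same r -> same (fun xi => q xi + r xi).
Proof.
move=> bq br sq sr; rewrite /same; under eq_fun do rewrite mulrDl.
under [in RHS]eq_fun do rewrite mulrDl.
rewrite !cintD; [by rewrite sq sr|exact: bmcM|exact: bmcM|..].
  by apply: bmcM => //; exact: bmc_g.
by apply: bmcM => //; exact: bmc_g.
Qed.

Let sameZ c q : bmc q -> same q -> same (fun xi => c * q xi).
Proof.
move=> bq sq; rewrite /same; under eq_fun do rewrite -mulrA.
under [in RHS]eq_fun do rewrite -mulrA.
rewrite !cintZ; [by rewrite sq|exact: bmcM|..].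
by apply: bmcM => //; exact: bmc_g.
Qed.

Let bval : bmc (fun xi : T => cval xi).
Proof. by apply: (@bmc_circle _ id) => w _; exact: cont_id. Qed.

(** [same] is not stable under products. [good] asks for it against all powers of [xi] and of its
    conjugate, and [mult] collects the functions that preserve [good]: they form an algebra
    containing both coordinates, hence all polynomials in them. *)
Let good r := bmc r /\ forall n, same (fun xi => r xi * cval xi ^+ n) /\
  same (fun xi => r xi * (cval xi)^* ^+ n).

Let mult q := bmc q /\ forall r, good r -> good (fun xi => q xi * r xi).

Let bvX n : bmc (fun xi : T => cval xi ^+ n). Proof. exact: bmcX. Qed.
Let bvcX n : bmc (fun xi : T => (cval xi)^* ^+ n).
Proof. by apply: bmcX; exact: bmc_conj. Qed.

(** The powers of the conjugate are obtained by conjugating [moments], the kernels being real. *)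
Let good1 : good (fun _ => 1).
Proof.
split; first exact: bmc_cst.
move=> n; split.
  by rewrite /same; under eq_fun do rewrite mul1r; under [in RHS]eq_fun do rewrite mul1r.
have cE (w : C) (x : R) : 1 * w^* ^+ n * x%:C = (w ^+ n * x%:C)^*.
  by rewrite mul1r rmorphM rmorphXn; congr (_ * _); exact/esym/conjc_real.
rewrite /same; under eq_fun do rewrite cE.
under [in RHS]eq_fun do rewrite cE.
rewrite !cint_conj ?moments//; first exact: bmcM.
by apply: (bmcM _ bk1c); exact: (bmc_g (bvX n)).
Qed.

Let val_conj xi : cval xi * (cval xi)^* = 1.
Proof. by rewrite mulcJ normc_circle expr1n. Qed.

Let mult_val : mult (fun xi => cval xi).
Proof.
split=> // r [br sr]; split; first exact: bmcM.
move=> n; split.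
  rewrite (_ : (fun _ => _) = (fun xi => r xi * cval xi ^+ n.+1)); first by have [] := sr n.+1.
  by apply/funext => xi; rewrite exprS; ring.
case: n => [|n].
  rewrite (_ : (fun _ => _) = (fun xi => r xi * cval xi ^+ 1)); first by have [] := sr 1%N.
  by apply/funext => xi; rewrite expr0 expr1 mulr1 mulrC.
rewrite (_ : (fun _ => _) = (fun xi => r xi * (cval xi)^* ^+ n)); first by have [] := sr n.
by apply/funext => xi; rewrite exprS mulrACA mulrA val_conj mul1r.
Qed.

Let mult_conj : mult (fun xi => (cval xi)^*).
Proof.
split=> [|r [br sr]]; first exact: bmc_conj.
split; first by apply: bmcM => //; exact: bmc_conj.
move=> n; split; last first.
  rewrite (_ : (fun _ => _) = (fun xi => r xi * (cval xi)^* ^+ n.+1)); first by have [] := sr n.+1.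
  by apply/funext => xi; rewrite exprS; ring.
case: n => [|n].
  rewrite (_ : (fun _ => _) = (fun xi => r xi * (cval xi)^* ^+ 1)); first by have [] := sr 1%N.
  by apply/funext => xi; rewrite expr0 expr1 mulr1 mulrC.
rewrite (_ : (fun _ => _) = (fun xi => r xi * cval xi ^+ n)); first by have [] := sr n.
apply/funext => xi; rewrite exprS mulrACA mulrA [_^* * _]mulrC val_conj mul1r//.
Qed.

Let goodD q r : good q -> good r -> good (fun xi => q xi + r xi).
Proof.
move=> [bq sq] [br sr]; split; first exact: bmcD.
move=> n; have [q1 q2] := sq n; have [r1 r2] := sr n; split.
  under eq_fun do rewrite mulrDl.
  exact: (sameD (bmcM bq (bvX n)) (bmcM br (bvX n)) q1 r1).
under eq_fun do rewrite mulrDl.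
exact: (sameD (bmcM bq (bvcX n)) (bmcM br (bvcX n)) q2 r2).
Qed.

Let goodZ c q : good q -> good (fun xi => c * q xi).
Proof.
move=> [bq sq]; split; first exact: bmcZ.
move=> n; have [q1 q2] := sq n; split.
  by under eq_fun do rewrite -mulrA; exact: (@sameZ c _ (bmcM bq (bvX n)) q1).
by under eq_fun do rewrite -mulrA; exact: (@sameZ c _ (bmcM bq (bvcX n)) q2).
Qed.

Let multD p q : mult p -> mult q -> mult (fun xi => p xi + q xi).
Proof.
move=> [bp mp] [bq mq]; split; first exact: bmcD.
by move=> r gr; under eq_fun do rewrite mulrDl; apply: goodD; [exact: mp|exact: mq].
Qed.

Let multM p q : mult p -> mult q -> mult (fun xi => p xi * q xi).
Proof.
move=> [bp mp] [bq mq]; split; first exact: bmcM.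
by move=> r gr; under eq_fun do rewrite -mulrA; exact/mp/mq.
Qed.

Let mult_cst c : mult (fun _ => c).
Proof. by split=> [|r]; [exact: bmc_cst|exact: goodZ]. Qed.

Let multX p n : mult p -> mult (fun xi => p xi ^+ n).
Proof.
move=> mp; elim: n => [|n IH].
  by under eq_fun do rewrite expr0; exact: mult_cst.
by under eq_fun do rewrite exprS; exact: multM.
Qed.

Let mult_real_affine (u : T -> R) (c e : R) : mult (fun xi => (u xi)%:C) ->
  mult (fun xi => (c + e * u xi)%:C).
Proof.
move=> mu; under eq_fun do rewrite rmorphD rmorphM.
by apply: multD; [exact: mult_cst|apply: multM => //; exact: mult_cst].
Qed.

Let mult_Re : mult (fun xi => (Re (cval xi))%:C).
Proof.
rewrite (_ : (fun _ => _) = (fun xi => 2^-1 * (cval xi + (cval xi)^*))).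
  by apply: multM; [exact: mult_cst|exact: multD].
by apply/funext => xi; case: (cval xi) => x y; apply: complex_ext; rewrite ?cReM ?cImM/=; field.
Qed.

Let mult_Im : mult (fun xi => (Im (cval xi))%:C).
Proof.
rewrite (_ : (fun _ => _) = (fun xi => (- 'i / 2) * (cval xi + (- 1) * (cval xi)^*))).
  apply: multM; first exact: mult_cst.
  by apply: multD => //; apply: multM => //; exact: mult_cst.
by apply/funext => xi; case: (cval xi) => x y; apply: complex_ext; rewrite ?cReM ?cImM/=; field.
Qed.

Let mult_step a n (u : T -> R) : mult (fun xi => (u xi)%:C) ->
  mult (fun xi => (step a n (u xi))%:C).
Proof.
move=> mu; rewrite /step; under eq_fun do rewrite rmorphXn.
apply: multX.
under eq_fun do rewrite rmorphB rmorphXn rmorph1 -mulN1r.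
apply: multD; first exact: mult_cst.
apply: multM; first exact: mult_cst.
apply: multX.
pose e := (2 * (1 + `|a|))^-1.
rewrite (_ : (fun _ => _) = (fun xi => (1 / 2 - a * e + e * u xi)%:C)).
  exact: mult_real_affine.
by apply/funext => xi; congr (_%:C); rewrite -/e; ring.
Qed.

Let mult_same q : mult q -> same q.
Proof.
move=> [bq mq]; have [_ /(_ 0%N)[+ _]] := mq _ good1.
rewrite /same; under eq_fun do rewrite expr0 !mulr1.
by under [in RHS]eq_fun do rewrite expr0 !mulr1.
Qed.

Definition quadrant (a b : R) xi : R := ((Re (cval xi) < a) && (Im (cval xi) < b))%:R.

(** The indicator of a quadrant is the pointwise limit of products of step polynomials in the two
    coordinates. These are multipliers bounded by 1, so the equality passes to the limit by
    domination. *)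
Lemma same_halfplanes a b :
  \int[lam]_xi (quadrant a b (g xi) * k1 xi) =
  \int[lam]_xi (quadrant a b xi * k2 xi).
Proof.
have Re1 xi : `|Re (cval xi)| <= 1 by have := Re_le (cval xi); rewrite normc_circle.
have Im1 xi : `|Im (cval xi)| <= 1 by have := Im_le (cval xi); rewrite normc_circle.
pose s n xi := step a n (Re (cval xi)) * step b n (Im (cval xi)).
have ms n : mult (fun xi => (s n xi)%:C).
  by under eq_fun do rewrite /s rmorphM; apply: multM; exact: mult_step.
have bs n : bmr (s n) by have [/bmcP[]] := ms n.
have s1 n xi : `|s n xi| <= 1.
  by rewrite /s normrM mulr_ile1 ?step_norm.
have slim xi : s n xi @[n --> \oo] --> quadrant a b xi.
  rewrite /quadrant -mulnb natrM; apply: cvgM; exact: step_cvg.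
have E n : \int[lam]_xi (s n (g xi) * k1 xi) = \int[lam]_xi (s n xi * k2 xi).
  have := mult_same (ms n); rewrite /same; under eq_fun do rewrite -rmorphM.
  under [in RHS]eq_fun do rewrite -rmorphM.
  by rewrite !cint_real => /complexI.
have mind : measurable_fun setT (quadrant a b).
  apply: (measurable_fun_cvg (h := s)); first by move=> m; have [] := bs m.
  by move=> xi _; exact: slim.
have [mk1 [M1 k1M]] := bk1; have [mk2 [M2 k2M]] := bk2.
have l1 : \int[lam]_xi (s n (g xi) * k1 xi) @[n --> \oo] -->
    \int[lam]_xi (quadrant a b (g xi) * k1 xi).
  apply: (@Rint_cvg _ _ _ _ _ _ M1).
  - by move=> n; have [] := bmrM (bmr_g (bs n)) bk1.
  - by apply: measurable_funM => //; exact: (measurableT_comp mind mg).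
  - by move=> n xi; rewrite normrM -[leRHS]mul1r ler_pM.
  - apply/nearW => xi; apply: cvgM; [exact: slim|exact: cvg_cst].
have l2 : \int[lam]_xi (s n xi * k2 xi) @[n --> \oo] -->
    \int[lam]_xi (quadrant a b xi * k2 xi).
  apply: (@Rint_cvg _ _ _ _ _ _ M2).
  - by move=> n; have [] := bmrM (bs n) bk2.
  - exact: measurable_funM.
  - by move=> n xi; rewrite normrM -[leRHS]mul1r ler_pM.
  - apply/nearW => xi; apply: cvgM; [exact: slim|exact: cvg_cst].
rewrite (_ : (fun n => _) = (fun n => \int[lam]_xi (s n xi * k2 xi))) in l1; last exact/funext.
exact: cvg_unique l1 l2.
Qed.

End moments.

(** * Change of variables deduced from the moments *)

Section moment_integrals.
Variable R : realType.
Local Notation C := R[i].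
Local Notation Re := (@complex.Re R).
Local Notation Im := (@complex.Im R).
Local Notation lam := (@circle_measure R).
Local Notation T := (circle R).
Implicit Types (xi : T).

Section general_kernels.
Variables (g : T -> T) (k1 k2 : T -> R).
Hypotheses (mg : measurable_fun setT g) (bk1 : bmr k1) (bk2 : bmr k2).
Hypotheses (k10 : forall xi, 0 <= k1 xi) (k20 : forall xi, 0 <= k2 xi).
Hypothesis moments : forall n,
  cint lam (fun xi => cval (g xi) ^+ n * (k1 xi)%:C) =
  cint lam (fun xi => cval xi ^+ n * (k2 xi)%:C).

Let mk1 : measurable_fun setT k1. Proof. by case: bk1. Qed.
Let mk2 : measurable_fun setT k2. Proof. by case: bk2. Qed.
Let mg_mixin := isMeasurableFun.Build _ _ _ _ _ mg.
Let g_pack : {mfun T >-> T} := HB.pack g mg_mixin.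

Let m1 := pushforward (density lam mk1 k10) g_pack.
Let m2 := density lam mk2 k20.

Let densityE (k : T -> R) (mk : measurable_fun setT k) (k0 : forall xi, 0 <= k xi) A :
  bmr k -> measurable A -> density lam mk k0 A = (\int[lam]_x (\1_A x * k x))%:E.
Proof.
move=> bk mA; rewrite /density integral_mkcond /Rintegral.
have bI : bmr (fun x => \1_A x * k x).
  apply: bmrM bk; split; first exact: measurable_indic.
  by exists 1 => x; rewrite indicE; case: (_ \in _); rewrite ?normr0 ?normr1.
rewrite fineK; last exact/integrable_fin_num/bmr_integrable.
apply: eq_integral => x _; rewrite patchE indicE.
by case: ifPn; rewrite ?mul1r ?mul0r.
Qed.

Let m12 A : measurable A -> m1 A = m2 A.
Proof.
move=> mA.
have mhp (A' : set T) : halfplanes A' -> measurable A'.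
  by move=> hA; rewrite circle_measurableE; exact: sub_sigma_algebra.
apply: (measure_unique (@halfplanes R) (fun=> setT)) => //.
- exact: circle_measurableE.
- move=> _ _ [a [b ->]] [a' [b' ->]]; exists (Num.min a a'), (Num.min b b').
  apply/seteqP; split=> xi /=; rewrite !lt_min.
    by move=> [[-> ->] [-> ->]].
  by move=> [/andP[-> ->] /andP[-> ->]].
- move=> _; exists 2, 2; apply/seteqP; split=> xi //= _.
  have hr := Re_le (cval xi); have hi := Im_le (cval xi).
  rewrite normc_circle in hr hi.
  by split; (apply: le_lt_trans (ler_norm _) _);
    [apply: le_lt_trans hr _|apply: le_lt_trans hi _]; rewrite ltr1n.
- by rewrite bigcup_const//; exists 0%N.
- move=> A' hA'; have mA' := mhp _ hA'; case: hA' => a [b A'E].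
  have IE xi : \1_A' xi = quadrant a b xi :> R.
    rewrite A'E indicE /quadrant; congr (_%:R); congr nat_of_bool.
    by apply/idP/idP => [/set_mem[-> ->]|/andP[h1 h2]]//; apply/mem_set.
  have mgA : measurable (g @^-1` A') by rewrite -[X in measurable X]setTI; exact: mg.
  transitivity ((\int[lam]_x (\1_(g @^-1` A') x * k1 x))%:E).
    exact: (densityE _ _ bk1 mgA).
  transitivity ((\int[lam]_x (\1_A' x * k2 x))%:E); last first.
    exact/esym/(densityE _ _ bk2 mA').
  congr EFin; have := same_halfplanes mg bk1 bk2 moments a b.
  under eq_Rintegral do rewrite -IE; under [in RHS]eq_Rintegral do rewrite -IE.
  by move=> <-.
- move=> _; apply: (@le_lt_trans _ _ (density lam mk1 k10 setT)) => //.
  by rewrite densityE// ltry.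
Qed.

Lemma moment_integral (phi : T -> \bar R) : measurable_fun setT phi ->
  (forall xi, 0 <= phi xi)%E ->
  (\int[lam]_xi (phi (g xi) * (k1 xi)%:E) = \int[lam]_xi (phi xi * (k2 xi)%:E))%E.
Proof.
move=> mphi phi0.
transitivity (\int[m1]_x phi x)%E.
  transitivity (\int[density lam mk1 k10]_x (phi \o g) x)%E.
    rewrite ge0_integral_density; first reflexivity.
      exact: (measurableT_comp mphi mg).
    by move=> x; exact: phi0.
  by rewrite /m1 [RHS]ge0_integral_pushforward.
rewrite (eq_measure_integral m2); last by move=> A mA _; exact: m12.
by rewrite /m2 ge0_integral_density.
Qed.

(** No integrability of [u] is asked: the positive and negative parts are transported separately,
    and nonnegative kernels commute with [Num.max _ 0]. *)
Lemma moment_integral_real (u : T -> R) : measurable_fun setT u ->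
  (\int[lam]_xi (u (g xi) * k1 xi)%:E = \int[lam]_xi (u xi * k2 xi)%:E)%E.
Proof.
move=> mu.
have max_mul (a b : R) : 0 <= b -> Num.max (a * b) 0 = Num.max a 0 * b.
  by move=> b0; rewrite -{1}(mul0r b) maxr_pMl.
have key (v : T -> R) : measurable_fun setT v ->
    (\int[lam]_xi (Num.max (v (g xi) * k1 xi) 0)%:E =
     \int[lam]_xi (Num.max (v xi * k2 xi) 0)%:E)%E.
  move=> mv; have mm : measurable_fun setT (fun xi => (Num.max (v xi) 0)%:E).
    by apply/measurable_EFinP; apply: measurable_maxr.
  have /(_ _) := moment_integral mm.
  under eq_integral do rewrite -EFinM -max_mul//.
  under [in RHS]eq_integral do rewrite -EFinM -max_mul//.
  by apply => xi; rewrite lee_fin le_max lexx orbT.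
have mu' : measurable_fun setT (fun xi => - u xi) by exact: measurableT_comp.
rewrite integralE [RHS]integralE; congr (_ - _)%E.
  transitivity (\int[lam]_xi (Num.max (u (g xi) * k1 xi) 0)%:E)%E.
    by apply: eq_integral => xi _; rewrite funeposE -EFin_max.
  by rewrite key//; apply: eq_integral => xi _; rewrite funeposE -EFin_max.
transitivity (\int[lam]_xi (Num.max (- u (g xi) * k1 xi) 0)%:E)%E.
  by apply: eq_integral => xi _; rewrite funenegE -EFinN -EFin_max mulNr.
by rewrite (key _ mu'); apply: eq_integral => xi _; rewrite funenegE -EFinN -EFin_max mulNr.
Qed.

End general_kernels.

Section bvals_integrals.
Variables (f : C -> C) (g : T -> T).
Hypothesis fg : bvals f g.

Let idb (z : C) : normc z < 1 -> forall n, cint lam (fun xi => cval xi ^+ n * (pk z xi)%:C) = z ^+ n.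
Proof.
move=> z1 n; apply: (@poisson_formula _ (fun w => w ^+ n) 2 z); rewrite ?ltr1n//.
by move=> w _; eexists; apply: cdiffX; exact: cdiff_id.
Qed.

Let moments z : normc z < 1 -> forall n,
  cint lam (fun xi => cval (g xi) ^+ n * (pk z xi)%:C) =
  cint lam (fun xi => cval xi ^+ n * (pk (f z) xi)%:C).
Proof.
move=> z1 n; rewrite (bvals_moment n fg z1) idb//.
by case: fg => _ + _ _; exact.
Qed.

Let mg : measurable_fun setT g. Proof. by case: fg. Qed.

Let fz1 z : normc z < 1 -> normc (f z) < 1. Proof. by case: fg => _ + _ _; exact. Qed.

Lemma bvals_integral z (phi : T -> \bar R) : normc z < 1 ->
  measurable_fun setT phi -> (forall xi, 0 <= phi xi)%E ->
  (\int[lam]_xi (phi (g xi) * (pk z xi)%:E) =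
   \int[lam]_xi (phi xi * (pk (f z) xi)%:E))%E.
Proof.
move=> z1; apply: moment_integral => //.
- exact: bmr_pk.
- exact/bmr_pk/fz1.
- by move=> xi; exact: pk_ge0.
- by move=> xi; exact/pk_ge0/fz1.
- exact: moments.
Qed.

Lemma bvals_integral_real z (u : T -> R) : normc z < 1 -> measurable_fun setT u ->
  (\int[lam]_xi (u (g xi) * pk z xi)%:E = \int[lam]_xi (u xi * pk (f z) xi)%:E)%E.
Proof.
move=> z1; apply: moment_integral_real => //.
- exact: bmr_pk.
- exact/bmr_pk/fz1.
- by move=> xi; exact: pk_ge0.
- by move=> xi; exact/pk_ge0/fz1.
- exact: moments.
Qed.

Lemma pk0 xi : pk 0 xi = 1.
Proof. by rewrite /pk normc0 subr0 normc_circle !expr1n expr0n/= subr0 divr1. Qed.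

(* [g] is nonsingular: its image of [lam] has the density [pk (f 0)]. *)
Lemma bvals_nonsingular (P : T -> Prop) :
  {ae lam, forall xi, P xi} -> {ae lam, forall xi, P (g xi)}.
Proof.
move=> [N [mN N0 subN]].
have mgN : measurable (g @^-1` N) by rewrite -[X in measurable X]setTI; exact: mg.
exists (g @^-1` N); split=> //; last by move=> xi /=; exact: subN.
have z1 : normc (0 : C) < 1 by rewrite normc0.
have := @bvals_integral 0 (EFin \o \1_N) z1 _ _.
rewrite (eq_integral (fun xi => (\1_(g @^-1` N) xi)%:E)); last first.
  by move=> xi _; rewrite pk0 mule1.
rewrite integral_indic// setIT => ->.
- rewrite (ae_eq_integral (fun=> 0%E)) ?integral0//.
  + apply: emeasurable_funM; first exact/measurable_EFinP/measurable_indic.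
    by apply/measurable_EFinP; have [] := bmr_pk (fz1 z1).
  + exists N; split=> // xi /=; apply: contra_notP => xiN _.
    by rewrite indicE memNset// mul0e.
- exact/measurable_EFinP/measurable_indic.
- by move=> xi; rewrite lee_fin indicE.
Qed.

End bvals_integrals.
End moment_integrals.

(** * Moebius maps and composition operators *)

Section L2_toolkit.
Variable R : realType.
Local Notation C := R[i].
Local Notation Re := (@complex.Re R).
Local Notation Im := (@complex.Im R).
Local Notation lam := (@circle_measure R).
Local Notation T := (circle R).
Local Notation L2c := (L2 lam).
Implicit Types (xi : T) (phi psi chi : L2c).

Definition nrm phi : R := fine (L2norm lam phi).

Lemma nrm_ge0 phi : 0 <= nrm phi.
Proof. by rewrite fine_ge0// Lnorm_ge0. Qed.

Lemma normrL2 phi : `|phi| = (nrm phi)%:C.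
Proof. by []. Qed.

Let L2norm_sqrE (u : T -> C) :
  (L2norm lam u `^ 2 = \int[lam]_xi (normc (u xi) ^+ 2)%:E)%E.
Proof.
rewrite /L2norm poweR_Lnorm ?pnatr_eq0//; apply: eq_integral => xi _ /=.
by rewrite normc_norm powR_mulrn ?normc_ge0.
Qed.

Lemma nrm_sqr phi : ((nrm phi ^+ 2)%:E = \int[lam]_xi (normc (phi xi) ^+ 2)%:E)%E.
Proof.
rewrite -L2norm_sqrE -(fine_normL2 phi) poweR_EFin -powR_mulrn// nrm_ge0//.
Qed.

Lemma mkL2 (u : T -> C) : measurable_fun setT u ->
  (\int[lam]_xi (normc (u xi) ^+ 2)%:E < +oo)%E ->
  exists psi : L2c, {ae lam, forall xi, psi xi = u xi}.
Proof.
move=> mu ulty.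
have su : u \in sqint lam.
  rewrite inE; split=> //.
  have := L2norm_sqrE u; have : (0 <= L2norm lam u)%E by exact: Lnorm_ge0.
  case: (L2norm lam u) => [r|_|]//; first by rewrite ltry.
  by rewrite poweRyr ?pnatr_eq0// => E; rewrite -E ltxx in ulty.
exists (\pi_(L2c)%qT (Sqintfun su)); exact: L2_reprE.
Qed.

Lemma L2_subE phi psi : {ae lam, forall xi, (phi - psi : L2c) xi = phi xi - psi xi}.
Proof.
apply: filterS2 (L2_addE phi (- psi)) (scaleL2E (-1) psi) => xi -> E.
by rewrite -scaleN1r E mulN1r.
Qed.

Lemma nrm_subE phi psi (u v : T -> C) :
  measurable_fun setT u -> measurable_fun setT v ->
  {ae lam, forall xi, phi xi = u xi} -> {ae lam, forall xi, psi xi = v xi} ->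
  ((nrm (phi - psi) ^+ 2)%:E = \int[lam]_xi (normc (u xi - v xi) ^+ 2)%:E)%E.
Proof.
move=> mu mv pu pv; rewrite nrm_sqr; apply: ae_eq_integral => //.
- apply/measurable_EFinP; apply: measurable_funX.
  by apply: measurable_normc; exact: L2_measurable.
- apply/measurable_EFinP; apply: measurable_funX; apply: measurable_normc.
  rewrite (_ : (fun _ => _) = (u + (-1) *: v)); last first.
    by apply/funext => xi; rewrite !fctE scaleN1r.
  by apply: measurable_funDc => //; exact: measurable_funZc.
- apply: filterS3 (L2_subE phi psi) pu pv => xi E1 E2 E3 _.
  by rewrite E1 E2 E3.
Qed.

Lemma nrmD phi psi : nrm (phi + psi) <= nrm phi + nrm psi.
Proof.
have := ler_normD phi psi; rewrite !normrL2 -(rmorphD (real_complex R)).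
by rewrite lecR.
Qed.

Lemma nrmB phi psi : nrm (phi - psi) = nrm (psi - phi).
Proof. by have := normrN (phi - psi); rewrite opprB !normrL2 => /complexI. Qed.

Lemma open_nrm (U : set L2c) phi : open U -> U phi ->
  exists2 e : R, 0 < e & forall psi, nrm (psi - phi) < e -> U psi.
Proof.
move=> oU Uphi; have : nbhs phi U by exact: open_nbhs_nbhs.
move=> /nbhs_ballP[[e e'] /=]; rewrite ltcE/= => /andP[/eqP -> e0] h.
exists e => // psi ne; apply: h; rewrite -ball_normE/= normrL2.
by rewrite (ltcR _ e) nrmB.
Qed.

Lemma nrm_nbhs phi (e : R) : 0 < e -> exists U : set L2c,
  [/\ open U, U phi & forall psi, U psi -> nrm (psi - phi) < e].
Proof.
move=> e0; exists (ball phi e%:C)^°; split.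
- exact: open_interior.
- by apply: nbhsx_ballx; rewrite ltcR.
- move=> psi /nbhs_singleton; rewrite -ball_normE/= normrL2 ltcR.
  by rewrite nrmB.
Qed.

Lemma transitive_nrm (A : L2c -> L2c) : topologically_transitive A ->
  forall phi psi (e : R), 0 < e -> exists k chi,
    nrm (chi - phi) < e /\ nrm (iter k A chi - psi) < e.
Proof.
move=> tA phi psi e e0.
have [U [oU Uphi hU]] := nrm_nbhs phi e0.
have [V [oV Vpsi hV]] := nrm_nbhs psi e0.
have [k [_ [[chi Uchi <-] Vchi]]] := tA U V oU oV (ex_intro _ _ Uphi) (ex_intro _ _ Vpsi).
by exists k, chi; split; [exact: hU|exact: hV].
Qed.

Lemma mixing_nrm (A : L2c -> L2c) :
  (forall phi psi (e : R), 0 < e -> exists k0, forall k, (k0 <= k)%N ->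
    exists chi, nrm (chi - phi) < e /\ nrm (iter k A chi - psi) < e) ->
  topologically_mixing A.
Proof.
move=> mA U V oU oV [phi Uphi] [psi Vpsi].
have [e1 e10 h1] := open_nrm oU Uphi; have [e2 e20 h2] := open_nrm oV Vpsi.
have [|k0 hk] := mA phi psi (Num.min e1 e2); first by rewrite lt_min e10.
exists k0 => k /hk[chi]; rewrite !lt_min => -[/andP[c1 _] /andP[_ c2]].
exists (iter k A chi); split; last exact: h2.
by exists chi => //; exact: h1.
Qed.

(** Instead of the Cauchy-Schwarz inequality, integrate [t <= t^2 / (2 e) + e / 2] with
    [t = |phi|]. *)
Lemma Rint_normc_lt phi (e : R) : 0 < e -> nrm phi < e ->
  (\int[lam]_xi (normc (phi xi))%:E <= e%:E)%E.
Proof.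
move=> e0 pe; have mphi := measurable_normc (L2_measurable phi).
have m2 : measurable_fun setT (fun xi => (normc (phi xi) ^+ 2)%:E).
  exact/measurable_EFinP/measurable_funX.
apply: (@le_trans _ _ (\int[lam]_xi ((2 * e)^-1 * normc (phi xi) ^+ 2 + e / 2)%:E)%E).
  apply: ge0_le_integral => //.
  - by move=> xi _; rewrite lee_fin normc_ge0.
  - exact/measurable_EFinP.
  - apply/measurable_EFinP; apply: measurable_funD => //.
    by apply: measurable_funM => //; exact/measurable_EFinP.
  - move=> xi _; rewrite lee_fin -subr_ge0.
    have -> : (2 * e)^-1 * normc (phi xi) ^+ 2 + e / 2 - normc (phi xi) =
      (2 * e)^-1 * (normc (phi xi) - e) ^+ 2 by field; exact: lt0r_neq0.
    by rewrite mulr_ge0 ?sqr_ge0// invr_ge0 mulr_ge0// ltW.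
under eq_integral do rewrite EFinD EFinM.
have c0 : 0 <= (2 * e)^-1 by rewrite invr_ge0 mulr_ge0// ltW.
have e20 : 0 <= e / 2 by rewrite divr_ge0// ltW.
rewrite ge0_integralD//; last 2 first.
- by move=> xi _; rewrite mule_ge0 ?lee_fin// sqr_ge0.
- by apply: emeasurable_funM.
rewrite ge0_integralZl//; last by move=> xi _; rewrite lee_fin sqr_ge0.
rewrite -nrm_sqr integral_cst// [X in (_ + _ * X)%E](_ : _ = 1%E); last exact: probability_setT.
rewrite mule1 -EFinM -EFinD lee_fin.
have : nrm phi ^+ 2 <= e ^+ 2 by rewrite lerXn2r ?nnegrE ?nrm_ge0// ltW.
move=> /(ler_wpM2l c0) h.
have E : (2 * e)^-1 * e ^+ 2 + e / 2 = e by field; exact: lt0r_neq0.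
by rewrite -[leRHS]E lerD2r.
Qed.

End L2_toolkit.

(** * Moebius maps of the disc and of the circle *)

Section moebius.
Variable R : realType.
Local Notation C := R[i].
Local Notation Re := (@complex.Re R).
Local Notation Im := (@complex.Im R).
Local Notation T := (circle R).
Implicit Types (al be z w : C) (xi : T).

Definition mob al be z := (al * z + be) / (be^* * z + al^*).
(** Determinant 1 for the matrix with rows [(al, be)] and [(conj be, conj al)], of which [mob] is
    the projective action. *)
Definition su al be := al * al^* - be * be^* = 1.

Lemma su_inv al be : su al be -> su al^* (- be).
Proof. by rewrite /su rmorphN/= conjCK mulrNN mulrC. Qed.

Lemma su_mul al be al' be' : su al be -> su al' be' ->
  su (al * al' + be * be'^*) (al * be' + be * al'^*).
Proof.
rewrite /su !(rmorphD, rmorphM)/= !conjCK => s s'.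
rewrite -[1]mulr1 -{1}s -s'; ring.
Qed.

Lemma su_norm al be : su al be -> normc al ^+ 2 = 1 + normc be ^+ 2.
Proof.
rewrite /su !mulcJ -(rmorphB (real_complex R)) -(rmorph1 (real_complex R)).
by move=> /complexI s; rewrite -s subrK.
Qed.

Let su_lt al be : su al be -> normc be < normc al.
Proof.
move=> /su_norm s; rewrite -(@ltr_pXn2r _ 2) ?nnegrE ?normc_ge0//.
by rewrite s ltrDr.
Qed.

Lemma mob_den al be z : su al be -> normc z <= 1 -> be^* * z + al^* != 0.
Proof.
move=> s z1; rewrite addrC -(opprK (be^* * z)) subr_eq0.
apply/eqP => /(congr1 (@normc R)); rewrite normcN normcM !normc_conj => e.
have := su_lt s; rewrite e ltNge => /negP; apply.
by rewrite ler_piMr ?normc_ge0.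
Qed.

(** The matrix preserves the Hermitian form [|p|^2 - |q|^2], evaluated here at [(z, 1)]. *)
Let mob_num al be z : su al be ->
  normc (al * z + be) ^+ 2 = normc (be^* * z + al^*) ^+ 2 - (1 - normc z ^+ 2).
Proof.
move=> s; have : (al * z + be) * (al * z + be)^* =
    (be^* * z + al^*) * (be^* * z + al^*)^* - (1 - z * z^*).
  rewrite -{1}s !(rmorphD, rmorphM)/= !conjCK.
  have -> : z * z^* = z * z^* * (al * al^* - be * be^*) by rewrite s mulr1.
  ring.
rewrite !mulcJ -(rmorph1 (real_complex R)) -!(rmorphB (real_complex R)).
exact: complexI.
Qed.

Lemma mob_disc al be z : su al be -> normc z < 1 -> normc (mob al be z) < 1.
Proof.
move=> s z1; have d0 := mob_den s (ltW z1).
rewrite /mob normcM normcV ltr_pdivrMr ?normc_gt0// mul1r.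
rewrite -(@ltr_pXn2r _ 2) ?nnegrE ?normc_ge0// mob_num//.
by rewrite ltrBlDr ltrDl subr_gt0 expr_lt1 ?normc_ge0.
Qed.

Lemma mob_circle al be z : su al be -> normc z = 1 -> normc (mob al be z) = 1.
Proof.
move=> s z1; have z1' : normc z <= 1 by rewrite z1.
have d0 := mob_den s z1'.
rewrite /mob normcM normcV.
have -> : normc (al * z + be) = normc (be^* * z + al^*).
  apply/eqP; rewrite -(@eqrXn2 _ 2) ?normc_ge0// mob_num//.
  by rewrite z1 expr1n subrr subr0.
by rewrite divff// normc_eq0.
Qed.

Lemma mob_comp al be al' be' z : su al be -> su al' be' -> normc z <= 1 ->
  mob al be (mob al' be' z) =
  mob (al * al' + be * be'^*) (al * be' + be * al'^*) z.
Proof.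
move=> s s' z1; have d' := mob_den s' z1; have d := mob_den (su_mul s s') z1.
rewrite /mob; move: d; rewrite !(rmorphD, rmorphM)/= !conjCK => d.
field; rewrite /= d' andbT; apply: contraNneq d => E; apply/eqP; rewrite -E; ring.
Qed.

Lemma mob1 z : mob 1 0 z = z.
Proof. by rewrite /mob rmorph0 rmorph1 mul0r mul1r add0r addr0 divr1. Qed.

Lemma mobK al be z : su al be -> normc z <= 1 ->
  mob al^* (- be) (mob al be z) = z.
Proof.
move=> s z1; rewrite mob_comp//; last exact: su_inv.
rewrite (_ : al^* * al + - be * be^* = 1); last by rewrite -s; ring.
by rewrite (_ : al^* * be + - be * al^* = 0) ?mob1//; ring.
Qed.

Lemma mobVK al be z : su al be -> normc z <= 1 ->
  mob al be (mob al^* (- be) z) = z.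
Proof. by move=> s z1; have := mobK (su_inv s) z1; rewrite conjCK opprK. Qed.

Lemma cdiff_mob al be z : su al be -> normc z <= 1 -> exists l, cdiff (mob al be) z l.
Proof.
move=> s z1; have aff (c e : C) : cdiff (fun w => c * w + e) z (0 * z + c * 1 + 0).
  apply: cdiffD; last exact: cdiff_cst.
  by apply: cdiffM; [exact: cdiff_cst|exact: cdiff_id].
eexists; apply: (cdiffM (aff al be)); apply: cdiffV; last exact: aff.
exact: mob_den.
Qed.

(** The matrix with rows [(1, - z)] and [(- conj z, 1)] sends [z] to 0; dividing it by the square
    root [s] of its determinant [1 - |z|^2] normalizes it. *)
Lemma mob_to0 z : normc z < 1 -> exists al be, su al be /\ mob al be z = 0.
Proof.
move=> z1; pose s := Num.sqrt (1 - normc z ^+ 2).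
have s0 : 0 < s by rewrite sqrtr_gt0 subr_gt0 expr_lt1 ?normc_ge0.
have s2 : s ^+ 2 = 1 - normc z ^+ 2.
  by rewrite sqr_sqrtr// subr_ge0 expr_le1 ?normc_ge0// ltW.
exists (s^-1)%:C, (- z * (s^-1)%:C); split; last first.
  by rewrite /mob (_ : _ * z + _ = 0) ?mul0r//; ring.
have cr (x : R) : (x%:C : C)^* = x%:C by exact: conjc_real.
rewrite /su !(rmorphM, rmorphN)/= !cr.
rewrite (_ : _ - _ = (1 - z * z^*) * (s^-1 ^+ 2)%:C); last first.
  by rewrite rmorphXn/=; ring.
rewrite mulcJ -(rmorph1 (real_complex R)) -(rmorphB (real_complex R)) -s2.
by rewrite -(rmorphM (real_complex R)) exprVn mulfV// expf_neq0// gt_eqF.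
Qed.

Section on_circle.
Variables (al be : C) (s : su al be).

Let mobT_subproof xi : `|mob al be (cval xi)| == 1.
Proof. by rewrite normrcE mob_circle// normc_circle. Qed.

Definition mobT xi : T := Sub (mob al be (cval xi)) (mobT_subproof xi).

Lemma cval_mobT xi : cval (mobT xi) = mob al be (cval xi).
Proof. exact: SubK. Qed.

Lemma measurable_mobT : measurable_fun setT mobT.
Proof.
apply: measurable_to_circle; under eq_fun do rewrite cval_mobT.
suff [] : bmc (fun xi => mob al be (cval xi)) by [].
apply: bmc_circle => z z1; have [|l dl] := cdiff_mob s (z := z); first by rewrite z1.
exact: cdiff_cont dl.
Qed.

End on_circle.

Lemma mobTK al be (s : su al be) (s' : su al^* (- be)) : cancel (mobT s) (mobT s').
Proof. by move=> xi; apply: cval_inj; rewrite !cval_mobT mobK// normc_circle. Qed.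

Lemma bvals_mob al be (s : su al be) f g : bvals f g ->
  bvals (fun z => mob al be (f z)) (fun xi => mobT s (g xi)).
Proof.
move=> [df f1 mg fg]; split.
- move=> z z1; have [l dl] := df z z1.
  have [m dm] := cdiff_mob s (ltW (f1 z z1)).
  by eexists; exact: cdiff_comp dl dm.
- by move=> z z1; apply: mob_disc => //; exact: f1.
- exact: measurableT_comp (measurable_mobT s) mg.
- apply: filterS fg => xi h; rewrite cval_mobT.
  have [|m dm] := @cdiff_mob al be (cval (g xi)) s; first by rewrite normc_circle.
  exact: (cvg_comp _ _ h (cdiff_cont dm)).
Qed.

Lemma bvals_id : @bvals R id id.
Proof.
split=> //.
  by move=> z _; exists 1; exact: cdiff_id.
by apply/nearW => xi; exact: (@scale_cvg _ id _ (@cont_id _ _)).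
Qed.

End moebius.

(** * The composition operator and weighted norms *)

Section composition_operator.
Variable R : realType.
Local Notation C := R[i].
Local Notation Re := (@complex.Re R).
Local Notation Im := (@complex.Im R).
Local Notation lam := (@circle_measure R).
Local Notation T := (circle R).
Local Notation L2c := (L2 lam).
Implicit Types (xi : T) (phi psi chi : L2c) (f : C -> C) (g : T -> T) (u : T -> R).

Let n0 : normc (0 : C) < 1. Proof. by rewrite normc0. Qed.

Lemma measurable_sqr phi : measurable_fun setT (fun xi => (normc (phi xi) ^+ 2)%:E).
Proof.
apply/measurable_EFinP; apply: measurable_funX; apply: measurable_normc.
exact: L2_measurable.
Qed.

Lemma bvals_sqr f g z phi : bvals f g -> normc z < 1 ->
  (\int[lam]_xi ((normc (phi (g xi)) ^+ 2)%:E * (pk z xi)%:E) =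
   \int[lam]_xi ((normc (phi xi) ^+ 2)%:E * (pk (f z) xi)%:E))%E.
Proof.
move=> fg z1; apply: (bvals_integral fg z1 (measurable_sqr phi)) => xi.
by rewrite lee_fin sqr_ge0.
Qed.

(** The image of the measure under [g] has density [pk (f 0)], which is bounded, so square
    integrability survives composition with [g]. *)
Lemma bvals_comp f g phi : bvals f g ->
  exists psi, {ae lam, forall xi, psi xi = phi (g xi)}.
Proof.
move=> fg; have [df f1 mg _] := fg.
apply: mkL2; first exact: (measurableT_comp (L2_measurable phi) mg).
have := bvals_sqr phi fg n0; under eq_integral do rewrite pk0 mule1.
move=> ->; have [mpk [K pkK]] := bmr_pk (f1 0 n0).
apply: (@le_lt_trans _ _ (\int[lam]_xi (K%:E * (normc (phi xi) ^+ 2)%:E))%E).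
  apply: ge0_le_integral => //.
  - by move=> xi _; rewrite mule_ge0// lee_fin ?sqr_ge0// pk_ge0// f1.
  - by apply: emeasurable_funM; [exact: measurable_sqr|exact/measurable_EFinP].
  - by apply: emeasurable_funM => //; exact: measurable_sqr.
  - move=> xi _; rewrite muleC lee_wpmul2r ?lee_fin ?sqr_ge0//.
    by apply: le_trans (pkK xi); exact: ler_norm.
rewrite integralZl//; last first.
  apply/integrableP; split; first exact: measurable_sqr.
  under eq_integral do rewrite gee0_abs ?lee_fin ?sqr_ge0//.
  by rewrite -nrm_sqr ltry.
by rewrite -nrm_sqr -EFinM ltry.
Qed.

Section given_boundary_map.
Variables (f : C -> C) (g : T -> T).
Hypotheses (fg : bvals f g) (bg : {ae lam, forall xi, boundary_map f xi = g xi}).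

Lemma comp_opE phi : {ae lam, forall xi, comp_op f phi xi = phi (g xi)}.
Proof.
have [psi psiE] := bvals_comp phi fg.
have : {ae lam, forall xi, psi xi = phi (boundary_map f xi)}.
  by apply: filterS2 psiE bg => xi -> ->.
move=> psiE'; have := @xgetPex _ 0 [set psi : L2c | {ae lam, forall xi, psi xi = phi (boundary_map f xi)}] (ex_intro _ psi psiE').
by rewrite -/(comp_op f phi) /= => h; apply: filterS2 h bg => xi -> ->.
Qed.

Lemma comp_opD phi psi : comp_op f (phi + psi) = comp_op f phi + comp_op f psi.
Proof.
apply: L2_ext.
(* [L2_addE] holds only almost everywhere, and pulling it back along [g] requires that preimages of
   null sets be null. *)
have := bvals_nonsingular fg (L2_addE phi psi).
apply: filterS3 (filterI (comp_opE (phi + psi)) (comp_opE phi))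
  (filterI (comp_opE psi) (L2_addE (comp_op f phi) (comp_op f psi))).
by move=> xi [-> E1] [E2 ->] ->; rewrite E1 E2.
Qed.

(** Keeping the weight [pk z] makes the formula iterate: each application of the operator moves [z]
    to [f z]. *)
Lemma comp_op_nrm z phi : normc z < 1 ->
  (\int[lam]_xi ((normc (comp_op f phi xi) ^+ 2)%:E * (pk z xi)%:E) =
   \int[lam]_xi ((normc (phi xi) ^+ 2)%:E * (pk (f z) xi)%:E))%E.
Proof.
move=> z1; rewrite -(bvals_sqr phi fg z1); apply: ae_eq_integral => //.
- apply: emeasurable_funM; first exact: measurable_sqr.
  by apply/measurable_EFinP; have [] := bmr_pk z1.
- apply: emeasurable_funM; last by apply/measurable_EFinP; have [] := bmr_pk z1.
  by case: fg => _ _ mg _; exact: measurableT_comp (measurable_sqr phi) mg.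
- by apply: filterS (comp_opE phi) => xi -> _.
Qed.

Let ell z phi := \int[lam]_xi (Re (phi xi) * pk z xi).

Let mRe phi : measurable_fun setT (fun xi => Re (phi xi)).
Proof. by have /measurable_complexP[] := L2_measurable phi. Qed.

Let ell_comp z phi : normc z < 1 -> ell z (comp_op f phi) = ell (f z) phi.
Proof.
move=> z1; congr fine; rewrite -(bvals_integral_real fg z1 (mRe phi)).
have [mpk _] := bmr_pk z1.
apply: ae_eq_integral => //.
- by apply/measurable_EFinP; exact: measurable_funM.
- apply/measurable_EFinP; apply: measurable_funM => //.
  by case: fg => _ _ mg _; exact: measurableT_comp (mRe phi) mg.
- by apply: filterS (comp_opE phi) => xi -> _.
Qed.

Let ell_bound z : normc z < 1 -> exists2 K, 0 < K & forall phi (e : R), 0 < e ->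
  nrm phi < e -> lam.-integrable setT (fun xi => (Re (phi xi) * pk z xi)%:E) /\
  `|ell z phi| <= K * e.
Proof.
move=> z1; have [mpk [K pkK]] := bmr_pk z1.
have K0 : 0 <= K by apply: le_trans (pkK (circle_param 0)).
exists (K + 1) => [|phi e e0 pe]; first by rewrite ltr_wpDl.
have mu : measurable_fun setT (fun xi => (Re (phi xi) * pk z xi)%:E).
  by apply/measurable_EFinP; exact: measurable_funM.
have mn : measurable_fun setT (fun xi => (normc (phi xi))%:E).
  by apply/measurable_EFinP; apply: measurable_normc; exact: L2_measurable.
have bnd : (\int[lam]_xi `|(Re (phi xi) * pk z xi)%:E| <= ((K + 1) * e)%:E)%E.
  apply: (@le_trans _ _ (\int[lam]_xi ((K + 1)%:E * (normc (phi xi))%:E))%E).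
    apply: ge0_le_integral => //.
    - exact: measurableT_comp.
    - exact: emeasurable_funM.
    - move=> xi _; rewrite lee_fin normrM mulrC ler_pM//; last exact: Re_le.
      by apply: le_trans (pkK xi) _; rewrite lerDl.
  rewrite ge0_integralZl//; last 2 first.
  - by move=> xi _; rewrite lee_fin normc_ge0.
  - by rewrite lee_fin addr_ge0.
  by rewrite EFinM lee_wpmul2l ?lee_fin ?addr_ge0// Rint_normc_lt.
have iu : lam.-integrable setT (fun xi => (Re (phi xi) * pk z xi)%:E).
  by apply/integrableP; split=> //; rewrite (le_lt_trans bnd)// ltry.
split=> //; rewrite -lee_fin /ell EFin_normr_Rintegral//.
by apply: le_trans bnd; exact: le_abse_integral.
Qed.

Let near_zero_and_one (x : R) : `|x| <= 1 / 4 -> `|x - 1| <= 1 / 4 -> False.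
Proof. by rewrite !ler_norml => /andP[? ?] /andP[? ?]; lra. Qed.

Lemma transitive_no_fixed_point : topologically_transitive (comp_op f) ->
  ~ exists z : C, disc z /\ f z = z.
Proof.
move=> tr [z [z1 fz]]; move: z1; rewrite /disc/= normrcE (ltcR _ 1) => z1.
have [one oneE] : exists one : L2c, {ae lam, forall xi, one xi = 1}.
  apply: (mkL2 (u := fun=> 1)) => //.
  under eq_integral do rewrite normc1 expr1n.
  by rewrite integral_cst// mul1e (le_lt_trans (probability_le1 _ _)) ?ltry.
have [K K0 KP] := ell_bound z1.
(* With this radius the functional is within 1/4 of 0 at [chi] and within 1/4 of 1 at its iterate,
   while invariance makes the two values equal. *)
pose e := (4 * K)^-1.
have e0 : 0 < e by rewrite invr_gt0 mulr_gt0.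
have [k [chi [c1 c2]]] := transitive_nrm tr 0 one e0.
have inv : ell z (iter k (comp_op f) chi) = ell z chi.
  by elim: k {c2} => // k IH; rewrite iterS ell_comp// fz.
rewrite subr0 in c1; have [ic b1] := KP _ _ e0 c1.
have [_ b2] := KP _ _ e0 c2.
set chik := iter k (comp_op f) chi in inv c2 b2.
have iphi phi : lam.-integrable setT (fun xi => (Re (phi xi) * pk z xi)%:E).
  have n1 : nrm phi < nrm phi + 1 by rewrite ltrDl.
  by have [] := KP phi _ (ltr_wpDl (nrm_ge0 _) ltr01) n1.
have mphi phi : measurable_fun setT (fun xi => (Re (phi xi) * pk z xi)%:E).
  exact: measurable_int (iphi phi).
have [mpk _] := bmr_pk z1.
have l1 : ell z one = 1.
  rewrite -(Rint_pk z1); congr fine; apply: ae_eq_integral => //.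
    exact/measurable_EFinP.
  by apply: filterS oneE => xi -> _; rewrite /= mul1r.
have lB : ell z (chik - one) = ell z chik - ell z one.
  rewrite /ell -(RintegralB _ (iphi chik) (iphi one))//; congr fine.
  apply: ae_eq_integral => //.
    apply/measurable_EFinP; apply: measurable_funB; exact/measurable_EFinP/mphi.
  by apply: filterS (L2_subE chik one) => xi -> _; rewrite cReD cReN mulrBl.
move: b2; rewrite lB l1 inv => b2.
have Ke : K * e = 1 / 4 by rewrite /e; field; exact: lt0r_neq0.
by rewrite Ke in b1 b2; exact: near_zero_and_one b1 b2.
Qed.

End given_boundary_map.
End composition_operator.

(** * Transitive operators *)

Section dense_range.
Variable R : realType.
Local Notation C := R[i].
Local Notation Re := (@complex.Re R).
Local Notation Im := (@complex.Im R).
Local Notation lam := (@circle_measure R).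
Local Notation T := (circle R).
Local Notation L2c := (L2 lam).
Implicit Types (xi : T) (phi psi chi : L2c) (f F : C -> C) (g gF : T -> T) (u v : T -> R).

(** Degree-one harmonic; [rk 1] is the real coordinate. The kernel [1 + rk c] has moments 1 and
    [c / 2] in degrees 0 and 1, and 0 in higher degrees. *)
Definition rk (c : C) xi : R := Re (c * (cval xi)^*).

Let bval : bmc (fun xi : T => cval xi).
Proof. by apply: (@bmc_circle _ id) => w _; exact: cont_id. Qed.

Let bvalc : bmc (fun xi : T => (cval xi)^*).
Proof. exact: bmc_conj. Qed.

Lemma bmr_rk c : bmr (rk c).
Proof. exact: bmc_Re (bmcZ _ bvalc). Qed.

Lemma rk_le c xi : `|rk c xi| <= normc c.
Proof.
by apply: le_trans (Re_le _) _; rewrite normcM normc_conj normc_circle mulr1.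
Qed.

Let rkE c xi : (rk c xi)%:C = c / 2 * (cval xi)^* + c^* / 2 * cval xi.
Proof.
have -> : (rk c xi)%:C = (c * (cval xi)^* + (c * (cval xi)^*)^*) / 2 by exact: ReJ_add.
by rewrite rmorphM/= conjCK; field.
Qed.

Let cint_val : cint lam (fun xi => cval xi) = 0.
Proof.
rewrite -[RHS](@negative_coefficient R (fun=> 1) 2) ?ltr1n//.
  by congr cint; apply/funext => xi; rewrite mul1r.
by move=> w _; eexists; exact: cdiff_cst.
Qed.

(** Expanding [rk] in [xi] and its conjugate leaves three coefficients of the boundary function of
    [F^n]: the mean [F(0)^n], the coefficient of [xi], which is the derivative of [F^n] at 0, and
    that of [1 / xi], which vanishes. *)
Lemma kernel_moments F gF a c n : bvals F gF -> F 0 = 0 -> cdiff F 0 a ->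
  cint lam (fun xi => cval (gF xi) ^+ n * (1 + rk c xi)%:C) =
  0 ^+ n + c / 2 * (a * 0 ^+ n.-1 *+ n).
Proof.
move=> FgF F0 dF0; have [dFn Fn1 mgn Fgn] := bvals_pow n FgF.
have bg : bmc (fun xi => cval (gF xi) ^+ n).
  by split=> //; exists 1 => xi; rewrite normcX normc_circle expr1n.
have m0 : cint lam (fun xi => cval (gF xi) ^+ n) = 0 ^+ n.
  have := bvals_moment n FgF (z := 0); rewrite normc0 F0 => /(_ ltr01) <-.
  by congr cint; apply/funext => xi; rewrite pk0 mulr1.
have m1 : cint lam (fun xi => cval (gF xi) ^+ n * (cval xi)^*) = a * 0 ^+ n.-1 *+ n.
  (* [boundary_first_coefficient] needs a function vanishing at 0, which fails for [F ^+ 0]. *)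
  case: (posnP n) dFn Fn1 mgn Fgn => [->|n0] dFn Fn1 mgn Fgn.
    rewrite mulr0n; under eq_fun do rewrite expr0 mul1r.
    by rewrite cint_conj// cint_val rmorph0.
  apply: (boundary_first_coefficient dFn Fn1 mgn Fgn).
    by rewrite F0 expr0n gtn_eqF.
  by have := cdiffX n dF0; rewrite F0.
have m2 : cint lam (fun xi => cval (gF xi) ^+ n * cval xi) = 0.
  exact: (boundary_negative_coefficient dFn Fn1 mgn Fgn).
have -> : (fun xi => cval (gF xi) ^+ n * (1 + rk c xi)%:C) =
    (fun xi => cval (gF xi) ^+ n + (c / 2 * (cval (gF xi) ^+ n * (cval xi)^*) +
       c^* / 2 * (cval (gF xi) ^+ n * cval xi))).
  apply/funext => xi; have -> : (1 + rk c xi)%:C = 1 + (rk c xi)%:C.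
    exact: (rmorphD (real_complex R) 1).
  by rewrite rkE; ring.
have b1 : bmc (fun xi => cval (gF xi) ^+ n * (cval xi)^*) by exact: bmcM.
have b2 : bmc (fun xi => cval (gF xi) ^+ n * cval xi) by exact: bmcM.
rewrite cintD//; last by apply: bmcD; exact: bmcZ.
rewrite cintD; [|exact: bmcZ..].
by rewrite !cintZ// m0 m1 m2 mulr0 addr0.
Qed.

Lemma first_coefficient_le1 F gF a : bvals F gF -> F 0 = 0 -> cdiff F 0 a -> normc a <= 1.
Proof.
move=> FgF F0 dF0; have [dF F1 mg Fg] := FgF.
have mvg : measurable_fun setT (fun xi => cval (gF xi)).
  exact: measurableT_comp (@measurable_cval R) mg.
have F1' z : normc z < 1 -> normc (F z) <= 1 by move=> /F1/ltW.
rewrite -(boundary_first_coefficient dF F1' mvg Fg F0 dF0).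
apply: normc_cint_le.
  apply: (bmcM _ bvalc); split=> //; exists 1 => xi; by rewrite normc_circle.
by move=> xi; rewrite normcM normc_conj !normc_circle mulr1.
Qed.

(* The projection of [Re xi] onto the functions of [gF xi] is [Re (a^* gF xi)].
   The constant 1 makes both kernels nonnegative densities. *)
Lemma kernel_integral F gF a u : bvals F gF -> F 0 = 0 -> cdiff F 0 a ->
  measurable_fun setT u ->
  (\int[lam]_xi (u (gF xi) * (1 + rk 1 xi))%:E =
   \int[lam]_xi (u xi * (1 + rk a xi))%:E)%E.
Proof.
move=> FgF F0 dF0 mu; have a1 := first_coefficient_le1 FgF F0 dF0.
have bk c : bmr (fun xi => 1 + rk c xi).
  by apply: bmrD; [exact: bmr_cst|exact: bmr_rk].
have k0 c : normc c <= 1 -> forall xi, 0 <= 1 + rk c xi.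
  move=> c1 xi; have := le_trans (rk_le c xi) c1.
  by rewrite ler_norml -subr_ge0 opprK addrC => /andP[].
have mg : measurable_fun setT gF by case: FgF.
apply: moment_integral_real => //.
- by apply: k0; rewrite normc1.
- exact: k0.
- move=> n; rewrite (kernel_moments 1 n FgF F0 dF0).
  have := @kernel_moments id id 1 a n (bvals_id R) erefl (cdiff_id 0).
  by move=> ->; rewrite -!mulrnAr; ring.
Qed.

Definition sqi u := measurable_fun setT u /\
  (\int[lam]_xi (u xi ^+ 2)%:E < +oo)%E.

Let norm_le_sqr (x : R) : `|x| <= x ^+ 2 + 1.
Proof.
have := sqr_ge0 (`|x| - 1); rewrite sqrrB1 real_normK ?num_real//.
by have := normr_ge0 x; lra.
Qed.

Let Re_sqr (w : C) : Re w ^+ 2 = 2^-1 * (normc w ^+ 2 + Re (w ^+ 2)).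
Proof. by rewrite normcE2 [in RHS]expr2 [w ^+ 2]expr2 cReM; field. Qed.

Lemma sqi_integrable u v : sqi u -> bmr v ->
  lam.-integrable setT (EFin \o (fun xi => u xi * v xi)).
Proof.
move=> [mu u2] [mv [M vM]].
have M0 : 0 <= M by apply: le_trans (vM (circle_param 0)).
have muv : measurable_fun setT (EFin \o (fun xi => u xi * v xi)).
  by apply/measurable_EFinP; exact: measurable_funM.
have m2 : measurable_fun setT (fun xi => (u xi ^+ 2)%:E).
  by apply/measurable_EFinP; exact: measurable_funX.
apply/integrableP; split=> //.
apply: (@le_lt_trans _ _ (\int[lam]_xi (M%:E * ((u xi ^+ 2)%:E + 1)))%E).
  apply: ge0_le_integral => //.
  - exact: measurableT_comp.
  - by apply: emeasurable_funM => //; exact: emeasurable_funD.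
  - by move=> xi _ /=; rewrite lee_fin normrM mulrC ler_pM ?norm_le_sqr.
rewrite ge0_integralZl//; last 2 first.
- exact: emeasurable_funD.
- by move=> xi _; rewrite adde_ge0 ?lee_fin ?sqr_ge0.
rewrite ge0_integralD//; last by move=> xi _; rewrite lee_fin sqr_ge0.
rewrite lte_mul_pinfty ?lee_fin// lte_add_pinfty//.
by rewrite integral_cst// mul1e (le_lt_trans (probability_le1 _ _)) ?ltry.
Qed.

Lemma sqi_sqr_integrable u : sqi u -> lam.-integrable setT (EFin \o (fun xi => u xi ^+ 2)).
Proof.
move=> [mu u2]; apply/integrableP; split.
  by apply/measurable_EFinP; exact: measurable_funX.
by under eq_integral do rewrite gee0_abs ?lee_fin ?sqr_ge0//.
Qed.

Lemma sqi_expand u v : sqi u -> bmr v ->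
  \int[lam]_xi ((u xi - v xi) ^+ 2) =
  \int[lam]_xi (u xi ^+ 2) - 2 * \int[lam]_xi (u xi * v xi) + \int[lam]_xi (v xi ^+ 2).
Proof.
move=> su bv; have iuv := sqi_integrable su bv; have iu := sqi_sqr_integrable su.
have iv : lam.-integrable setT (EFin \o (fun xi => v xi ^+ 2)).
  exact/bmr_integrable/bmrX.
rewrite -RintegralZl//.
have i2 : lam.-integrable setT (EFin \o (fun xi => 2 * (u xi * v xi))).
  by have := integrableZl measurableT 2 iuv.
rewrite -RintegralB// -RintegralD//; last by have := integrableB measurableT iu i2.
by apply: eq_Rintegral => xi _; ring.
Qed.

(** For [w = c conj xi], the square of [Re w] is half of [|w|^2 + Re (w^2)], and [w^2] has mean
    0. *)
Lemma Rint_rk_sqr c : \int[lam]_xi (rk c xi ^+ 2) = normc c ^+ 2 / 2.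
Proof.
have c2 : cint lam (fun xi => c ^+ 2 * (cval xi * cval xi)^*) = 0.
  rewrite cintZ; last exact/bmc_conj/bmcM.
  rewrite cint_conj; last exact: bmcM.
  rewrite (@negative_coefficient R id 2) ?ltr1n//; last first.
    by move=> w _; eexists; exact: cdiff_id.
  by rewrite rmorph0 mulr0.
have bc : bmr (fun xi => Re (c ^+ 2 * (cval xi * cval xi)^*)).
  exact: bmc_Re (bmcZ _ (bmc_conj (bmcM bval bval))).
have -> : \int[lam]_xi (rk c xi ^+ 2) =
    \int[lam]_xi (2^-1 * (normc c ^+ 2 + Re (c ^+ 2 * (cval xi * cval xi)^*))).
  apply: eq_Rintegral => xi _.
  have -> : normc c ^+ 2 = normc (c * (cval xi)^*) ^+ 2.
    by rewrite normcM normc_conj normc_circle mulr1.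
  have -> : c ^+ 2 * (cval xi * cval xi)^* = (c * (cval xi)^*) ^+ 2.
    by rewrite rmorphM exprMn -expr2.
  exact: Re_sqr.
rewrite RintZ; last by apply: bmrD => //; exact: bmr_cst.
rewrite RintD//; last exact: bmr_cst.
rewrite Rint_cst mulrC; congr (_ * _).
by rewrite (_ : \int[lam]_xi _ = 0) ?addr0//; have /(congr1 Re) := c2.
Qed.

End dense_range.

(** * A transitive composition operator comes from a Moebius map *)

Section transitive_automorphism.
Variable R : realType.
Local Notation C := R[i].
Local Notation Re := (@complex.Re R).
Local Notation Im := (@complex.Im R).
Local Notation lam := (@circle_measure R).
Local Notation T := (circle R).
Local Notation L2c := (L2 lam).
Implicit Types (xi : T) (phi psi chi : L2c).
Variables (f : C -> C) (g : T -> T).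
Hypotheses (fg : bvals f g) (bg : {ae lam, forall xi, boundary_map f xi = g xi}).
Hypothesis tr : topologically_transitive (comp_op f).

Let n0 : normc (0 : C) < 1. Proof. by rewrite normc0. Qed.

Let XP : exists X : L2c, {ae lam, forall xi, X xi = cval xi}.
Proof.
apply: mkL2; first exact: measurable_cval.
under eq_integral do rewrite normc_circle expr1n.
by rewrite integral_cst// mul1e (le_lt_trans (probability_le1 _ _)) ?ltry.
Qed.

(** Transitivity leads from near 0 to near [X]. Time 0 is excluded because [X] has norm 1 and
    [e <= 1/2]; at a positive time the iterate lies in the range. *)
Let dense (X : L2c) (e : R) : {ae lam, forall xi, X xi = cval xi} -> 0 < e -> e <= 1 / 2 ->
  exists phi, nrm (comp_op f phi - X) < e.
Proof.
move=> XE e0 e2.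
have nX : nrm X = 1.
  apply/eqP; rewrite -(@eqrXn2 _ 2) ?nrm_ge0// expr1n; apply/eqP/EFin_inj.
  rewrite nrm_sqr; transitivity (\int[lam]_xi cst 1 xi)%E.
    apply: ae_eq_integral => //; first exact: measurable_sqr.
    by apply: filterS XE => xi -> _; rewrite normc_circle expr1n.
  by rewrite integral_cst// mul1e; exact: probability_setT.
have [[|k] [chi [c1 c2]]] := transitive_nrm tr 0 X e0; last by exists (iter k (comp_op f) chi).
exfalso; rewrite subr0 in c1; rewrite /= nrmB in c2.
have := nrmD (X - chi) chi; rewrite subrK nX => h; lra.
Qed.

Variables (al be : C) (s : su al be) (fb : mob al be (f 0) = 0).
Let F z := mob al be (f z).
Let gF xi := mobT s (g xi).
Let FgF : bvals F gF := bvals_mob s fg.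
Let FE : F 0 = 0 := fb.

Let combine (p q d e : R) : 0 <= p - 2 * q + d / 2 -> p - 2 * q + 1 / 2 <= e ^+ 2 ->
  1 - 2 * e ^+ 2 <= d.
Proof. by move=> h1 h2; lra. Qed.

(* [Re xi] has mean square 1/2, while its best approximation by a function of
   [gF xi] has mean square [normc a ^+ 2 / 2]. *)
Let near_X (X : L2c) a phi (e : R) : {ae lam, forall xi, X xi = cval xi} ->
  cdiff F 0 a -> 0 < e -> nrm (comp_op f phi - X) < e -> 1 - 2 * e ^+ 2 <= normc a ^+ 2.
Proof.
move=> XE dFa e0 phiX.
pose u xi := Re (phi (g xi)).
(* Undoing the Moebius map turns [u], a function of [g], into the function [w] of [gF]; it is for
   [gF] that the interior map fixes 0. *)
pose w xi := Re (phi (mobT (su_inv s) xi)).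
have mRe : measurable_fun setT (fun xi => Re (phi xi)).
  by have /measurable_complexP[] := L2_measurable phi.
have [_ _ mg _] := fg.
have mphig : measurable_fun setT (fun xi => phi (g xi)).
  exact: measurableT_comp (L2_measurable phi) mg.
have mu : measurable_fun setT u by exact: measurableT_comp mRe mg.
have mw : measurable_fun setT w by exact: measurableT_comp mRe (measurable_mobT _).
have wgF xi : w (gF xi) = u xi by rewrite /w /gF mobTK.
have Tphi : ((nrm (comp_op f phi) ^+ 2)%:E = \int[lam]_xi (normc (phi (g xi)) ^+ 2)%:E)%E.
  rewrite nrm_sqr; apply: ae_eq_integral => //.
  - exact: measurable_sqr.
  - exact: measurableT_comp (measurable_sqr phi) mg.
  - by apply: filterS (comp_opE fg bg phi) => xi -> _.
have su : sqi u.
  split=> //; apply: (@le_lt_trans _ _ (nrm (comp_op f phi) ^+ 2)%:E); last by rewrite ltry.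
  rewrite Tphi; apply: ge0_le_integral => //.
  - by move=> xi _; rewrite lee_fin sqr_ge0.
  - by apply/measurable_EFinP; exact: measurable_funX.
  - exact: measurableT_comp (measurable_sqr phi) mg.
  - by move=> xi _; rewrite lee_fin normcE2 lerDl sqr_ge0.
have uw2 : (\int[lam]_xi (u xi ^+ 2)%:E = \int[lam]_xi (w xi ^+ 2)%:E)%E.
  have mw2 : measurable_fun setT (fun xi => w xi ^+ 2) by exact: measurable_funX.
  transitivity (\int[lam]_xi (w (gF xi) ^+ 2 * pk 0 xi)%:E)%E.
    by apply: eq_integral => xi _; rewrite pk0 mulr1 wgF.
  rewrite (bvals_integral_real FgF n0 mw2) FE.
  by apply: eq_integral => xi _; rewrite pk0 mulr1.
have uw1 : \int[lam]_xi (u xi * 1) = \int[lam]_xi (w xi * 1).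
  congr fine; transitivity (\int[lam]_xi (w (gF xi) * pk 0 xi)%:E)%E.
    by apply: eq_integral => xi _; rewrite pk0 wgF.
  rewrite (bvals_integral_real FgF n0 mw) FE.
  by apply: eq_integral => xi _; rewrite pk0.
have sw : sqi w by split=> //; rewrite -uw2; case: su.
have uwk : \int[lam]_xi (u xi * (1 + rk 1 xi)) = \int[lam]_xi (w xi * (1 + rk a xi)).
  congr fine; rewrite -(kernel_integral FgF FE dFa mw).
  by apply: eq_integral => xi _; rewrite wgF.
have split_k v c : sqi v -> \int[lam]_xi (v xi * (1 + rk c xi)) =
    \int[lam]_xi (v xi * 1) + \int[lam]_xi (v xi * rk c xi).
  move=> sv; rewrite -(RintegralD _ (sqi_integrable sv (bmr_cst _ 1))
    (sqi_integrable sv (bmr_rk c)))//.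
  by apply: eq_Rintegral => xi _; rewrite mulrDr.
(* The equality of means cancels the constant 1 of the kernels and leaves the correlations with
   [rk]. *)
rewrite !split_k// uw1 in uwk; move/addrI : uwk => uwk.
have Ew := sqi_expand sw (bmr_rk a); have Eu := sqi_expand su (bmr_rk 1).
rewrite !Rint_rk_sqr normc1 expr1n in Ew Eu.
have uw2' : \int[lam]_xi (u xi ^+ 2) = \int[lam]_xi (w xi ^+ 2) by congr fine.
have pos : 0 <= \int[lam]_xi ((w xi - rk a xi) ^+ 2).
  by apply: Rintegral_ge0 => xi _; exact: sqr_ge0.
have bound : \int[lam]_xi ((u xi - rk 1 xi) ^+ 2) <= e ^+ 2.
  have E := nrm_subE mphig (@measurable_cval R) (comp_opE fg bg phi) XE.
  apply: (@le_trans _ _ (nrm (comp_op f phi - X) ^+ 2)); last first.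
    by rewrite lerXn2r ?nnegrE ?nrm_ge0// ltW.
  have bE : (\int[lam]_xi ((u xi - rk 1 xi) ^+ 2)%:E <= (nrm (comp_op f phi - X) ^+ 2)%:E)%E.
    rewrite E; apply: ge0_le_integral => //.
    - by move=> xi _; rewrite lee_fin sqr_ge0.
    - apply/measurable_EFinP; apply: measurable_funX; apply: measurable_funB => //.
      by have [] := bmr_rk (1 : C).
    - apply/measurable_EFinP; apply: measurable_funX; apply: measurable_normc.
      rewrite (_ : (fun _ => _) = (fun xi => phi (g xi)) + (-1) *: (fun xi => cval xi)).
        apply: measurable_funDc => //; exact: (measurable_funZc (-1) (@measurable_cval R)).
      by apply/funext => xi; rewrite !fctE scaleN1r.
    - move=> xi _; rewrite lee_fin.
      have -> : u xi - rk 1 xi = Re (phi (g xi) - cval xi).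
        by rewrite cReD cReN /rk mul1r; case: (cval xi).
      by rewrite normcE2 lerDl sqr_ge0.
  rewrite -lee_fin /Rintegral fineK// ge0_fin_numE ?(le_lt_trans bE) ?ltry//.
  by apply: integral_ge0 => xi _; rewrite lee_fin sqr_ge0.
(* The two expanded squares differ only in their last terms, [|a|^2 / 2] and 1/2; the first is
   nonnegative and the second at most [e^2]. *)
by move: pos bound; rewrite Ew Eu uw2' uwk; exact: combine.
Qed.

Let small_radius (d : R) : 0 <= d -> d < 1 ->
  [/\ 0 < (1 - d) / 2, (1 - d) / 2 <= 1 / 2 & d < 1 - 2 * ((1 - d) / 2) ^+ 2].
Proof. by move=> d0 d1; split; [lra|lra|nra]. Qed.

Lemma transitive_moebius : exists2 a, normc a = 1 &
  forall z, normc z < 1 -> mob al be (f z) = a * z.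
Proof.
have [X XE] := XP; have [dF F1 _ _] := FgF.
have [a dFa] := dF 0 n0; have a1 := first_coefficient_le1 FgF FE dFa.
have a1' : 1 <= normc a.
  rewrite leNgt; apply/negP => alt.
  have a2 : normc a ^+ 2 < 1 by rewrite expr_lt1 ?normc_ge0.
  have a0 : 0 <= normc a ^+ 2 by exact: sqr_ge0.
  have [e0 e2 lt] := small_radius a0 a2.
  have [phi phiX] := dense XE e0 e2.
  by have := near_X XE dFa e0 phiX; rewrite leNgt lt.
exists a; first by apply/eqP; rewrite eq_le a1.
apply: (schwarz dF _ FE dFa a1').
by move=> z /F1/ltW.
Qed.

End transitive_automorphism.

(** * Automorphisms of the disc *)

Section disc_automorphisms.
Variable R : realType.
Local Notation C := R[i].
Local Notation Re := (@complex.Re R).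
Local Notation Im := (@complex.Im R).
Local Notation lam := (@circle_measure R).
Local Notation T := (circle R).
Implicit Types (z w v : C) (F f G : C -> C).

Lemma mean_value_bound G rho M p : 1 < rho ->
  (forall w, normc w < rho -> {for w, continuous G}) ->
  (forall w, normc w < rho -> w != 0 -> w != p -> exists l, cdiff G w l) ->
  (forall w, normc w = 1 -> normc (G w) <= M) -> normc (G 0) <= M.
Proof.
move=> rho1 cG dG GM; rewrite -(mean_value_circle rho1 cG dG).
apply: normc_cint_le; last by move=> xi; exact/GM/normc_circle.
by apply: bmc_circle => w w1; apply: cG; rewrite w1.
Qed.

(** By the Poisson formula and [Rint_sqr], [|G z|^2] is at most the mean of [|G|^2] times the
    squared bound of the kernel. *)
Lemma poisson_sqr_bound G rho z : 1 < rho -> normc z < 1 ->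
  (forall w, normc w < rho -> exists l, cdiff G w l) ->
  \int[lam]_xi (normc (G (cval xi)) ^+ 2) = 0 -> G z = 0.
Proof.
move=> rho1 z1 dG G0; have [mpk [K zK]] := bmr_pk z1.
have bG : bmc (fun xi : T => G (cval xi)).
  apply: bmc_circle => w w1; have [|m dm] := dG w; first by rewrite w1.
  exact: cdiff_cont dm.
have bp : bmc (fun xi => (pk z xi)%:C) by exact/bmc_real/bmr_pk.
have bGp := bmcM bG bp.
apply/eqP; rewrite -normc_eq0 -sqrf_eq0 -(poisson_formula rho1 z1 dG) eq_le sqr_ge0 andbT.
apply: (@le_trans _ _ ((\int[lam]_xi normc (G (cval xi) * (pk z xi)%:C)) ^+ 2)).
  by rewrite lerXn2r ?nnegrE ?normc_ge0 ?Rintegral_ge0 ?normc_cint// => xi _; exact: normc_ge0.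
apply: le_trans (Rint_sqr (bmc_normc bGp)) _.
have bG2 : bmr (fun xi : T => normc (G (cval xi)) ^+ 2) by exact/bmrX/bmc_normc.
rewrite -(mulr0 (K ^+ 2)) -G0 -RintZ//; apply: Rint_le.
- exact/bmrX/bmc_normc.
- by apply: bmrM bG2; exact: bmr_cst.
- move=> xi; rewrite normcM normc_real exprMn mulrC ler_wpM2r ?sqr_ge0//.
  by rewrite lerXn2r ?nnegrE ?(le_trans _ (zK xi)).
Qed.

(** Conjugation multiplies the conjugate slope by [conj (w - z) / (w - z)], of modulus at most 1 (it
    is 0 at [w = z] by the convention on division), which is harmless because the slope tends to
    0. *)
Let cdiff_conj0 f z : cdiff f z 0 -> cdiff (fun w => (f w)^*) z 0.
Proof.
move=> [phi [cphi phi0 fE]].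
exists (fun w => (phi w)^* * ((w - z)^* / (w - z))); split.
- apply/(@cvg_cplx_norm _ _ (nbhs z)) => /=; rewrite phi0 rmorph0 mul0r.
  have cn : {for z, continuous (fun w => normc (phi w))}.
    by apply: (@continuous_comp _ _ _ phi (@normc R)); [exact: cphi|exact: normc_cont].
  rewrite /prop_for /continuous_at phi0 normc0 in cn.
  apply: (squeeze_cvgr _ (@cvg_cst _ _ _ (nbhs z) _) cn).
  apply: nearW => w; rewrite subr0 normc_ge0/= normcM normc_conj ler_piMr ?normc_ge0//.
  rewrite normcM normcV.
  have -> : normc (w - z)^* = normc (w - z) by exact: normc_conj.
  have [->|wz] := eqVneq (w - z) 0; first by rewrite normc0 mul0r.
  by rewrite divff// normc_eq0.
- by rewrite phi0 rmorph0 mul0r.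
- move=> w; rewrite fE rmorphD rmorphM/=.
  have [->|wz] := eqVneq w z; first by rewrite subrr rmorph0 !mulr0.
  by rewrite -mulrA mulfVK// subr_eq0.
Qed.

(** Since all derivatives vanish, [V conj V] is holomorphic too. The mean of [|V|^2] over a circle
    is then [|V 0|^2 = 0], and [poisson_sqr_bound] gives [V = 0] inside. *)
Lemma cdiff0_constant f z : (forall w, normc w < 1 -> cdiff f w 0) ->
  normc z < 1 -> f z = f 0.
Proof.
move=> df z1.
pose V w := f w - f 0.
have dV w : normc w < 1 -> cdiff V w 0.
  move=> w1; rewrite -[0]addr0 -[X in _ + X]oppr0.
  by apply: cdiffD; [exact: df|apply: cdiffN; exact: cdiff_cst].
(* Between [normc z] and 1: [z / r] stays in the disc, and the dilate [V (r w)] is holomorphic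
   beyond the closed disc. *)
pose r := (1 + normc z) / 2.
have [r0 r1 zr] : [/\ 0 < r, r < 1 & normc z < r].
  by have := normc_ge0 z; rewrite /r; split; lra.
have ri1 : 1 < r^-1 by rewrite invf_gt1.
have r01 : 0 < r < 1 by rewrite r0.
have hV : holo_disc V by move=> w w1; exists 0; exact: dV.
have hVV : holo_disc (fun w => V w * (V w)^*).
  by move=> w w1; eexists; apply: (cdiffM (dV w w1)); apply: cdiff_conj0; exact: dV.
have zr1 : normc (z / r%:C) < 1.
  by rewrite normcM normcV normc_real gtr0_norm// ltr_pdivrMr// mul1r.
have := @poisson_sqr_bound (fun w => V (r%:C * w)) r^-1 (z / r%:C) ri1 zr1.
rewrite mulrC divfK; last by rewrite (fmorph_eq0 (real_complex R)) gt_eqF.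
move=> h; apply/eqP; rewrite -subr_eq0; apply/eqP; apply: h.
  by move=> w; exact: holo_scale.
apply: (@complexI R); rewrite -cint_real.
have -> : (fun xi : T => (normc (V (r%:C * cval xi)) ^+ 2)%:C) =
    (fun xi : T => (fun w => V w * (V w)^*) (r%:C * cval xi)).
  by apply/funext => xi; rewrite mulcJ.
rewrite (@mean_value_circle _ (fun w => V (r%:C * w) * (V (r%:C * w))^*) r^-1 0)//.
- by rewrite mulr0 /V subrr mul0r.
- by move=> w wr; have [l dl] := holo_scale hVV r01 wr; exact: cdiff_cont dl.
- by move=> w wr _ _; have [l dl] := holo_scale hVV r01 wr; exists l.
Qed.

Section bijective.
Variable F : C -> C.
Hypotheses (dF : holo_disc F) (F1 : forall z, normc z < 1 -> normc (F z) < 1).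
Hypothesis injF : forall z w, normc z < 1 -> normc w < 1 -> F z = F w -> z = w.
Hypothesis surjF : forall w, normc w < 1 -> exists2 z, normc z < 1 & F z = w.

(* Minimum modulus principle: [F - F z] does not vanish on the disc of center
   [z0] and radius [rho] when [z] lies outside of it. *)
Lemma injective_open z0 rho : 0 < rho -> normc z0 + rho < 1 ->
  exists2 d : R, 0 < d & forall z, normc z < 1 -> normc (F z - F z0) < d ->
    normc (z - z0) <= rho.
Proof.
move=> rho0 z0rho.
have inD v : normc z0 + rho * normc v < 1 -> normc (z0 + rho%:C * v) < 1.
  move=> h; apply: le_lt_trans (le_normcD _ _) _.
  by rewrite normcM normc_real gtr0_norm.
have affd v : cdiff (fun v => z0 + rho%:C * v) v (0 + (0 * v + rho%:C * 1)).
  apply: cdiffD; first exact: cdiff_cst.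
  by apply: cdiffM; [exact: cdiff_cst|exact: cdiff_id].
have dG v : normc z0 + rho * normc v < 1 -> exists l, cdiff (fun v => F (z0 + rho%:C * v)) v l.
  by move=> /inD /dF[l dl]; eexists; exact: cdiff_comp (affd v) dl.
have pi0 : 0 <= 2 * pi :> R by rewrite mulr_ge0// pi_ge0.
pose m (t : R) := normc (F (z0 + rho%:C * expi t) - F z0).
have cm : continuous m.
  move=> t; have [|l dl] := dG (expi t); first by rewrite normc_expi mulr1.
  apply: (@continuous_comp _ _ _ (fun t => F (z0 + rho%:C * expi t) - F z0) (@normc R)); last exact: normc_cont.
  apply: contB; last exact: cont_cst.
  apply: (@continuous_comp _ _ _ (@expi R) (fun v => F (z0 + rho%:C * v))); first exact: expi_cont.
  exact: cdiff_cont dl.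
have [c _ cmin] : exists2 c, c \in `[- pi, pi]%R & forall t, t \in `[- pi, pi]%R -> m c <= m t.
  apply: EVT_min; last exact: continuous_subspaceT.
  by rewrite (le_trans _ (pi_ge0 _))// oppr_le0 pi_ge0.
have z01 : normc z0 < 1 by apply: le_lt_trans z0rho; rewrite lerDl ltW.
have mc0 : 0 < m c.
  rewrite /m normc_gt0 subr_eq0; apply/eqP => /injF.
  rewrite inD ?normc_expi ?mulr1// => /(_ isT z01) /(congr1 (fun w => w - z0)).
  rewrite subrr addrAC subrr add0r => /(congr1 (@normc R)).
  by rewrite normcM normc_expi normc_real normc0 mulr1 gtr0_norm// => r0; rewrite r0 ltxx in rho0.
(* [m c] is the minimum of [|F - F z0|] on the circle. If [F z] is within half of it from [F z0],
   then [|F - F z|] is at least [m c / 2] on the circle but smaller at the center, against the mean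
   value bound for the inverse [G]. *)
exists (m c / 2) => [|z z1 Fz]; first by rewrite divr_gt0.
rewrite leNgt; apply/negP => zrho.
(* In the rescaled variable, a disc slightly larger than the unit one whose image stays in the unit
   disc and does not reach [z]. *)
pose rho' := Num.min (normc (z - z0) / rho) ((1 - normc z0) / rho).
have rho'1 : 1 < rho'.
  by rewrite lt_min !ltr_pdivlMr// !mul1r zrho/=; lra.
have inD' v : normc v < rho' -> normc z0 + rho * normc v < 1 /\ rho * normc v < normc (z - z0).
  rewrite lt_min !ltr_pdivlMr// ![normc v * rho]mulrC => /andP[h1 h2]; split=> //; lra.
have nz v : normc v < rho' -> F (z0 + rho%:C * v) - F z != 0.
  move=> /inD'[v1 v2]; rewrite subr_eq0; apply/eqP => /injF.
  rewrite inD// => /(_ isT z1) E; move: v2; rewrite -E addrAC subrr add0r.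
  by rewrite normcM normc_real gtr0_norm// ltxx.
pose G v := (F (z0 + rho%:C * v) - F z)^-1.
have dGv v : normc v < rho' -> exists l, cdiff G v l.
  move=> vr; have [v1 _] := inD' v vr; have [l dl] := dG v v1.
  eexists; apply: cdiffV; first exact: nz.
  by apply: (cdiffD dl); apply: cdiffN; exact: cdiff_cst.
have : normc (G 0) <= 2 / m c.
  apply: (@mean_value_bound G rho' (2 / m c) 0 rho'1).
  - by move=> v /dGv[l]; exact: cdiff_cont.
  - by move=> v vr _ _; exact: dGv.
  move=> v v1; have v1' : `|v| == 1 by rewrite normrcE v1.
  have [anglev] := angleP (Sub v v1' : T).
  set t := angle _ in anglev *; rewrite /cval SubK => vE.
  have := cmin t; rewrite in_itv/= anglev => /(_ isT); rewrite {2}/m vE => mcv.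
  rewrite /G normcV -[2 / m c]invrK lef_pV2 ?posrE ?normc_gt0 ?invr_gt0 ?divr_gt0//; last first.
    by apply: nz; rewrite v1.
  rewrite invf_div; have := normc_subr (F (z0 + rho%:C * v) - F z0) (F z - F z0).
  by rewrite opprB addrA subrK; move: Fz mcv; lra.
rewrite /G mulr0 addr0 normcV normcB leNgt => /negP; apply.
rewrite -[2 / m c]invrK invf_div ltf_pV2 ?posrE ?divr_gt0//.
rewrite normc_gt0 subr_eq0; apply/eqP => E; move: (zrho).
by rewrite (injF z1 z01 E) subrr normc0 ltNge (ltW rho0).
Qed.

(* [F] need not be known to have a continuous inverse: compactness is applied to
   [injective_open] at the points of the closed disc of radius [s]. *)
Lemma proper_map (s : R) : s < 1 -> exists2 r, r < 1 &
  forall z, normc z < 1 -> normc (F z) <= s -> normc z <= r.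
Proof.
move=> s1.
have K := compact_setX (@segment_compact R (-1) 1) (@segment_compact R (-1) 1).
pose P (r : R) (x : R * R) := forall z, normc z < 1 -> normc (F z) <= s ->
  F z = x.1 +i* x.2 -> normc z <= r.
have cc (x : R * R) e : 0 < e ->
    \forall y \near x, normc ((y.1 +i* y.2) - (x.1 +i* x.2)) < e.
  move=> e0; have e20 : 0 < e / 2 by rewrite divr_gt0.
  exists (ball x.1 (e / 2), ball x.2 (e / 2)); first by split; exact: nbhsx_ballx.
  move=> y [h1 h2]; rewrite /mkset; apply: le_lt_trans (normc_leD _) _.
  by rewrite (splitr e) cReD cImD cReN cImN/= ltrD// distrC.
have [r r1 rP] : exists2 r, r < 1 & `[-1, 1] `*` `[-1, 1] `<=` P r.
  suff h : \forall r \near 1^'-, `[-1, 1] `*` `[-1, 1] `<=` P r.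
    by have [r [r1 rP]] := filter_ex (filterI (nbhs_left_lt 1) h); exists r.
  move/compact_near_coveringP: K; apply => x _.
  have [x1|x1] := ltP (normc (x.1 +i* x.2)) 1.
    have [z0 z01 z0E] := surjF x1.
    (* Preimages of values near [F z0] are then within half the distance from [z0] to the circle, so
       of modulus at most [(1 + normc z0) / 2 < 1]. *)
    have rho0 : 0 < (1 - normc z0) / 2 by rewrite divr_gt0// subr_gt0.
    have [|d d0 dP] := @injective_open z0 ((1 - normc z0) / 2) rho0; first by move: z01; lra.
    exists ([set y | normc ((y.1 +i* y.2) - (x.1 +i* x.2)) < d], [set r | (1 + normc z0) / 2 < r]).
      split; first exact: cc.
      by apply: nbhs_left_gt; move: z01; lra.
    move=> [y r] [/= yd rgt] z z1 _ zE.
    have := dP z z1; rewrite zE z0E => /(_ yd) zz0.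
    have := normc_subr z z0; move: zz0 rgt; lra.
  (* Around a point of modulus at least 1, no value of modulus at most [s] lies within [1 - s]: the
     condition is empty there. *)
  exists ([set y | normc ((y.1 +i* y.2) - (x.1 +i* x.2)) < 1 - s], setT).
    by split; [apply: cc; rewrite subr_gt0|exact: filterT].
  move=> [y r] [/= yd _] z z1 zs zE; exfalso.
  move: zs; rewrite zE leNgt => /negP; apply.
  have := normc_subr (x.1 +i* x.2) (y.1 +i* y.2); rewrite normcB.
  have {}yd : normc ((y.1 +i* y.2) - (x.1 +i* x.2)) < 1 - s := yd.
  by move: yd x1; lra.
exists r => // z z1 Fz; apply: (rP (Re (F z), Im (F z))) => //=; last by case: (F z).
have F1' := F1 z1.
split; rewrite /= in_itv/= -ler_norml ltW// (le_lt_trans _ F1')//; [exact: Re_le|exact: Im_le].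
Qed.

(* The maximum principle for [z / F z] on large circles gives [1 <= normc a],
   after which the equality case of the Schwarz lemma applies. *)
Lemma bijective_rotation a : F 0 = 0 -> cdiff F 0 a -> a != 0 ->
  normc a = 1 /\ forall z, normc z < 1 -> F z = a * z.
Proof.
move=> F0 dF0 a0.
pose h := diffquot 0 a F.
have hE z : z != 0 -> h z = F z / z.
  by move=> z0; rewrite /h /diffquot (negPf z0) F0 !subr0.
have n01 : normc (0 : C) < 1 by rewrite normc0.
have hn0 z : normc z < 1 -> h z != 0.
  have [->|z0 z1] := eqVneq z 0; first by rewrite /h /diffquot eqxx.
  rewrite hE// mulf_neq0 ?invr_eq0//; apply: contraNneq z0 => Fz0.
  by apply/eqP/(injF z1 n01); rewrite F0.
have dh z : normc z < 1 -> z != 0 -> exists l, cdiff h z l.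
  move=> z1 z0; have [l dl] := dF z1; eexists.
  apply: (@near_cdiff _ (fun w => F w * w^-1)); last first.
    by apply: (cdiffM dl); apply: cdiffV z0 _; exact: cdiff_id.
  apply/nbhs_normc; exists (normc z); first by rewrite normc_gt0.
  move=> w wz /=; rewrite hE//; apply: contraTneq wz => ->.
  by rewrite sub0r normcN ltxx.
have ch z : normc z < 1 -> {for z, continuous h}.
  have [-> _|z0 z1] := eqVneq z 0; first exact/cdiff_diffquot.
  by have [l dl] := dh z z1 z0; exact: cdiff_cont dl.
have sa s : 0 < s -> s < 1 -> s <= normc a.
  move=> s0 /proper_map[r r1 rP].
  (* A positive radius strictly between [r] and 1, so that [|F| > s] on its circle; [r] itself may
     be negative. *)
  pose r' := Num.max (1 / 2) ((1 + r) / 2).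
  have r'1 : r' < 1 by rewrite gt_max; apply/andP; split; lra.
  have r'0 : 0 < r' by rewrite lt_max divr_gt0.
  have rr' : r < r' by rewrite lt_max; apply/orP; right; lra.
  have ri1 : 1 < r'^-1 by rewrite invf_gt1.
  have inD w : normc w < r'^-1 -> normc (r'%:C * w) < 1.
    by move=> wr; rewrite normcM normc_real gtr0_norm// mulrC -ltr_pdivlMr// mul1r.
  have r'C : r'%:C != 0 :> C by rewrite (fmorph_eq0 (real_complex R)) gt_eqF.
  have cs w : {for w, continuous (fun w => r'%:C * w)}.
    by apply: contM; [exact: cont_cst|exact: cont_id].
  have : normc (h (r'%:C * 0))^-1 <= s^-1.
    apply: (@mean_value_bound (fun w => (h (r'%:C * w))^-1) r'^-1 s^-1 0 ri1).
    - move=> w wr; apply: contV; first exact/hn0/inD.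
      by apply: (@continuous_comp _ _ _ (fun w => r'%:C * w) h); [exact: cs|exact/ch/inD].
    - move=> w wr w0 _; have [||l dl] := dh (r'%:C * w); [exact: inD|exact: mulf_neq0|].
      by eexists; apply: cdiffV; [exact/hn0/inD|exact: cdiff_scale dl].
    - move=> w w1; have wr : normc w < r'^-1 by rewrite w1.
      have w0 : r'%:C * w != 0 by rewrite mulf_neq0// -normc_gt0 w1.
      have rw : normc (r'%:C * w) = r' by rewrite normcM normc_real w1 mulr1 gtr0_norm.
      rewrite normcV lef_pV2 ?posrE// ?normc_gt0 ?hn0 ?inD// hE// normcM normcV rw.
      rewrite ler_pdivlMr// ltW//; apply: (@le_lt_trans _ _ s).
        by apply: ler_piMr; exact: ltW.
      rewrite ltNge; apply/negP => /(rP _ (inD _ wr)).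
      by rewrite rw leNgt rr'.
  rewrite mulr0 /h /diffquot eqxx normcV lef_pV2 ?posrE// normc_gt0//.
have a1 : 1 <= normc a.
  rewrite leNgt; apply/negP => a1; have := normc_ge0 a => na0.
  suff : (1 + normc a) / 2 <= normc a by lra.
  by apply: sa; lra.
have F1' z : normc z < 1 -> normc (F z) <= 1 by move=> /F1/ltW.
have FE := schwarz dF F1' F0 dF0 a1.
split=> //; apply/eqP; rewrite eq_le a1 andbT leNgt; apply/negP => ai.
(* If [|a| > 1], the point [1 / a] of the disc would be sent to 1. *)
have a'1 : normc a^-1 < 1 by rewrite normcV invf_lt1// (lt_trans _ ai).
by have := F1 a'1; rewrite FE// mulfV// normc1 ltxx.
Qed.

End bijective.

(** A diagonal matrix acts by [v / conj v], which is [v^2] for [v] of modulus 1. *)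
Lemma mob_rotation v z : su v 0 -> mob v 0 z = v ^+ 2 * z.
Proof.
rewrite /su rmorph0 mulr0 subr0 => vv.
have v0 : v^* != 0 by apply/eqP => v0; move/eqP: vv; rewrite v0 mulr0 eq_sym oner_eq0.
rewrite /mob rmorph0 mul0r add0r addr0.
apply: (mulIf v0); rewrite divfK//.
have -> : v ^+ 2 * z * v^* = (v * v^*) * (v * z) by ring.
by rewrite vv mul1r.
Qed.

Lemma rotation_mob (a : C) : normc a = 1 -> exists2 v, su v 0 & v ^+ 2 = a.
Proof.
move=> a1; exists (sqrtc a); last exact: sqr_sqrtc.
have : normc (sqrtc a) ^+ 2 == 1 ^+ 2 by rewrite -normcX sqr_sqrtc a1 expr1n.
rewrite eqrXn2 ?normc_ge0// => /eqP v1.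
by rewrite /su rmorph0 mulr0 subr0 mulcJ v1 expr1n.
Qed.

(* Recentring at a point where the derivative does not vanish avoids proving
   that it never vanishes. *)
Lemma bijective_mob f : holo_disc f -> (forall z, normc z < 1 -> normc (f z) < 1) ->
  (forall z w, normc z < 1 -> normc w < 1 -> f z = f w -> z = w) ->
  (forall w, normc w < 1 -> exists2 z, normc z < 1 & f z = w) ->
  exists al be, su al be /\ forall z, normc z < 1 -> f z = mob al be z.
Proof.
move=> df f1 injf surjf.
have [p p1 dp] : exists2 p, normc p < 1 & ~ cdiff f p 0.
  (* Otherwise [f] would be constant, against injectivity at the points 0 and 1/2. *)
  apply: contrapT => h.
  have h1 : normc ((2^-1)%:C : C) < 1.
    by rewrite normc_real gtr0_norm ?invr_gt0// invf_lt1// ltr1n.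
  have /(injf _ _ h1) : f (2^-1)%:C = f 0.
    apply: cdiff0_constant h1 => w w1; apply: contrapT => dw; apply: h; by exists w.
  rewrite normc0 => /(_ ltr01) /eqP.
  by rewrite (fmorph_eq0 (real_complex R)) invr_eq0 pnatr_eq0.
have [al1 [be1 [s1 m1]]] := mob_to0 (f1 _ p1).
have [al2 [be2 [s2 m2]]] := mob_to0 p1.
pose F z := mob al1 be1 (f (mob al2^* (- be2) z)).
have s1' := su_inv s1; have s2' := su_inv s2.
have fE w : normc w < 1 -> f w = mob al1^* (- be1) (F (mob al2 be2 w)).
  by move=> w1; rewrite /F (mobK s2 (ltW w1)) (mobK s1 (ltW (f1 _ w1))).
have F0 : F 0 = 0.
  by rewrite /F (_ : mob al2^* (- be2) 0 = p)// -m2 (mobK s2 (ltW p1)).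
have dF : holo_disc F.
  move=> z z1; have [l2 d2] := cdiff_mob s2' (ltW z1).
  have [l d] := df _ (mob_disc s2' z1).
  have [l1 d1] := cdiff_mob s1 (ltW (f1 _ (mob_disc s2' z1))).
  by eexists; exact: cdiff_comp (cdiff_comp d2 d) d1.
have F1 z : normc z < 1 -> normc (F z) < 1.
  by move=> z1; apply: mob_disc s1 (f1 _ (mob_disc s2' z1)).
have n01 : normc (0 : C) < 1 by rewrite normc0.
have injF z w : normc z < 1 -> normc w < 1 -> F z = F w -> z = w.
  move=> z1 w1 /(congr1 (mob al1^* (- be1))).
  rewrite /F !(mobK s1) ?ltW ?f1 ?mob_disc// => /injf; rewrite !mob_disc// => /(_ isT isT).
  by move=> /(congr1 (mob al2 be2)); rewrite !mobVK ?ltW.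
have surjF w : normc w < 1 -> exists2 z, normc z < 1 & F z = w.
  move=> w1; have [z z1 zE] := surjf _ (mob_disc s1' w1).
  by exists (mob al2 be2 z); [exact: mob_disc|rewrite /F mobK ?ltW// zE mobVK ?ltW].
have [a da] := dF 0 n01.
have a0 : a != 0.
  apply/eqP => a0; apply: dp; rewrite a0 in da.
  have [l2 d2] := cdiff_mob s2 (ltW p1).
  have {}da : cdiff F (mob al2 be2 p) 0 by rewrite m2.
  have [l1 d1] := cdiff_mob s1' (ltW (F1 _ (mob_disc s2 p1))).
  have d := cdiff_comp (cdiff_comp d2 da) d1.
  rewrite mul0r mulr0 in d.
  apply: near_cdiff d; apply/nbhs_normc; exists (1 - normc p); rewrite ?subr_gt0// => w wp.
  by rewrite fE//; move: wp; have := normc_subr w p; lra.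
have [a1 FE] := bijective_rotation dF F1 injF surjF F0 da a0.
have [v sv va] := rotation_mob a1.
(* First row of the matrix product of the inverse of the first recentring, the rotation, and the
   second recentring. *)
exists ((al1^* * v + - be1 * 0^*) * al2 + (al1^* * 0 + - be1 * v^*) * be2^*).
exists ((al1^* * v + - be1 * 0^*) * be2 + (al1^* * 0 + - be1 * v^*) * al2^*).
have sm := su_mul s1' sv; split; first exact: su_mul.
move=> z z1; rewrite fE// FE ?mob_disc// -va -mob_rotation//.
by rewrite mob_comp// ?ltW// ?mob_disc// mob_comp// ltW.
Qed.

End disc_automorphisms.

(** * Mixing *)

Section moebius_dynamics.
Variable R : realType.
Local Notation C := R[i].
Local Notation Re := (@complex.Re R).
Local Notation Im := (@complex.Im R).
Implicit Types (al be z w : C).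

(** With [y = Im al], a point [z = i c / conj be], [c] real, is fixed when
    [c^2 - 2 y c + |be|^2 = 0]. If [x = Re al] satisfies [|x| < 1], the discriminant is positive
    because [y^2 - |be|^2 = 1 - x^2]; the roots [y - q] and [y + q] have product [|be|^2], so the
    smaller one in absolute value gives a fixed point in the disc. *)
Lemma mob_no_fixed_point al be : su al be ->
  (forall z, normc z < 1 -> mob al be z <> z) -> be != 0 /\ 1 <= `|Re al|.
Proof.
move=> s nofix; split.
  apply/eqP => be0; apply: (nofix 0); first by rewrite normc0.
  by rewrite be0 /mob mulr0 addr0 mul0r.
rewrite leNgt; apply/negP => x1.
have be0 : be != 0.
  apply/eqP => be0; apply: (nofix 0); first by rewrite normc0.
  by rewrite be0 /mob mulr0 addr0 mul0r.
set x := Re al in x1; pose y := Im al.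
have b0 : 0 < normc be by rewrite normc_gt0.
have b2 : normc be ^+ 2 = x ^+ 2 + y ^+ 2 - 1.
  by have := su_norm s; rewrite normcE2 -/x -/y => ->; rewrite addrC addKr.
have x21 : x ^+ 2 < 1.
  by rewrite -[x ^+ 2]real_normK ?num_real// expr_lt1.
have [c c2 cb] : exists2 c, c ^+ 2 - 2 * y * c + normc be ^+ 2 = 0 & c ^+ 2 < normc be ^+ 2.
  pose q := Num.sqrt (1 - x ^+ 2).
  have q0 : 0 < q by rewrite sqrtr_gt0 subr_gt0.
  have q2 : q ^+ 2 = 1 - x ^+ 2 by rewrite sqr_sqrtr// subr_ge0 ltW.
  have bq : normc be ^+ 2 = (y - q) * (y + q) by rewrite -subr_sqr q2 b2; ring.
  have bq0 : 0 < (y - q) * (y + q) by rewrite -bq exprn_gt0.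
  have [y0|y0] := leP 0 y.
    exists (y - q); first by rewrite bq; ring.
    by rewrite bq expr2; nra.
  exists (y + q); first by rewrite bq; ring.
  by rewrite bq expr2; nra.
have bJ : be^* != 0 by rewrite -normc_gt0 normc_conj.
pose z := (0 +i* c) / be^*.
have z1 : normc z < 1.
  rewrite /z normcM normcV normc_conj ltr_pdivrMr// mul1r.
  rewrite -(@ltr_pXn2r _ 2) ?nnegrE ?normc_ge0//.
  by rewrite normcE2/= expr0n/= add0r.
apply: (nofix z z1); have d := mob_den s (ltW z1).
apply: (mulIf d); rewrite /mob divfK//.
apply: (mulIf bJ); rewrite mulrDl mulcJ.
have zb : z * be^* = 0 +i* c by rewrite /z divfK.
rewrite [LHS](_ : _ = al * (z * be^*) + (normc be ^+ 2)%:C); last by ring.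
rewrite [RHS](_ : _ = (z * be^*) * (z * be^* + al^*)); last by ring.
rewrite zb; have alJ : Re al^* = x /\ Im al^* = - y by rewrite /x /y; case: (al).
case: alJ => xE yE.
apply: complex_ext; rewrite ?(cReD, cImD, cReM, cImM) xE yE /= -/x -/y; lra.
Qed.

Let iter_step (t u v : R) n : 2 <= `|t| -> 1 <= `|u| - `|v| -> n%:R <= `|u| ->
  1 <= `|t * u - v| - `|u| /\ n.+1%:R <= `|t * u - v|.
Proof.
move=> t2 uv nu; have := lerB_normD (t * u) (- v); rewrite normrN normrM.
have : 2 * `|u| <= `|t| * `|u| by rewrite ler_wpM2r.
by rewrite -natr1; split; lra.
Qed.

(* The powers of a matrix of determinant 1 are given by the Chebyshev
   recursion [u_(n+1) = tr * u_n - u_(n-1)], of growth at least linear when the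
   trace is at least 2 in absolute value. *)
Lemma iter_mob al be n : su al be -> 1 <= `|Re al| -> exists u v : R,
  [/\ 1 <= `|u| - `|v|, n.+1%:R <= `|u|, su (u%:C * al - v%:C) (u%:C * be) &
  forall z, normc z <= 1 ->
    iter n.+1 (mob al be) z = mob (u%:C * al - v%:C) (u%:C * be) z].
Proof.
move=> s al1; elim: n => [|n [u [v [uv nu suv IH]]]].
  exists 1, 0; split; rewrite ?normr1 ?normr0 ?subr0 ?rmorph1 ?mul1r//.
have t2 : 2 <= `|2 * Re al| by rewrite normrM ger0_norm// ler_peMr.
have [h1 h2] := iter_step t2 uv nu.
have cr (r : R) : (r%:C : C)^* = r%:C by exact: conjc_real.
have tE : (2 : R)%:C * (Re al)%:C = al + al^*.
  by rewrite -(rmorphM (real_complex R)); apply: complex_ext; case: (al) => p q /=; rewrite ?subrr//; ring.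
have aE : al * (u%:C * al - v%:C) + be * (u%:C * be)^* =
    (2 * Re al * u - v)%:C * al - u%:C.
  rewrite !(rmorphM, rmorphB)/= cr tE.
  have -> : be * (u%:C * be^*) = u%:C * (al * al^* - (al * al^* - be * be^*)) by ring.
  by rewrite s; ring.
have bE : al * (u%:C * be) + be * (u%:C * al - v%:C)^* = (2 * Re al * u - v)%:C * be.
  rewrite !(rmorphM, rmorphB)/= !cr tE; ring.
exists (2 * Re al * u - v), u; split=> //.
  by rewrite -aE -bE; exact: su_mul.
by move=> z z1; rewrite iterS IH// mob_comp// aE bE.
Qed.

(** If the iterate has matrix entries [A] and [B], it sends 0 to [B / conj A], whence [1 - |B / A|^2
    = 1 / |A|^2 = 1 / (1 + |B|^2)], and [|B| = |u| |be|] grows at least linearly. *)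
Lemma iter_mob_escape al be d : su al be -> be != 0 -> 1 <= `|Re al| -> 0 < d ->
  exists k0, forall k, (k0 <= k)%N ->
  normc (iter k (mob al be) 0) < 1 /\ 1 - normc (iter k (mob al be) 0) ^+ 2 < d.
Proof.
move=> s be0 al1 d0; have b0 : 0 < normc be ^+ 2 by rewrite exprn_gt0 ?normc_gt0.
have [m mlt] : exists m, (d * normc be ^+ 2)^-1 < m%:R.
  by exists (Num.bound (d * normc be ^+ 2)^-1); apply: archi_boundP; rewrite invr_ge0 mulr_ge0// ltW.
exists m.+1 => -[//|k]; rewrite ltnS => mk.
have [u [v [uv nu suv ->]]] := iter_mob k s al1; last by rewrite normc0.
have n01 : normc (0 : C) < 1 by rewrite normc0.
split; first exact: mob_disc.
set A := u%:C * al - v%:C in suv *; set B := u%:C * be in suv *.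
have B2 : (d^-1) < normc B ^+ 2.
  rewrite /B normcM normc_real exprMn -ltr_pdivrMr//.
  rewrite -invfM (lt_le_trans mlt)// (le_trans (_ : _ <= k.+1%:R))//.
    by rewrite ler_nat (leq_trans mk).
  have : (1 : R) <= k.+1%:R by rewrite ler1n.
  by move: nu; rewrite expr2; nra.
have A2 := su_norm suv.
have A20 : 0 < normc A ^+ 2 by rewrite A2 ltr_pwDl// sqr_ge0.
rewrite /mob !mulr0 add0r add0r normcM normcV normc_conj exprMn exprVn.
have -> : 1 - normc B ^+ 2 / normc A ^+ 2 = (normc A ^+ 2)^-1.
  by rewrite -{1}(mulfV (lt0r_neq0 A20)) -mulrBl A2 addrK mul1r.
rewrite -[d]invrK ltf_pV2 ?posrE ?invr_gt0//.
by rewrite A2 (lt_trans B2)// ltrDr.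
Qed.

End moebius_dynamics.

(** * Mixing for Moebius maps without fixed point in the disc *)

Section moebius_mixing.
Variable R : realType.
Local Notation C := R[i].
Local Notation lam := (@circle_measure R).
Local Notation T := (circle R).
Local Notation L2c := (L2 lam).
Implicit Types (al be z w : C) (xi : T) (phi psi chi : L2c).

Let n01 : normc (0 : C) < 1. Proof. by rewrite normc0. Qed.

Let measurable_dist z : measurable_fun setT (fun xi : T => normc (cval xi - z)).
Proof.
suff [] : bmr (fun xi : T => normc (cval xi - z)) by [].
apply: bmc_normc; apply: (@bmc_circle _ (fun w => w - z)) => w _.
by apply: contB; [exact: cont_id|exact: cont_cst].
Qed.

Let measurable_cap z (e : R) : measurable [set xi : T | normc (cval xi - z) < e].
Proof.
have := measurable_dist z measurableT (measurable_itv `]-oo, e[%R).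
by rewrite setTI.
Qed.

Let integral_pk z : normc z < 1 -> (\int[lam]_xi (pk z xi)%:E = 1)%E.
Proof.
move=> z1; rewrite -(Rint_pk z1) /Rintegral fineK//.
by apply: integrable_fin_num => //; exact/bmr_integrable/bmr_pk.
Qed.

Let cap_bound (e n q : R) : 0 < e -> 0 <= n -> n <= 1 - e -> q <= (2 * e) ^+ 2 ->
  q <= 4 * e * (1 - n ^+ 2).
Proof.
move=> e0 n0 ne qe; have : n ^+ 2 <= n by rewrite expr2 ler_piMl//; lra.
move=> n2; have : 4 * e * e <= 4 * e * (1 - n ^+ 2) by rewrite ler_pM2l ?mulr_gt0//; lra.
lra.
Qed.

Let lt_fifth (x y : R) : 0 < y -> x <= y / 5 -> 4 * x < y.
Proof. lra. Qed.

(* Compare with the Poisson kernel at the point [(1 - e) z], which is at least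
   [1 / (4 e)] on the cap. *)
Lemma circle_measure_cap z (e : R) : normc z < 1 -> 0 < e -> e <= 1 ->
  (lam [set xi | (normc (cval xi - z) < e)%R] <= (4 * e)%:E)%E.
Proof.
move=> z1 e0 e1; set A := [set xi | _].
have mA : measurable A by exact: measurable_cap.
pose w := (1 - e)%:C * z.
have nz := normc_ge0 z.
have wE : normc w = (1 - e) * normc z by rewrite normcM normc_real ger0_norm// subr_ge0.
have we : normc w <= 1 - e by rewrite wE ler_piMr ?subr_ge0// ltW.
have w1 : normc w < 1 by lra.
have w0 := normc_ge0 w.
have lowpk xi : normc (cval xi - z) < e -> 1 <= 4 * e * pk w xi.
  move=> xz; have xw : normc (cval xi - w) < 2 * e.
    have -> : cval xi - w = (cval xi - z) + e%:C * z.
      by rewrite /w (rmorphB (real_complex R)) rmorph1; ring.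
    apply: le_lt_trans (le_normcD _ _) _; rewrite normcM normc_real gtr0_norm//.
    by nra.
  have xw0 := circle_sub_gt0 xi w1.
  rewrite /pk mulrA ler_pdivlMr ?exprn_gt0// mul1r.
  apply: (cap_bound e0 w0 we); apply: lerXn2r (ltW xw); rewrite nnegrE ?normc_ge0//.
  by rewrite mulr_ge0// ltW.
have [mpk _] := bmr_pk w1.
apply: (@le_trans _ _ (\int[lam]_xi ((4 * e)%:E * (pk w xi)%:E))%E).
  rewrite -(setIT A) -integral_indic//; apply: ge0_le_integral => //.
  - by apply/measurable_EFinP; exact: measurable_indic.
  - by apply: emeasurable_funM => //; exact/measurable_EFinP.
  - move=> xi _; rewrite indicE lee_fin; case: (boolP (xi \in A)) => [|_].
      by rewrite inE => /lowpk.
    by rewrite mulr_ge0 ?pk_ge0// mulr_ge0// ltW.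
rewrite ge0_integralZl//.
- by rewrite integral_pk// mule1.
- exact/measurable_EFinP.
- by move=> xi _; rewrite lee_fin pk_ge0.
- by rewrite lee_fin mulr_ge0// ltW.
Qed.

(* Vanishing on a small cap around [z] costs little in norm, and off the cap the
   Poisson kernel of [z] is small. *)
Lemma L2_cutoff phi (e : R) : 0 < e -> exists2 d : R, 0 < d &
  forall z, normc z < 1 -> 1 - normc z ^+ 2 < d -> exists2 phi' : L2c,
    nrm (phi' - phi) < e &
    (\int[lam]_xi ((normc (phi' xi) ^+ 2)%:E * (pk z xi)%:E) < (e ^+ 2)%:E)%E.
Proof.
move=> e0; have e20 : 0 < e ^+ 2 by rewrite exprn_gt0.
have iphi : lam.-integrable setT (EFin \o (fun xi => normc (phi xi) ^+ 2)).
  apply/integrableP; split; first exact: measurable_sqr.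
  under eq_integral do rewrite gee0_abs ?lee_fin ?sqr_ge0//.
  by rewrite -nrm_sqr ltry.
have [delta [delta0 deltaP]] := integral_normr_continuous iphi e20.
(* The bound wanted for the Poisson kernel off the cap; the added 1 makes
   [c * nrm phi ^+ 2 < e ^+ 2] strict and the denominator positive. *)
pose c := e ^+ 2 / (nrm phi ^+ 2 + 1).
have I0 : 0 < nrm phi ^+ 2 + 1 by rewrite ltr_wpDl// sqr_ge0.
have c0 : 0 < c by rewrite divr_gt0.
have cI : c * nrm phi ^+ 2 < e ^+ 2.
  by rewrite /c mulrAC ltr_pdivrMr// ltr_pM2l// ltrDl.
(* The cap of radius [eta] has measure at most [4 eta < delta], for which [deltaP] bounds the lost
   part of [phi]; [eta <= 1] is needed by [circle_measure_cap]. *)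
pose eta := Num.min 1 (delta / 5).
have eta0 : 0 < eta by rewrite lt_min ltr01 divr_gt0.
have eta1 : eta <= 1 by rewrite ge_min lexx.
have eta_delta : 4 * eta < delta.
  by apply: lt_fifth => //; rewrite ge_min lexx orbT.
(* Off the cap the kernel is at most [(1 - |z|^2) / eta^2], hence at most [c]. *)
exists (c * eta ^+ 2) => [|z z1 zd]; first by rewrite mulr_gt0// exprn_gt0.
pose A := [set xi : T | normc (cval xi - z) < eta].
have mA : measurable A by exact: measurable_cap.
pose u xi := if normc (cval xi - z) < eta then 0 else phi xi.
have mphi := L2_measurable phi.
have mu : measurable_fun setT u.
  have mb : measurable_fun setT (fun xi : T => normc (cval xi - z) < eta).
    by apply: measurable_fun_ltr => //; exact: measurable_dist.
  exact: (measurable_fun_ifc mb (measurable_cst (0 : C)) mphi).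
have u_le xi : normc (u xi) ^+ 2 <= normc (phi xi) ^+ 2.
  by rewrite /u; case: ifP => _//; rewrite normc0 expr0n/= sqr_ge0.
have mu2 : measurable_fun setT (fun xi => (normc (u xi) ^+ 2)%:E).
  by apply/measurable_EFinP; apply: measurable_funX; exact: measurable_normc.
have [|phi' phi'E] := mkL2 mu.
  apply: (@le_lt_trans _ _ (\int[lam]_xi (normc (phi xi) ^+ 2)%:E)%E); last by rewrite -nrm_sqr ltry.
  apply: ge0_le_integral => //; first by move=> xi _; rewrite lee_fin sqr_ge0.
  - exact: measurable_sqr.
  - by move=> xi _; rewrite lee_fin.
exists phi'.
  rewrite -(@ltr_pXn2r _ 2) ?nnegrE ?nrm_ge0 ?ltW//.
  have pp : {ae lam, forall xi, phi xi = phi xi} by apply/nearW.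
  have <- : \int[lam]_(xi in A) `|normc (phi xi) ^+ 2| = nrm (phi' - phi) ^+ 2.
    transitivity (fine (nrm (phi' - phi) ^+ 2)%:E)=> //.
    rewrite (nrm_subE mu mphi phi'E pp) /Rintegral integral_mkcond; congr fine.
    apply: eq_integral => xi _; rewrite patchE ger0_norm ?sqr_ge0// /u.
    case: ifPn => [|xiA].
      by rewrite inE /A/= => ->; rewrite sub0r normcN.
    case: ifPn => h; last by rewrite subrr normc0 expr0n.
    by move: xiA; rewrite notin_setE /A/= h.
  apply: deltaP => //; apply: le_lt_trans (circle_measure_cap z1 eta0 eta1) _.
  by rewrite lte_fin.
have [mpk _] := bmr_pk z1.
have pkc xi : eta <= normc (cval xi - z) -> pk z xi <= c.
  move=> xz; rewrite /pk ler_pdivrMr ?exprn_gt0 ?circle_sub_gt0// (le_trans (ltW zd))//.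
  by rewrite ler_pM2l// lerXn2r ?nnegrE ?normc_ge0// ltW.
rewrite (_ : (\int[lam]_xi _ = \int[lam]_xi ((normc (u xi) ^+ 2)%:E * (pk z xi)%:E))%E); last first.
  apply: ae_eq_integral => //.
  - by apply: emeasurable_funM; [exact: measurable_sqr|exact/measurable_EFinP].
  - by apply: emeasurable_funM => //; exact/measurable_EFinP.
  - by apply: filterS phi'E => xi -> _.
apply: (@le_lt_trans _ _ (\int[lam]_xi (c%:E * (normc (phi xi) ^+ 2)%:E))%E).
  apply: ge0_le_integral => //.
  - by move=> xi _; rewrite mule_ge0// lee_fin ?sqr_ge0// pk_ge0.
  - by apply: emeasurable_funM => //; exact/measurable_EFinP.
  - by apply: emeasurable_funM => //; exact: measurable_sqr.
  - move=> xi _; rewrite lee_fin /u; case: ifPn => [_|].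
      by rewrite normc0 expr0n/= mul0r mulr_ge0 ?sqr_ge0// ltW.
    by rewrite -leNgt => /pkc h; rewrite mulrC ler_wpM2r ?sqr_ge0.
rewrite ge0_integralZl//.
- by rewrite -nrm_sqr -EFinM lte_fin.
- exact: measurable_sqr.
- by move=> xi _; rewrite lee_fin sqr_ge0.
- by rewrite lee_fin ltW.
Qed.

(** Radial limits see [f] only inside the disc, and [mob] is continuous up to the circle. The
    equality holds everywhere, so [f] and [mob al be] have literally the same composition operator,
    whatever [f] is outside of the disc. *)
Lemma boundary_map_mob f al be (s : su al be) :
  (forall z, normc z < 1 -> f z = mob al be z) -> boundary_map f = mobT s.
Proof.
move=> fE; apply/funext => xi; apply: cval_inj.
have lim : radial f xi r @[r --> 1^'-] --> mob al be (cval xi).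
  have x1 : normc (cval xi) <= 1 by rewrite normc_circle.
  have [l dl] := cdiff_mob s x1.
  have cr : {for (1 : R), continuous (fun r : R => mob al be (r%:C * cval xi))}.
    apply: (@continuous_comp _ _ _ (fun r : R => r%:C * cval xi) (mob al be)).
      by apply: contM; [exact: real_complex_cont|exact: cont_cst].
    by rewrite mul1r; exact: cdiff_cont dl.
  rewrite /prop_for /continuous_at mul1r in cr.
  have {}cr : mob al be (r%:C * cval xi) @[r --> 1^'-] --> mob al be (cval xi).
    by apply: cvg_trans cr; apply: cvg_app; exact: cvg_within.
  apply: cvg_trans cr; apply: near_eq_cvg.
  near=> r; rewrite /radial fE// normcM normc_circle mulr1 normc_real.
  by rewrite ger0_norm; near: r; [exact: nbhs_left_lt|exact: nbhs_left_ge].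
rewrite /cval /boundary_map val_insubd /radial_limit (cvg_lim _ lim)//.
by rewrite normrcE mob_circle ?normc_circle// eqxx.
Unshelve. all: by end_near. Qed.

Lemma mob_mixing al be : su al be -> be != 0 -> 1 <= `|complex.Re al| ->
  topologically_mixing (comp_op (mob al be)).
Proof.
move=> s be0 al1; pose s' := su_inv s.
have be0' : - be != 0 by rewrite oppr_eq0.
have al1' : 1 <= `|complex.Re al^*| by case: (al) al1.
have bg c e (t : su c e) : bvals (mob c e) (mobT t) /\
    {ae lam, forall xi, boundary_map (mob c e) xi = mobT t xi}.
  split; first exact: (bvals_mob t (@bvals_id R)).
  by apply/nearW => xi; rewrite (@boundary_map_mob (mob c e) _ _ t).
have [b1 g1] := bg _ _ s; have [b2 g2] := bg _ _ s'.
set A := comp_op (mob al be); pose B := comp_op (mob al^* (- be)).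
have AB psi : A (B psi) = psi.
  apply: L2_ext.
  have h1 : {ae lam, forall xi, A (B psi) xi = B psi (mobT s xi)} := comp_opE b1 g1 (B psi).
  (* The description of [B psi] holds almost everywhere and is evaluated at [mobT s xi], so
     nonsingularity is needed. *)
  have h2 : {ae lam, forall xi, B psi (mobT s xi) = psi (mobT s' (mobT s xi))}.
    exact: (bvals_nonsingular b1 (P := fun eta => B psi eta = psi (mobT s' eta)) (comp_opE b2 g2 psi)).
  suff h xi : A (B psi) xi = B psi (mobT s xi) /\
      B psi (mobT s xi) = psi (mobT s' (mobT s xi)) -> A (B psi) xi = psi xi.
    exact: (filterS h (filterI h1 h2)).
  move=> [E1 E2]; by rewrite E1 E2 mobTK.
have AkD k phi psi : iter k A (phi + psi) = iter k A phi + iter k A psi.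
  by elim: k => // k IH; rewrite !iterS IH /A (comp_opD b1 g1).
have AkB k psi : iter k A (iter k B psi) = psi.
  by elim: k psi => // k IH psi; rewrite iterSr iterS AB IH.
have norm_iter c e (t : su c e) k phi :
    ((nrm (iter k (comp_op (mob c e)) phi) ^+ 2)%:E =
     \int[lam]_xi ((normc (phi xi) ^+ 2)%:E * (pk (iter k (mob c e) 0) xi)%:E))%E.
  have [b g] := bg _ _ t.
  (* The base point is general because each step of the induction moves it by [mob c e]; only
     [z = 0], where the weight is 1, gives the norm. *)
  have key z : normc z < 1 ->
      (\int[lam]_xi ((normc (iter k (comp_op (mob c e)) phi xi) ^+ 2)%:E * (pk z xi)%:E) =
       \int[lam]_xi ((normc (phi xi) ^+ 2)%:E * (pk (iter k (mob c e) z) xi)%:E))%E.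
    elim: k z => // k IH z z1; rewrite iterS (comp_op_nrm b g _ z1) IH ?iterSr//.
    exact: mob_disc.
  by rewrite nrm_sqr -key//; apply: eq_integral => xi _; rewrite pk0 mule1.
apply: mixing_nrm => phi psi e e0.
have e20 : 0 < e / 2 by rewrite divr_gt0.
have [d1 d10 c1] := L2_cutoff phi e20.
have [d2 d20 c2] := L2_cutoff psi e20.
have [k1 k1P] := iter_mob_escape s be0 al1 d10.
have [k2 k2P] := iter_mob_escape s' be0' al1' d20.
have small c h (t : su c h) k chi :
    (\int[lam]_xi ((normc (chi xi) ^+ 2)%:E * (pk (iter k (mob c h) 0) xi)%:E) < ((e / 2) ^+ 2)%:E)%E ->
    nrm (iter k (comp_op (mob c h)) chi) < e / 2.
  rewrite -(norm_iter _ _ t) lte_fin ltr_pXn2r// nnegrE ?nrm_ge0//; exact: ltW.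
exists (maxn k1 k2) => k; rewrite geq_max => /andP[/k1P[z1 zd] /k2P[w1 wd]].
have [phi' phi'1 /(small _ _ s) phi'2] := c1 _ z1 zd.
have [psi' psi'1 /(small _ _ s') psi'2] := c2 _ w1 wd.
exists (phi' + iter k B psi'); split.
  rewrite addrAC; apply: le_lt_trans (nrmD _ _) _.
  rewrite (splitr e); apply: ltrD; [exact: phi'1|exact: psi'2].
rewrite AkD AkB -addrA; apply: le_lt_trans (nrmD _ _) _.
rewrite (splitr e); apply: ltrD; [exact: phi'2|exact: psi'1].
Qed.

End moebius_mixing.

(** * The implications between the three conditions *)

Section theorem_parts.
Variable R : realType.
Local Notation C := R[i].
Implicit Types (z w a : C) (f : C -> C).

Let discE z : disc z = (normc z < 1).
Proof. by rewrite /disc/= normrcE (ltcR _ 1). Qed.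

Lemma automorphism_mob f : inner f -> automorphism f ->
  exists al be, su al be /\ forall z, normc z < 1 -> f z = mob al be z.
Proof.
move=> /inner_bvals[g [df f1 _ _] _] [_ [_ inj surj]]; apply: bijective_mob => //.
  move=> z w; rewrite -!discE => z1 w1; apply: inj; exact: mem_set.
by move=> w; rewrite -discE => /surj[z z1 zE]; exists z => //; rewrite -discE.
Qed.

Lemma automorphism_mixing f : inner f -> automorphism f ->
  ~ (exists z, disc z /\ f z = z) -> topologically_mixing (comp_op f).
Proof.
move=> fi fa nofix; have [al [be [s fE]]] := automorphism_mob fi fa.
have [|be0 al1] := mob_no_fixed_point s.
  by move=> z z1 zE; apply: nofix; exists z; rewrite discE z1 fE.
suff -> : comp_op f = comp_op (mob al be) by exact: mob_mixing.
by apply/funext => phi; rewrite /comp_op !(@boundary_map_mob _ _ _ _ s).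
Qed.

Lemma mixing_transitive (X : topologicalType) (A : X -> X) :
  topologically_mixing A -> topologically_transitive A.
Proof.
by move=> mA U V oU oV U0 V0; have [k kP] := mA U V oU oV U0 V0; exists k; exact: kP.
Qed.

Lemma transitive_automorphism f : inner f -> topologically_transitive (comp_op f) ->
  automorphism f.
Proof.
move=> fi tr; split; first by case: fi.
have [g fg bg] := inner_bvals fi; have [df f1 _ _] := fg.
have n01 : normc (0 : C) < 1 by rewrite normc0.
have [al [be [s fb]]] := mob_to0 (f1 0 n01).
have [a a1 fa] := transitive_moebius fg bg tr s fb.
have a0 : a != 0 by rewrite -normc_gt0 a1.
split=> [z|z w|w].
- by rewrite /= !discE; exact: f1.
- rewrite !inE !discE => z1 w1 E; apply: (mulfI a0).
  by rewrite -!fa// E.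
- rewrite /= discE => w1; have m1 := mob_disc s w1.
  have z1 : normc (a^-1 * mob al be w) < 1 by rewrite normcM normcV a1 invr1 mul1r.
  (* The preimage is found by solving [mob al be w = a * z]. *)
  exists (a^-1 * mob al be w); first by rewrite discE.
  have := fa _ z1; rewrite mulVKf// => /(congr1 (mob al^* (- be))).
  by rewrite !mobK// ltW// f1.
Qed.

End theorem_parts.

Theorem theorem3p3 (R : realType) (f : R[i] -> R[i]) (finner : inner f) :
  (topologically_transitive (comp_op f) <-> topologically_mixing (comp_op f)) /\
  (topologically_mixing (comp_op f) <->
     automorphism f /\ ~ exists z : R[i], disc z /\ f z = z).
Proof.
have fwd : topologically_transitive (comp_op f) ->
    automorphism f /\ ~ exists z : R[i], disc z /\ f z = z.
  move=> tr; split; first exact: transitive_automorphism.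
  have [g fg bg] := inner_bvals finner.
  exact: transitive_no_fixed_point fg bg tr.
have bwd : automorphism f /\ (~ exists z : R[i], disc z /\ f z = z) ->
    topologically_mixing (comp_op f).
  by move=> [fa nofix]; exact: automorphism_mixing.
split; split; [by move=> /fwd/bwd|exact: mixing_transitive|by move=> /mixing_transitive/fwd|exact: bwd].
Qed.
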